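(* Let $G$ be a Fuchsian Schottky group of genus $g$. Then $G$ is classical on all possible generating sets (that is, for every choice of $g$ elements $A_1,\dots,A_g$ generating $G$, the group $G$ is a classical Schottky group on the generators $A_1,\dots,A_g$) if and only if $g=2$ and $G$ is generated by a pair of hyperbolic elements with intersecting axes.
   Context: A Schottky group of genus $g$ is a group of Möbius transformations of the Riemann sphere $\overline{\mathbb C}$ generated by $g$ elements $A_1,\dots,A_g$ for which there exist $2g$ mutually disjoint Jordan curves $C_1,C_1',\dots,C_g,C_g'\subseteq\overline{\mathbb C}$ such that $A_i(C_i)=C_i'$ and $A_i$ maps the outside of $C_i$ onto the inside of $C_i'$ for each $i$. Here the $2g$ curves have a common exterior region: each curve has a designated complementary component (its inside, the other component being its outside), and the $2g$ insides have pairwise disjoint closures. One says the group is Schottky on the generators $A_1,\dots,A_g$. Such a group is automatically free of rank $g$ on $A_1,\dots,A_g$, discrete, and all its nontrivial elements are loxodromic (including hyperbolic). If all the Jordan curves can be taken to be geometric circles in $\overline{\mathbb C}$ (Euclidean circles, or lines together with $\infty$), the group is called a classical Schottky group on the generators $A_1,\dots,A_g$. A Fuchsian group is a discrete subgroup of $PSL(2,\mathbb R)$, acting on $\overline{\mathbb C}$ and preserving the upper half plane $U$. A Fuchsian Schottky group of genus $g$ is a Fuchsian group that is a Schottky group of genus $g$ on some set of $g$ generators. The axis of a hyperbolic element of $PSL(2,\mathbb R)$ is the hyperbolic geodesic in $U$ joining its two fixed points on $\overline{\mathbb R}=\mathbb R\cup\{\infty\}$; a pair of hyperbolic elements has intersecting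 axes if their axes are distinct and meet at a point of $U$.
   Formalization: The genus is assumed to satisfy g ≥ 2; for g = 1 the equivalence is false, since a group generated by one hyperbolic element is classical on each of its generators although g ≠ 2 (and it also fails for the trivial group, g = 0). *)

(* Defs.v *)
From HB Require Import structures.
From mathcomp Require Import all_boot all_order all_algebra.
From mathcomp Require Import all_classical all_reals all_analysis.
From mathcomp Require Import complex.

Set Implicit Arguments.
Unset Strict Implicit.
Unset Printing Implicit Defensive.

Import Order.TTheory GRing.Theory Num.Theory.
Import numFieldNormedType.Exports.

Local Open Scope classical_set_scope.
Local Open Scope complex_scope.
Local Open Scope ring_scope.

(* The usual metric topology of the plane, given by the modulus. *)
HB.instance Definition _ (R : rcfType) := PseudoPointedMetric.copy R[i] R[i]^o.

(* Points are [Some z], for z complex, and [None], which is infinity. *)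
Definition sphere (R : realType) : topologicalType :=
  one_point_compactification R[i].

Section MoebiusGroups.
Variable R : realType.
Local Notation S := (sphere R).

(* The map z |-> (az + b) / (cz + d), for M = [a b; c d]. *)
Definition mobius (M : 'M[R[i]]_2) : S -> S := fun p =>
  match p with
  | Some z => let d := M 1 0 * z + M 1 1 in
              if d == 0 then None else Some ((M 0 0 * z + M 0 1) / d)
  | None => if M 1 0 == 0 then None else Some (M 0 0 / M 1 0)
  end.

Definition is_mobius : set (S -> S) :=
  [set f | exists2 M : 'M[R[i]]_2, \det M != 0 & f = mobius M].

Definition mobius_group (H : set (S -> S)) : Prop :=
  [/\ H `<=` is_mobius,
      H id,
      (forall f h, H f -> H h -> H (f \o h)) &
      (forall f, H f -> exists2 h, H h & cancel f h /\ cancel h f)].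

(* For a set X of Möbius transformations: the group that X generates. *)
Definition generated (X : set (S -> S)) : set (S -> S) :=
  smallest mobius_group X.

(* M and - M give the same transformation: this realises PSL(2, R) as the
   image of SL(2, R). *)
Definition real_mobius (M : 'M[R]_2) : S -> S :=
  mobius (map_mx (real_complex R) M).

Definition PSL2R : set (S -> S) :=
  [set f | exists2 M : 'M[R]_2, \det M = 1 & f = real_mobius M].

(* PSL(2, R) has the quotient topology of SL(2, R) by the finite group
   {1, -1}, so that a subgroup is discrete exactly when its preimage in
   SL(2, R) is a discrete subset of the space of matrices. *)
Definition fuchsian (G : set (S -> S)) : Prop :=
  [/\ mobius_group G, G `<=` PSL2R &
      let P := [set M : 'M[R]_2 | \det M = 1 /\ G (real_mobius M)] in
      P `<=` isolated P].

Definition unit_circle : set R[i] := [set z | `|z| = 1].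

Definition jordan_curve (C : set S) : Prop :=
  exists f : R[i] -> S, [/\ {within unit_circle, continuous f},
    set_inj unit_circle f & f @` unit_circle = C].

Definition geometric_circle (C : set S) : Prop :=
  (exists (c : R[i]) (r : R), 0 < r /\
     C = Some @` [set z : R[i] | `|z - c| = r%:C]) \/
  (exists a b : R[i], b != 0 /\
     C = Some @` [set a + t%:C * b | t in [set: R]] `|` [set None]).

Definition components (A : set S) : set (set S) :=
  [set connected_component A x | x in A].

(* The curve of index (i, false) is C_i and that of index (i, true) is C_i';
   I and O are their insides and outsides. *)
Definition schottky_curves (g : nat) (A : 'I_g -> S -> S)
    (C I O : 'I_g * bool -> set S) : Prop :=
  [/\ trivIset setT C,
      (forall k, I k <> O k /\ components (~` C k) = [set I k; O k]),
      trivIset setT (fun k => closure (I k)) &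
      (forall i, A i @` C (i, false) = C (i, true) /\
                 A i @` O (i, false) = I (i, true))].

Definition schottky_on_with (K : set S -> Prop) (g : nat)
    (A : 'I_g -> S -> S) (G : set (S -> S)) : Prop :=
  [/\ (forall i, is_mobius (A i)), G = generated (range A) &
      exists C I O : 'I_g * bool -> set S,
        (forall k, K (C k)) /\ schottky_curves A C I O].

Definition schottky_on := schottky_on_with jordan_curve.

Definition classical_schottky_on := schottky_on_with
  (fun C => jordan_curve C /\ geometric_circle C).

Definition fuchsian_schottky (g : nat) (G : set (S -> S)) : Prop :=
  fuchsian G /\ exists A : 'I_g -> S -> S, schottky_on A G.

Definition hyperbolic (f : S -> S) : Prop :=
  exists M : 'M[R]_2, [/\ \det M = 1, f = real_mobius M & 2 < `|\tr M|].

Definition upper_half_plane : set R[i] := [set z | 0 < complex.Im z].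

(* The hyperbolic geodesic of the upper half plane that joins two distinct
   points of the extended real line, [None] being infinity. *)
Definition geodesic (p q : option R) : set R[i] := upper_half_plane `&`
  match p, q with
  | Some a, Some b =>
      [set z | `|z - ((a + b) / 2)%:C| = (`|a - b| / 2)%:C]
  | Some a, None | None, Some a => [set z | complex.Re z = a]
  | None, None => set0
  end.

Definition boundary_point (p : option R) : S := omap (real_complex R) p.

(* A hyperbolic f has exactly two fixed points on the extended real line. *)
Definition axis (f : S -> S) : set R[i] :=
  [set z | exists p q : option R,
     [/\ p <> q, f (boundary_point p) = boundary_point p,
         f (boundary_point q) = boundary_point q & geodesic p q z]].

Definition intersecting_axes (f h : S -> S) : Prop :=
  axis f <> axis h /\ axis f `&` axis h !=set0.

End MoebiusGroups.

(* Main.v *)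
(** Real Moebius transformations preserve the extended real line, which a circle
    separating the fixed points of a hyperbolic one crosses. So a classical Schottky
    system of real generators is a family of disjoint intervals in which the
    generators play ping-pong. Let a and b be two of them, and consider the three
    ways of splitting their four fixed points into two pairs: exactly one is linked.
    Accordingly, kappa a b = tr [a, b] - 2 is negative and the axes cross, or
    tr a tr b tr (ab) < 0, or tr a tr b tr (ab^-1) < 0. In the last two cases, the
    pair (a, a^2 b) or (a, a^2 b^-1) satisfies none of the three inequalities. Hence
    if G is classical on all generators, all pairs of generators have crossing axes;
    but of three generators a1, a2, a3, the axis of a1 a2 or of a1 a2^-1 does not
    cross that of a3. So g = 2.

    Conversely, kappa takes the same value on all pairs of generators of a free group
    of rank 2. Indeed, if u and v are words in a and b, then uv - vu is a multiple of
    ab - ba in the algebra spanned by 1, a, b, ab, so that kappa a b divides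
    kappa u v, over any commutative ring; if a and b are also words in u and v, the
    quotient is a unit of C[t] along any polynomial curve of pairs (a, b), hence a
    constant, and it equals 1 on the generators of the quaternion group.
    When the axes of some pair of generators cross, kappa is thus negative on the
    Schottky generators b1 and b2. Their commutator moves a closed Jordan domain into
    its interior, hence is hyperbolic, and kappa < -4. Every pair of generators with
    kappa < -4 is conjugate, up to signs, to a diagonal and a symmetric matrix, for
    which explicit circles exist. *)

From mathcomp Require Import all_boot all_order all_algebra.
From mathcomp Require Import all_classical all_reals all_analysis.
From mathcomp Require Import complex.
From mathcomp Require Import ring lra zify.
Require Import Defs.

Set Implicit Arguments.
Unset Strict Implicit.
Unset Printing Implicit Defensive.

Import Order.TTheory GRing.Theory Num.Theory.
Import numFieldNormedType.Exports.

Local Open Scope classical_set_scope.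
Local Open Scope complex_scope.
Local Open Scope ring_scope.

(** * Two by two matrices and words *)

(** In genus 1 the equivalence fails: the group of a hyperbolic element is classical on either of
    its generators. Genus 2 also gives ping-pong a curve besides the two attached to the ends of a
    word. Traces on PSL(2, R) have no sign, but kappa a b and tr a tr b tr (ab) are even in a and in
    b, so that any lifts to SL(2, R) will do. Inverses are taken as adjugates, in order that words
    can be evaluated over a polynomial ring, where it says something to be a unit. Of a Jordan
    curve, only the two complementary components provided by the definition are used: the union of
    the inside and the curve stands in for the closure of the inside. The explicit circles come from
    a symmetry. The axes of a diagonal and of a symmetric matrix cross at i, and the half-turn z ->
    -1/z about i conjugates both matrices to their inverses. So the four discs are sought in two
    pairs that it exchanges, and kappa < -4 is the only condition left. *)

Lemma ord2P (i : 'I_2) : i = 0 \/ i = 1.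
Proof. by case: i => [[|[|//]] lek]; [left|right]; exact: val_inj. Qed.

Section Mx2.
Variable K : comNzRingType.
Implicit Types a b c d : 'M[K]_2.

Lemma matrix2P a b : a 0 0 = b 0 0 -> a 0 1 = b 0 1 ->
  a 1 0 = b 1 0 -> a 1 1 = b 1 1 -> a = b.
Proof.
move=> h00 h01 h10 h11; apply/matrixP => i j.
by case: (ord2P i) => ->; case: (ord2P j) => ->.
Qed.

Lemma mulmx2E a b i j : (a * b) i j = a i 0 * b 0 j + a i 1 * b 1 j.
Proof.
rewrite mxE !big_ord_recl big_ord0 addr0.
by congr (_ + a i _ * b _ j); exact: val_inj.
Qed.

Lemma det2E a : \det a = a 0 0 * a 1 1 - a 0 1 * a 1 0.
Proof.
rewrite (expand_det_row _ 0) !big_ord_recl big_ord0 addr0 /cofactor !det_mx11.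
rewrite !mxE /= /bump /= expr0 expr1 mul1r mulN1r mulrN.
by congr (a 0 _ * a _ _ - a 0 _ * a _ _); exact: val_inj.
Qed.

Lemma tr2E a : \tr a = a 0 0 + a 1 1.
Proof.
rewrite /mxtrace !big_ord_recl big_ord0 addr0.
by congr (_ + a _ _); exact: val_inj.
Qed.

Definition mx2 (x y z t : K) : 'M[K]_2 :=
  \matrix_(i, j) if i == 0 then if j == 0 then x else y
                 else if j == 0 then z else t.

Lemma mx2E x y z t : (mx2 x y z t 0 0 = x) * (mx2 x y z t 0 1 = y) *
  (mx2 x y z t 1 0 = z) * (mx2 x y z t 1 1 = t).
Proof. by rewrite !mxE. Qed.

Lemma one2E : ((1 : 'M[K]_2) 0 0 = 1) * ((1 : 'M[K]_2) 0 1 = 0) *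
  ((1 : 'M[K]_2) 1 0 = 0) * ((1 : 'M[K]_2) 1 1 = 1).
Proof. by rewrite !mxE. Qed.

Lemma addmx2E a b i j : (a + b) i j = a i j + b i j. Proof. by rewrite mxE. Qed.
Lemma oppmx2E a i j : (- a) i j = - a i j. Proof. by rewrite mxE. Qed.
Lemma scalemx2E (x : K) a i j : (x *: a) i j = x * a i j. Proof. by rewrite mxE. Qed.

Definition mxe2 := (mx2E, one2E, mulmx2E, addmx2E, oppmx2E, scalemx2E).

(** The adjugate, which is the inverse on SL(2) and needs no division, so that words make sense over
    every commutative ring. *)
Definition adj2 a : 'M[K]_2 := mx2 (a 1 1) (- a 0 1) (- a 1 0) (a 0 0).

Lemma mulmx_adj2 a : \det a = 1 -> a * adj2 a = 1.
Proof.
rewrite det2E => d1; apply: matrix2P; rewrite !mxe2; first by rewrite -d1; ring.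
- by ring.
- by ring.
by rewrite -d1; ring.
Qed.

Lemma mul_adj2mx a : \det a = 1 -> adj2 a * a = 1.
Proof.
rewrite det2E => d1; apply: matrix2P; rewrite !mxe2; first by rewrite -d1; ring.
- by ring.
- by ring.
by rewrite -d1; ring.
Qed.

Lemma det_adj2 a : \det (adj2 a) = \det a.
Proof. by rewrite !det2E !mxe2; ring. Qed.

Lemma adj2K a : adj2 (adj2 a) = a.
Proof. by apply: matrix2P; rewrite !mxe2 ?opprK. Qed.

Lemma adj2M a b : adj2 (a * b) = adj2 b * adj2 a.
Proof. by apply: matrix2P; rewrite !mxe2; ring. Qed.

Lemma adj2_1 : adj2 1 = 1 :> 'M[K]_2.
Proof. by apply: matrix2P; rewrite !mxe2 ?oppr0. Qed.

Lemma adj2N a : adj2 (- a) = - adj2 a.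
Proof. by apply: matrix2P; rewrite !mxe2. Qed.

(* On SL(2), this is the trace of the commutator of a and b, minus 2. *)
Definition kappa a b : K := - \det (a * b - b * a).

(** The trace identity of Fricke. Homogenised by the determinants, it is an identity between
    polynomials in the entries; [kappa_comm] is treated likewise. *)
Lemma kappaE a b : \det a = 1 -> \det b = 1 -> kappa a b =
  \tr a ^+ 2 + \tr b ^+ 2 + \tr (a * b) ^+ 2 - \tr a * \tr b * \tr (a * b) - 4.
Proof.
move=> da db; have -> : kappa a b = \tr a ^+ 2 * \det b + \tr b ^+ 2 * \det a +
    \tr (a * b) ^+ 2 - \tr a * \tr b * \tr (a * b) - 4 * \det a * \det b.
  by rewrite /kappa !det2E !tr2E !mxe2; ring.
by rewrite da db !mulr1.
Qed.

Lemma kappa_comm a b : \det a = 1 -> \det b = 1 ->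
  \tr (a * b * adj2 a * adj2 b) = kappa a b + 2.
Proof.
move=> da db.
have -> : \tr (a * b * adj2 a * adj2 b) = kappa a b + 2 * \det a * \det b.
  by rewrite /kappa !det2E !tr2E !mxe2; ring.
by rewrite da db !mulr1.
Qed.

(** With [kappaNr], this makes [kappa] independent of the lifts from PSL(2) to SL(2). *)
Lemma kappaNl a b : kappa (- a) b = kappa a b.
Proof. by rewrite /kappa !det2E !mxe2; ring. Qed.

Lemma kappaNr a b : kappa a (- b) = kappa a b.
Proof. by rewrite /kappa !det2E !mxe2; ring. Qed.

End Mx2.

(** * Words in free generators and their matrices *)

Section Words.
Variable I : eqType.
Local Notation letter := (I * bool)%type.

(** A letter [(i, e)] is the generator of index i when e is false, and its inverse when e is
    true. *)
Definition flip (l : letter) : letter := (l.1, ~~ l.2).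

Definition push (l : letter) (w : seq letter) :=
  if w is l' :: w' then if l' == flip l then w' else l :: w else [:: l].

Definition reduce := foldr push [::].

Definition reduced := sorted (fun l l' : letter => l' != flip l).

Lemma reduce_reduced w : reduced (reduce w).
Proof.
elim: w => //= l w; rewrite /push; case: (reduce w) => //= l' w' h.
case: eqP => [_|/eqP ne] /=; last by rewrite ne.
by case: w' h => //= l'' w'' /andP[].
Qed.

Lemma flipK : involutive flip. Proof. by case=> i e; rewrite /flip /= negbK. Qed.

(** Reduction only cancels adjacent inverse letters, which no action sees if [flip] inverts a letter
    in it. This serves for matrices and for the sphere alike. *)
Lemma foldr_reduce (T : Type) (act : letter -> T -> T) x w :
  (forall l y, act l (act (flip l) y) = y) ->
  foldr act x (reduce w) = foldr act x w.
Proof.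
move=> actK; elim: w => //= l w <-; rewrite /push.
by case: (reduce w) => //= l' w'; case: eqP => //= ->; rewrite actK.
Qed.

Definition winv (w : seq letter) := rev (map flip w).

Definition lsubst (s : I -> seq letter) (l : letter) :=
  if l.2 then winv (s l.1) else s l.1.

Definition wsubst (s : I -> seq letter) (w : seq letter) :=
  flatten (map (lsubst s) w).

Section WordMatrix.
Variable K : comNzRingType.

Definition lmx (x : I -> 'M[K]_2) (l : letter) := if l.2 then adj2 (x l.1) else x l.1.

Definition wmx (x : I -> 'M[K]_2) (w : seq letter) : 'M[K]_2 :=
  foldr (fun l a => lmx x l * a) 1 w.

Variable x : I -> 'M[K]_2.
Hypothesis x1 : forall i, \det (x i) = 1.

Lemma det_lmx l : \det (lmx x l) = 1.
Proof. by rewrite /lmx; case: l.2; rewrite ?det_adj2 x1. Qed.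

Lemma det_wmx w : \det (wmx x w) = 1.
Proof. by elim: w => [|l w IHw] /=; rewrite ?det1 // det_mulmx det_lmx IHw mulr1. Qed.

Lemma lmx_flip l : lmx x l * lmx x (flip l) = 1.
Proof. by rewrite /lmx; case: l => i [] /=; rewrite ?mulmx_adj2 ?mul_adj2mx. Qed.

Lemma wmx_reduce w : wmx x (reduce w) = wmx x w.
Proof. by apply: foldr_reduce => l a; rewrite mulrA lmx_flip mul1r. Qed.

Lemma wmx_cat w w' : wmx x (w ++ w') = wmx x w * wmx x w'.
Proof. by elim: w => [|l w IHw] /=; rewrite ?mul1r // IHw mulrA. Qed.

Lemma wmx_winv w : wmx x (winv w) = adj2 (wmx x w).
Proof.
elim: w => [|l w IHw] /=; first by rewrite adj2_1.
rewrite /winv /= rev_cons -cats1 wmx_cat IHw adj2M; congr (_ * _).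
by rewrite /= mulr1 /lmx /=; case: l.2; rewrite //= adj2K.
Qed.

Lemma wmx_subst s w : wmx x (wsubst s w) = wmx (fun i => wmx x (s i)) w.
Proof.
elim: w => //= l w IHw; rewrite /wsubst /= wmx_cat IHw; congr (_ * _).
by rewrite /lsubst /lmx; case: l.2; rewrite ?wmx_winv.
Qed.

End WordMatrix.
End Words.

(** * Divisibility of kappa on words *)

Section KappaWords.
Local Notation letter := ('I_2 * bool)%type.

Lemma kappa_dvd_word (K : comNzRingType) (x : 'I_2 -> 'M[K]_2) (w w' : seq letter) :
    (forall i, \det (x i) = 1) ->
  exists Q, kappa (wmx x w) (wmx x w') = Q * kappa (x 0) (x 1).
Proof.
move=> x1; set a := x 0; set b := x 1.
have da : a 0 0 * a 1 1 - a 0 1 * a 1 0 = 1 by rewrite -det2E x1.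
have db : b 0 0 * b 1 1 - b 0 1 * b 1 0 = 1 by rewrite -det2E x1.
(* By Cayley-Hamilton and its polarised form [e2], these combinations are stable under
   multiplication by letters. *)
pose comb (v : K * K * K * K) : 'M[K]_2 :=
  v.1.1.1 *: 1 + v.1.1.2 *: a + v.1.2 *: b + v.2 *: (a * b).
have combM1 l v : exists v', lmx x l * comb v = comb v'.
  have mula u : exists u', a * comb u = comb u'.
    case: u => [[[u0 u1] u2] u3].
    exists (- u1, u0 + \tr a * u1, - u3, u2 + \tr a * u3).
    have e1 : a * a = \tr a *: a - 1.
      rewrite -[1]scale1r -da; apply: matrix2P; rewrite !mxe2 tr2E; ring.
    rewrite /comb /= !mulrDr -!scalerAr mulr1 e1 mulrA e1 mulrBl mul1r.
    rewrite -scalerAl !scalerDl !scalerDr !scalerA !scalerN !scaleNr.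
    by rewrite -!addrA; apply: matrix2P; rewrite !mxe2; ring.
  have mulb u : exists u', b * comb u = comb u'.
    case: u => [[[u0 u1] u2] u3].
    exists (u1 * (\tr (a * b) - \tr a * \tr b) - u2 - u3 * \tr a, u1 * \tr b + u3,
      u0 + u1 * \tr a + u2 * \tr b + u3 * \tr (a * b), - u1).
    have e1 : b * b = \tr b *: b - 1.
      rewrite -[1]scale1r -db; apply: matrix2P; rewrite !mxe2 tr2E; ring.
    have e2 : b * a = (\tr (a * b) - \tr a * \tr b) *: 1 + \tr b *: a + \tr a *: b - a * b.
      by apply: matrix2P; rewrite !mxe2 !tr2E !mxe2; ring.
    have e3 : b * (a * b) = a - \tr a *: 1 + \tr (a * b) *: b.
      have -> : b * (a * b) = \det b *: a - \det b *: (\tr a *: 1) + \tr (a * b) *: b.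
        by apply: matrix2P; rewrite !mxe2 !tr2E !mxe2 !det2E; ring.
      by rewrite x1 !scale1r.
    rewrite /comb /= !mulrDr -!scalerAr mulr1 e1 e2 e3.
    by apply: matrix2P; rewrite !mxe2; ring.
  have sub u u' t : exists v', t *: comb u - comb u' = comb v'.
    case: u u' => [[[u0 u1] u2] u3] [[[v0 v1] v2] v3].
    exists (t * u0 - v0, t * u1 - v1, t * u2 - v2, t * u3 - v3).
    by rewrite /comb /=; apply: matrix2P; rewrite !mxe2; ring.
  (* An inverse letter is the trace minus the letter. *)
  have adjE (c : 'M[K]_2) u : adj2 c * u = \tr c *: u - c * u.
    by apply: matrix2P; rewrite !mxe2 tr2E; ring.
  case: l => i []; rewrite /lmx /=; case: (ord2P i) => ->; rewrite -/a -/b.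
  - by rewrite adjE; case: (mula v) => v' ->.
  - by rewrite adjE; case: (mulb v) => v' ->.
  - exact: mula.
  - exact: mulb.
have combw u : exists v, wmx x u = comb v.
  elim: u => [|l u [v IHu]] /=; last by rewrite IHu.
  by exists (1, 0, 0, 0); rewrite /comb /= !scale0r !addr0 scale1r.
case: (combw w) (combw w') => [[[[u0 u1] u2] u3] ->] [[[[v0 v1] v2] v3] ->].
(* The commutator of two combinations is this matrix times ab - ba, because [a, ab] = a (ab - ba)
   and [b, ab] = - (ab - ba) b = - adj2 b (ab - ba). *)
exists (\det ((u1 * v2 - u2 * v1) *: 1 + (u1 * v3 - u3 * v1) *: a
   - (u2 * v3 - u3 * v2) *: adj2 b)).
rewrite /kappa mulrN -det_mulmx; congr (- \det _).
by apply: matrix2P; rewrite /comb !mxe2 /=; ring.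
Qed.

End KappaWords.

(** * Invariance of kappa under a change of free generators *)

Section KappaWords.
Local Notation letter := ('I_2 * bool)%type.
Lemma map_mx2M (K L : comNzRingType) (f : {rmorphism K -> L}) (a b : 'M[K]_2) :
  map_mx f (a * b) = map_mx f a * map_mx f b.
Proof. exact: map_mxM. Qed.

Lemma wmx_map (K L : comNzRingType) (f : {rmorphism K -> L}) (I : eqType)
  (x : I -> 'M[K]_2) w : map_mx f (wmx x w) = wmx (fun i => map_mx f (x i)) w.
Proof.
elim: w => [|l w IHw] /=; first by rewrite map_mx1.
rewrite map_mx2M IHw; congr (_ * _); rewrite /lmx; case: l.2 => //.
by apply: matrix2P; rewrite !mxE /= ?mxE ?rmorphN.
Qed.

Lemma kappa_map (K L : comNzRingType) (f : {rmorphism K -> L}) (a b : 'M[K]_2) :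
  kappa (map_mx f a) (map_mx f b) = f (kappa a b).
Proof. by rewrite /kappa -!map_mx2M -map_mxB det_map_mx rmorphN. Qed.

(** Three elementary factors suffice when the lower left entry is nonzero. When it vanishes,
    multiplication by a lower triangular factor makes it nonzero. *)
Lemma sl2_elementary (F : fieldType) (e : 'M[F]_2) : \det e = 1 ->
  exists x y z t, e = mx2 1 0 x 1 * mx2 1 y 0 1 * mx2 1 0 z 1 * mx2 1 t 0 1.
Proof.
have main (a : 'M[F]_2) : \det a = 1 -> a 1 0 != 0 ->
    a = mx2 1 ((a 0 0 - 1) / a 1 0) 0 1 * mx2 1 0 (a 1 0) 1 *
        mx2 1 ((a 1 1 - 1) / a 1 0) 0 1.
  rewrite det2E => da c0; apply: matrix2P; rewrite !mxe2; try by field.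
  have -> : a 0 1 = (a 0 0 * a 1 1 - 1) / a 1 0 by rewrite -da; field.
  by field.
move=> de; have [c0|c0] := eqVneq (e 1 0) 0; last first.
  exists 0, ((e 0 0 - 1) / e 1 0), (e 1 0), ((e 1 1 - 1) / e 1 0).
  rewrite {1}(main _ de c0); have -> : mx2 1 0 0 1 = 1 :> 'M[F]_2.
    by apply: matrix2P; rewrite !mxe2.
  by rewrite mul1r.
have L1 (x : F) : mx2 1 0 (- x) 1 * mx2 1 0 x 1 = 1.
  by apply: matrix2P; rewrite !mxe2; ring.
pose a := mx2 1 0 1 1 * e.
have da : \det a = 1 by rewrite det_mulmx de mulr1 det2E !mxe2; ring.
have a10 : a 1 0 != 0.
  rewrite /a !mxe2 c0 mul1r mulr0 addr0.
  by apply: contra_eqN de => /eqP e0; rewrite det2E c0 e0 mul0r mulr0 subrr eq_sym oner_eq0.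
exists (-1), ((a 0 0 - 1) / a 1 0), (a 1 0), ((a 1 1 - 1) / a 1 0).
have assoc (p q r s : 'M[F]_2) : p * q * r * s = p * (q * r * s) by rewrite !mulrA.
by rewrite assoc -main // /a mulrA L1 mul1r.
Qed.

(** Elementary matrices contract to 1 inside SL(2): multiply the parameters of the four factors of
    [adj2 a * b] by the variable, and put a in front. *)
Lemma sl2_curve (F : fieldType) (a b : 'M[F]_2) : \det a = 1 -> \det b = 1 ->
  exists P : 'M[{poly F}]_2, [/\ \det P = 1,
    map_mx (horner_eval 0) P = a & map_mx (horner_eval 1) P = b].
Proof.
move=> da db.
have [|x [y [z [t e]]]] := @sl2_elementary _ (adj2 a * b).
  by rewrite det_mulmx det_adj2 da db mulr1.
pose E (s : {poly F}) : 'M[{poly F}]_2 := mx2 1 0 (x *: s) 1 * mx2 1 (y *: s) 0 1 *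
  mx2 1 0 (z *: s) 1 * mx2 1 (t *: s) 0 1.
have mapmx2 u (p q r s : {poly F}) : map_mx (horner_eval u) (mx2 p q r s) =
    mx2 p.[u] q.[u] r.[u] s.[u].
  by apply: matrix2P; rewrite !mxE.
have h1 (u : F) : 1.[u] = 1 by rewrite hornerE.
have h0 (u : F) : 0.[u] = 0 by rewrite hornerE.
exists (map_mx polyC a * E 'X); split.
- rewrite /E !det_mulmx (det_map_mx polyC) da; rewrite !det2E !mxe2.
  by rewrite !(mulr0, mul0r, subr0, mulr1).
- rewrite map_mx2M -map_mx_comp /E !map_mx2M !mapmx2 !(hornerZ, hornerX, h1, h0, mulr0).
  have -> : mx2 1 0 0 1 = 1 :> 'M[F]_2 by apply: matrix2P; rewrite !mxe2.
  by rewrite !mulr1; apply: matrix2P; rewrite !mxE /= /horner_eval hornerC.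
- rewrite map_mx2M -map_mx_comp /E !map_mx2M !mapmx2 !(hornerZ, hornerX, h1, h0) !mulr1 -e.
  have -> : map_mx (horner_eval 1 \o polyC) a = a.
    by apply: matrix2P; rewrite !mxE /= /horner_eval hornerC.
  by rewrite mulrA mulmx_adj2 // mul1r.
Qed.

(** Commutation up to sign passes from the generators to their inverses and products. *)
Lemma wmx_anticomm (K : comNzRingType) (x : 'I_2 -> 'M[K]_2) :
    (forall i, \det (x i) = 1) -> x 0 * x 1 = - (x 1 * x 0) -> forall w w',
  exists b : bool, wmx x w * wmx x w' = (-1) ^+ b *: (wmx x w' * wmx x w).
Proof.
move=> x1 ac.
pose com (a b : 'M[K]_2) := exists e : bool, a * b = (-1) ^+ e *: (b * a).
have comC a b : com a b -> com b a.
  by case=> e ab; exists e; rewrite ab scalerA -signr_addb addbb scale1r.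
have comM a b c : com a b -> com a c -> com a (b * c).
  move=> [e ab] [e' ac']; exists (e (+) e').
  by rewrite mulrA ab -scalerAl -(mulrA b a c) ac' -scalerAr scalerA mulrA -signr_addb.
have com1 (d : 'M[K]_2) : com d 1.
  by exists false; rewrite scale1r mulr1 mul1r.
have comV a b : \det a = 1 -> com a b -> com (adj2 a) b.
  move=> da [e ab]; apply: comC; exists e.
  have := congr1 (fun m => adj2 a * m * adj2 a) ab.
  rewrite -scalerAr -scalerAl !mulrA mul_adj2mx // mul1r => ->.
  by rewrite -!mulrA mulmx_adj2 // mulr1.
have com01 : com (x 0) (x 1) by exists true; rewrite scaleN1r.
have comi i j : com (x i) (x j).
  have comrefl k : com (x k) (x k) by exists false; rewrite scale1r.
  by case: (ord2P i) => ->; case: (ord2P j) => -> //; apply: comC.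
have coml l l' : com (lmx x l) (lmx x l').
  rewrite /lmx; case: l.2; case: l'.2 => //.
  - by apply: (comV) => //; apply: comC; apply: comV.
  - exact: comV.
  - by apply: comC; apply: comV.
move=> w w'; suff : com (wmx x w) (wmx x w') by [].
have coml' l : com (lmx x l) (wmx x w').
  elim: w' => [|l' w' IHw']; [exact: com1|exact: comM].
elim: w => [|l w IHw]; first by apply: comC; exact: com1.
by apply: (comC); apply: comM; exact: comC.
Qed.

(** The second hypothesis says that substituting the words u in [s i] gives the free generator i
    back. So it does for matrices of determinant 1 over any ring, in particular along the curves P
    that lead from the quaternion units y to x. *)
Lemma kappa_word_basis (C : numClosedFieldType) (x : 'I_2 -> 'M[C]_2)
    (u s : 'I_2 -> seq letter) :
    (forall i, \det (x i) = 1) ->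
    (forall i, reduce (wsubst u (s i) ++ [:: (i, true)]) = [::]) ->
  kappa (wmx x (u 0)) (wmx x (u 1)) = kappa (x 0) (x 1).
Proof.
move=> x1 us.
pose y (i : 'I_2) : 'M[C]_2 := if i == 0 then mx2 'i 0 0 (- 'i) else mx2 0 1 (-1) 0.
have y1 i : \det (y i) = 1.
  rewrite /y; case: ifP => _; rewrite det2E !mxe2; last by ring.
  by rewrite mulrN -expr2 sqrCi; ring.
have /fin_all_exists[P hP] : forall i, exists P : 'M[{poly C}]_2, [/\ \det P = 1,
    map_mx (horner_eval 0) P = y i & map_mx (horner_eval 1) P = x i].
  by move=> i; exact: sl2_curve.
have P1 i : \det (P i) = 1 by case: (hP i).
have [Q hQ] := kappa_dvd_word (u 0) (u 1) P1.
pose v i := wmx P (u i).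
have v1 i : \det (v i) = 1 by exact: det_wmx.
have [Q' hQ'] := kappa_dvd_word (s 0) (s 1) v1.
have sv i : wmx v (s i) = P i.
  have := wmx_reduce P1 (wsubst u (s i) ++ [:: (i, true)]).
  rewrite us wmx_cat wmx_subst /= mulr1 -/v => e.
  by rewrite -[RHS]mul1r [X in X * P i]e /lmx /= -mulrA mul_adj2mx // mulr1.
have kP t : (kappa (P 0) (P 1)).[t] =
    kappa (map_mx (horner_eval t) (P 0)) (map_mx (horner_eval t) (P 1)).
  by rewrite kappa_map.
have kv t : (kappa (v 0) (v 1)).[t] =
    kappa (wmx (fun i => map_mx (horner_eval t) (P i)) (u 0))
          (wmx (fun i => map_mx (horner_eval t) (P i)) (u 1)).
  by rewrite -!wmx_map kappa_map.
have yac : y 0 * y 1 = - (y 1 * y 0).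
  have y0E : y 0 = mx2 'i 0 0 (- 'i) by [].
  have y1E : y 1 = mx2 0 1 (-1) 0 by [].
  by apply: matrix2P; rewrite y0E y1E !mxe2; ring.
have ky : kappa (y 0) (y 1) = -4.
  have y0E : y 0 = mx2 'i 0 0 (- 'i) by [].
  have y1E : y 1 = mx2 0 1 (-1) 0 by [].
  have sq : 'i * 'i = -1 :> C by rewrite -expr2 sqrCi.
  by rewrite /kappa yac y0E y1E det2E !mxe2; ring: sq.
have k0P : (kappa (P 0) (P 1)).[0] = -4.
  by rewrite kP; have [_ -> _] := hP 0; have [_ -> _] := hP 1.
have kP0 : kappa (P 0) (P 1) != 0.
  by apply: contra_eqN k0P => /eqP ->; rewrite horner0 eq_sym oppr_eq0 pnatr_eq0.
(* Each of the two values of kappa divides the other; the common factor cancels, since it equals -4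
   at t = 0. *)
have QQ : Q' * Q = 1.
  apply: (mulIf kP0); rewrite mul1r -mulrA -hQ.
  by rewrite -/(v 0) -/(v 1) -hQ' !sv.
have : Q \is a GRing.unit by apply/unitrPr; exists Q'; rewrite mulrC.
rewrite poly_unitE => /andP[/size_poly1P[q q0 Qq] _].
have kq t : (kappa (v 0) (v 1)).[t] = q * (kappa (P 0) (P 1)).[t].
  by rewrite [kappa (v 0) _]hQ Qq hornerM hornerC.
have funy : (fun i => map_mx (horner_eval 0) (P i)) =1 y by move=> i; case: (hP i).
have funx : (fun i => map_mx (horner_eval 1) (P i)) =1 x by move=> i; case: (hP i).
have wmx_ext (z z' : 'I_2 -> 'M[C]_2) w : z =1 z' -> wmx z w = wmx z' w.
  by move=> zz; rewrite /wmx; elim: w => //= l w ->; rewrite /lmx zz.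
(* Two words in the quaternion units either anticommute, and then their kappa is -4 like that of the
   units, or commute, and then -4 q = 0, which is excluded. *)
have q1 : q = 1.
  have := kq 0; rewrite kv k0P !(wmx_ext _ _ _ funy).
  have [[] e] := wmx_anticomm y1 yac (u 0) (u 1); rewrite /kappa e.
    rewrite expr1 scaleN1r -opprD -mulr2n -mulNrn -scaler_nat => d.
    have : \det (wmx y (u 1) * wmx y (u 0)) = 1 by rewrite det_mulmx !det_wmx ?mulr1.
    set m := _ * _ in d *; have dm : \det (2%:R *: - m) = 4 * \det m.
      by rewrite !det2E !mxe2; ring.
    move=> m1; move: d; rewrite dm m1 mulr1 -[LHS]mul1r mulrN -mulrN => /mulIf.
    by rewrite oppr_eq0 pnatr_eq0 => /(_ isT) ->.
  rewrite expr0 scale1r subrr.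
  have -> : \det (0 : 'M[C]_2) = 0 by rewrite det2E !mxE mulr0 subrr.
  by rewrite oppr0 => /esym/eqP; rewrite mulf_eq0 (negPf q0) oppr_eq0 pnatr_eq0.
have := kq 1; rewrite kv kP q1 mul1r !(wmx_ext _ _ _ funx) => ->.
by have [_ _ ->] := hP 0; have [_ _ ->] := hP 1.
Qed.

End KappaWords.

(** * The topology of the Riemann sphere *)

Section ComplexTopology.
Variable R : realType.
Local Notation C := R[i].

Lemma realC1 : 1%:C = 1 :> C. Proof. by []. Qed.
Lemma realC0 : 0%:C = 0 :> C. Proof. by []. Qed.
Lemma realCD (x y : R) : (x + y)%:C = x%:C + y%:C. Proof. exact: rmorphD. Qed.
Lemma realCB (x y : R) : (x - y)%:C = x%:C - y%:C. Proof. exact: rmorphB. Qed.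
Lemma realCN (x : R) : (- x)%:C = - x%:C. Proof. exact: rmorphN. Qed.
Lemma realCM (x y : R) : (x * y)%:C = x%:C * y%:C. Proof. exact: rmorphM. Qed.
Lemma realCX (x : R) n : (x ^+ n)%:C = x%:C ^+ n. Proof. exact: rmorphXn. Qed.
Lemma realCn n : (n%:R)%:C = n%:R :> C. Proof. exact: rmorph_nat. Qed.
Lemma realCV (x : R) : (x^-1)%:C = x%:C^-1. Proof. exact: fmorphV. Qed.

Lemma contM (T : topologicalType) (x : T) (f g : T -> C) :
  {for x, continuous f} -> {for x, continuous g} ->
  {for x, continuous (fun t => f t * g t)}.
Proof. exact: (@cvgM C T (nbhs x) _ f g (f x) (g x)). Qed.

Lemma contD (T : topologicalType) (x : T) (f g : T -> C) :
  {for x, continuous f} -> {for x, continuous g} ->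
  {for x, continuous (fun t => f t + g t)}.
Proof. exact: (@cvgD C C^o T (nbhs x) _ f g (f x) (g x)). Qed.

Lemma contV (T : topologicalType) (x : T) (f : T -> C) :
  f x != 0 -> {for x, continuous f} -> {for x, continuous (fun t => (f t)^-1)}.
Proof. exact: (@cvgV C T (nbhs x) _ f (f x)). Qed.

Lemma contK (T : topologicalType) (x : T) (k : C) :
  {for x, continuous (fun=> k)}.
Proof. exact: cvg_cst. Qed.

Lemma hausdorff_complex : hausdorff_space C.
Proof. exact: (@norm_hausdorff C C^o). Qed.

Lemma nbhs_complexP (z : C) (A : set C) :
  nbhs z A <-> exists2 e : R, 0 < e & forall w, `|w - z| < e%:C -> A w.
Proof.
split.
  move=> /(@nbhs_ballP C C^o) [e /= e0 eA].
  exists (complex.Re e); first by move: e0; rewrite ltcE => /andP[_ ].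
  move=> w wz; apply: eA; rewrite -ball_normE /ball_ /= distrC.
  by rewrite -(RRe_real (gtr0_real e0)).
move=> [e e0 eA]; apply/(@nbhs_ballP C C^o); exists e%:C; first by rewrite /= ltcR.
by move=> w; rewrite -ball_normE /ball_ /= distrC; exact: eA.
Qed.

Lemma norm_realC (x : R) : `|x%:C| = `|x|%:C.
Proof. by rewrite normc_def /= expr0n /= addr0 sqrtr_sqr. Qed.

Lemma cont_realC (T : topologicalType) (x : T) (f : T -> R) :
  {for x, continuous f} -> {for x, continuous (fun t => (f t)%:C)}.
Proof.
move=> fx A /nbhs_complexP[e e0 eA].
have := @cvgrPdist_lt _ _ _ (nbhs x) _ f (f x).
move=> [/(_ fx) /(_ e e0) h _].
apply: filterS h => t /= h; apply: eA.
by rewrite -rmorphB norm_realC ltcR distrC.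
Qed.

Lemma cont_complex (T : topologicalType) (x : T) (f g : T -> R) :
  {for x, continuous f} -> {for x, continuous g} ->
  {for x, continuous (fun t => f t +i* g t)}.
Proof.
move=> fx gx; have -> : (fun t => f t +i* g t) = (fun t => (f t)%:C + 'i * (g t)%:C).
  by apply: funext => t; rewrite [LHS]complexE.
by apply: contD; [|apply: contM; first exact: contK]; apply: cont_realC.
Qed.

(** The modulus as an element of R; the norm itself has values in R[i]. *)
Definition nrm (z : C) : R := complex.Re `|z|.

Lemma nrmE z : (nrm z)%:C = `|z|.
Proof. by rewrite /nrm RRe_real ?normr_real. Qed.

Lemma nrm_ge0 z : 0 <= nrm z.
Proof. by rewrite -lecR nrmE normr_ge0. Qed.

Lemma cont_nrm (z : C) : {for z, continuous nrm}.
Proof.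
apply/(@cvgrPdist_lt R R^o C (nbhs z) (nbhs_filter z)) => e e0.
apply/nbhs_complexP; exists e => // w wz.
rewrite -ltcR -norm_realC realCB !nrmE; apply: le_lt_trans wz.
by rewrite [X in _ <= X]distrC; exact: ler_dist_dist.
Qed.

Lemma compact_bounded_complex (K : set C) : compact K ->
  exists2 r : R, 0 < r & forall z, K z -> `|z| <= r%:C.
Proof.
move=> cK; have : compact (nrm @` K).
  by apply: continuous_compact => //; apply: continuous_subspaceT => z; exact: cont_nrm.
move=> /(@compact_bounded R R^o)[N [_ hN]].
have N1 : N < `|N| + 1 by rewrite (le_lt_trans (ler_norm N)) ?ltrDl.
exists (`|N| + 1); first by rewrite ltr_wpDl.
move=> z Kz; rewrite -nrmE lecR; apply: le_trans (ler_norm _) _.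
by have := hN _ N1 (nrm z); apply; exists z.
Qed.

Lemma closed_ball_complex (r : R) : closed [set z : C | `|z| <= r%:C].
Proof.
rewrite -openC openE => z /= /negP; rewrite -nrmE lecR -ltNge => rz.
apply/nbhs_complexP; exists (nrm z - r); first by rewrite subr_gt0.
move=> w; rewrite -nrmE realCB nrmE => h /=; apply/negP.
rewrite -nrmE lecR -ltNge -ltcR nrmE.
have : `|z| - `|w| <= `|w - z| by rewrite distrC lerB_dist.
move=> /le_lt_trans/(_ h); rewrite -!nrmE -!realCB !ltcR; lra.
Qed.

Lemma abs_Re_Im_le (z : C) (r : R) : `|z| <= r%:C ->
  (`|complex.Re z| <= r) /\ (`|complex.Im z| <= r).
Proof.
case: z => x y; rewrite normc_def /= lecR => h.
have r0 : 0 <= r by exact: le_trans (sqrtr_ge0 _) h.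
split; rewrite -[X in X <= _]sqrtr_sqr; apply: le_trans h; apply: ler_wsqrtr.
  by rewrite lerDl sqr_ge0.
by rewrite lerDr sqr_ge0.
Qed.

Lemma compact_ball_complex (r : R) : compact [set z : C | `|z| <= r%:C].
Proof.
pose f (p : R * R) : C := p.1 +i* p.2.
have cf : compact (f @` (`[- r, r] `*` `[- r, r])).
  apply: continuous_compact; last by apply: compact_setX; exact: segment_compact.
  apply: continuous_subspaceT => p; apply: cont_complex; [exact: cvg_fst|exact: cvg_snd].
apply: (@subclosed_compact C _ _ (@closed_ball_complex r) cf) => z /abs_Re_Im_le[].
rewrite !ler_norml => hx hy; exists (complex.Re z, complex.Im z) => //=.
by rewrite /f; case: z {hx hy}.
Qed.

Lemma star_connected (A : set C) :
  (forall z (t : R), A z -> 0 <= t <= 1 -> A (t%:C * z)) -> connected A.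
Proof.
move=> sA.
have -> : A = \bigcup_(z in A) ((fun t : R => t%:C * z) @` `[0, 1]).
  rewrite eqEsubset; split => [z Az|w [z Az [t] /=]].
    by exists z => //; exists 1; rewrite /= ?in_itv /= ?lexx ?ler01 ?mul1r.
  by rewrite in_itv /= => t01 <-; exact: sA.
apply: bigcup_connected.
  by exists 0 => z Az; exists 0; rewrite /= ?in_itv /= ?lexx ?ler01 ?mul0r.
move=> z Az; apply: connected_continuous_connected; first exact: segment_connected.
apply: continuous_subspaceT => t; apply: contM; last exact: contK.
exact: cont_realC.
Qed.

Lemma unit_circleE (z : C) : unit_circle z <-> complex.Re z ^+ 2 + complex.Im z ^+ 2 = 1.
Proof.
rewrite /unit_circle /=; split => [z1|h].
  by apply: complexI; rewrite add_Re2_Im2 z1 expr1n.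
by rewrite normc_def h sqrtr1.
Qed.

Lemma connected_unit_circle : connected (@unit_circle R).
Proof.
pose f (s : R) (x : R) : C := x +i* (s * Num.sqrt (1 - x ^+ 2)).
have cf s : connected (f s @` `[-1, 1]).
  apply: connected_continuous_connected; first exact: segment_connected.
  apply: continuous_subspaceT => x.
  apply: (@cont_complex R x (fun x => x) (fun x => s * Num.sqrt (1 - x ^+ 2))).
    exact: cvg_id.
  apply: (@cvgM R R (nbhs x) _ (fun=> s) (fun x => Num.sqrt (1 - x ^+ 2)) s).
    exact: cvg_cst.
  apply: (@continuous_comp R R R (fun x => 1 - x ^+ 2) Num.sqrt);
    last exact: sqrt_continuous.
  apply: (@cvgB R R^o R (nbhs x) _ (fun=> 1) (fun x => x ^+ 2)); first exact: cvg_cst.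
  exact: (@cvgM R R (nbhs x) _ id id x x cvg_id cvg_id).
have -> : @unit_circle R = (f 1 @` `[-1, 1]) `|` (f (-1) @` `[-1, 1]).
  rewrite eqEsubset; split => [z /unit_circleE|z].
    case: z => x y /= xy.
    have hx : `[-1, 1]%classic x.
      by rewrite /= in_itv /=; apply/andP; split; nra.
    have yE : Num.sqrt (1 - x ^+ 2) = `|y|.
      by rewrite -sqrtr_sqr; congr Num.sqrt; lra.
    have [y0|y0] := leP 0 y; [left|right]; exists x => //; rewrite /f yE.
      by rewrite ger0_norm // mul1r.
    by rewrite ltr0_norm // mulN1r opprK.
  case=> -[x /=]; rewrite in_itv /= => hx <-; apply/unit_circleE => /=;
    rewrite exprMn sqr_sqrtr; try nra.
apply: connectedU => //; exists 1; split; exists 1; rewrite /= ?in_itv /= ?lexx //=.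
- by lra.
- by rewrite /f expr1n subrr sqrtr0 mulr0.
- by lra.
- by rewrite /f expr1n subrr sqrtr0 mulr0.
Qed.

Lemma compact_unit_circle : compact (@unit_circle R).
Proof.
apply: (@subclosed_compact C _ _ _ (@compact_ball_complex 1)); last first.
  by move=> z /= ->.
have -> : @unit_circle R = nrm @^-1` [set 1].
  rewrite eqEsubset; split => z /=; first by rewrite /unit_circle /= /nrm => ->.
  by rewrite /unit_circle /= -nrmE => ->.
apply: closed_comp => [z _|]; [exact: cont_nrm|exact: closed_eq].
Qed.

End ComplexTopology.

(** * The sphere in homogeneous coordinates *)

Section SphereTopology.
Variable R : realType.
Local Notation C := R[i].
Local Notation S := (sphere R).
Local Notation inC := (Some : C -> S).

Lemma nbhs_inftyP (A : set S) : nbhs (None : S) A <->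
  A None /\ exists2 r : R, 0 < r & forall z : C, r%:C < `|z| -> A (Some z).
Proof.
split.
  move=> NA; split; first exact: nbhs_singleton NA.
  case: NA => K [cK _] KA; have [r r0 hr] := compact_bounded_complex cK.
  exists r => // z rz; apply: KA; left; exists z => // /hr.
  by move=> /(lt_le_trans rz); rewrite ltxx.
case=> A0 [r r0 rA]; exists [set z : C | `|z| <= r%:C].
  by split; [exact: compact_ball_complex|exact: closed_ball_complex].
move=> p [[z /= /negP hz <-]|-> //]; apply: rA.
by rewrite real_ltNge ?normr_real //; rewrite complex_real.
Qed.

Lemma nbhs_finiteP (z : C) (A : set S) : nbhs (Some z : S) A <->
  exists2 e : R, 0 < e & forall w, `|w - z| < e%:C -> A (Some w).
Proof. exact: (nbhs_complexP z (inC @^-1` A)). Qed.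

Lemma hausdorff_sphere : hausdorff_space S.
Proof.
move=> p q; rewrite /cluster /= => pq.
have inf_fin (z : C) : exists A B, [/\ nbhs (None : S) A, nbhs (Some z : S) B & A `&` B = set0].
  exists (fun p : S => if p is Some w then ((nrm z + 1)%:C < `|w| : Prop) else True).
  exists (fun p : S => if p is Some w then (`|w - z| < 1%:C : Prop) else False); split.
  - apply/nbhs_inftyP; split => //; exists (nrm z + 1) => //.
    by have := nrm_ge0 z; lra.
  - by apply/nbhs_finiteP; exists 1; rewrite ?ltr01.
  - rewrite -subset0 => -[w|] [] //= h1 h2.
    have := lerB_dist w z => /le_lt_trans/(_ h2).
    by move: h1; rewrite -!nrmE -!realCB !ltcR; lra.
case: p q pq => [z|] [w|] // pq.
- congr Some; apply: hausdorff_complex; rewrite /cluster /= => A B Az Bw.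
  have [|p [[]]] := pq (inC @` A) (inC @` B) _ (one_point_compactification_some_nbhs _ _ Bw).
    exact: one_point_compactification_some_nbhs.
  by move=> u Au <- [v Bv [vu]]; exists u; split => //; rewrite -vu.
- have [A [B [nA nB]]] := inf_fin z; rewrite -subset0 => AB.
  by have [p [Bp Ap]] := pq B A nB nA; case: (AB p).
- have [A [B [nA nB]]] := inf_fin w; rewrite -subset0 => AB.
  by have [p [Ap Bp]] := pq A B nA nB; case: (AB p).
Qed.

(* Homogeneous coordinates; [pt 0 0] is the junk value [None]. *)
Definition pt (x y : C) : S := if y == 0 then None else Some (x / y).

Lemma ptP (p : S) : exists x y, ((x != 0) || (y != 0)) /\ p = pt x y.
Proof.
case: p => [z|]; [exists z, 1|exists 1, 0]; rewrite /pt ?oner_eq0 ?orbT ?eqxx //.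
by rewrite divr1.
Qed.

Lemma pt_eq (x y x' y' : C) : (x != 0) || (y != 0) -> (x' != 0) || (y' != 0) ->
  pt x y = pt x' y' <-> x * y' = x' * y.
Proof.
rewrite /pt; have [-> | y0] := eqVneq y 0; have [-> | y'0] := eqVneq y' 0 => //=.
- by rewrite !mulr0.
- rewrite orbF => x0 _; split => //; rewrite mulr0 => /eqP.
  by rewrite mulf_eq0 (negPf x0) (negPf y'0).
- rewrite orbF => _ x0; split => //; rewrite mulr0 => /esym/eqP.
  by rewrite mulf_eq0 (negPf x0) (negPf y0).
- move=> _ _; split=> [[] /eqP|e].
    by rewrite eqr_div // => /eqP.
  by congr Some; apply/eqP; rewrite eqr_div //; apply/eqP.
Qed.

Lemma det_coord_neq0 (M : 'M[C]_2) x y : \det M != 0 -> (x != 0) || (y != 0) ->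
  (M 0 0 * x + M 0 1 * y != 0) || (M 1 0 * x + M 1 1 * y != 0).
Proof.
move=> M0; apply: contraTT; rewrite !negb_or !negbK => /andP[/eqP h0 /eqP h1].
have hx : \det M * x = M 1 1 * (M 0 0 * x + M 0 1 * y) - M 0 1 * (M 1 0 * x + M 1 1 * y).
  by rewrite det2E; ring.
have hy : \det M * y = M 0 0 * (M 1 0 * x + M 1 1 * y) - M 1 0 * (M 0 0 * x + M 0 1 * y).
  by rewrite det2E; ring.
move: hx hy; rewrite h0 h1 !mulr0 subrr => /eqP; rewrite mulf_eq0 (negPf M0) /= => ->.
by move=> /eqP; rewrite mulf_eq0 (negPf M0).
Qed.

Lemma mobius_pt (M : 'M[C]_2) x y : \det M != 0 -> (x != 0) || (y != 0) ->
  mobius M (pt x y) = pt (M 0 0 * x + M 0 1 * y) (M 1 0 * x + M 1 1 * y).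
Proof.
move=> M0 xy0; rewrite {1}/pt; have [y0|y0] /= := eqVneq y 0.
  move: xy0; rewrite y0 eqxx orbF !mulr0 !addr0 => x0.
  rewrite /pt mulf_eq0 (negPf x0) orbF; case: eqP => // /eqP c0.
  by rewrite -mulf_div divff ?mulr1.
have e : M 1 0 * (x / y) + M 1 1 = (M 1 0 * x + M 1 1 * y) / y by field.
rewrite /pt e mulf_eq0 invr_eq0 (negPf y0) orbF; case: eqP => // /eqP d0.
by congr Some; field; rewrite d0 y0.
Qed.

Lemma mobiusM (M N : 'M[C]_2) p : \det M != 0 -> \det N != 0 ->
  mobius (M * N) p = mobius M (mobius N p).
Proof.
move=> M0 N0; have [x [y [xy0 ->]]] := ptP p.
have MN0 : \det (M * N) != 0 by rewrite det_mulmx mulf_neq0.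
rewrite !mobius_pt ?det_coord_neq0 // !mulmx2E.
by congr pt; ring.
Qed.

Lemma mobiusZ (k : C) (M : 'M[C]_2) p : k != 0 -> \det M != 0 ->
  mobius (k *: M) p = mobius M p.
Proof.
move=> k0 M0; have [x [y [xy0 ->]]] := ptP p.
have kM0 : \det (k *: M) != 0.
  have -> : \det (k *: M) = k * k * \det M by rewrite !det2E !mxE; ring.
  by rewrite !mulf_neq0.
rewrite !mobius_pt // !mxE; apply/pt_eq; last by ring.
  by have := det_coord_neq0 kM0 xy0; rewrite !mxE.
exact: det_coord_neq0.
Qed.

Lemma mobius1 p : mobius (1 : 'M[C]_2) p = p.
Proof.
have [x [y [xy0 ->]]] := ptP p; rewrite mobius_pt ?det1 ?oner_eq0 // !one2E.
by congr pt; ring.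
Qed.

(** It suffices to compare the images of infinity, 0 and 1. *)
Lemma mobius_inj_mx (M N : 'M[C]_2) : \det M != 0 -> \det N != 0 ->
  mobius M = mobius N -> exists2 k : C, k != 0 & M = k *: N.
Proof.
move=> M0 N0 MN.
have h x y : (x != 0) || (y != 0) ->
    (M 0 0 * x + M 0 1 * y) * (N 1 0 * x + N 1 1 * y) =
    (N 0 0 * x + N 0 1 * y) * (M 1 0 * x + M 1 1 * y).
  move=> xy0; have := congr1 (@^~ (pt x y)) MN; rewrite /= !mobius_pt // => /pt_eq.
  by apply; exact: det_coord_neq0.
have o0 : (1 : C) != 0 by exact: oner_neq0.
have := h 1 0; have := h 0 1; have := h 1 1; rewrite o0 eqxx /=.
rewrite !(mulr0, mulr1, addr0, add0r) => /(_ isT) h11 /(_ isT) h01 /(_ isT) h10.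
have e : M 0 0 * N 1 1 = N 0 0 * M 1 1 + N 0 1 * M 1 0 - M 0 1 * N 1 0.
  have -> : M 0 0 * N 1 1 = (M 0 0 + M 0 1) * (N 1 0 + N 1 1) - M 0 0 * N 1 0 -
    M 0 1 * N 1 1 - M 0 1 * N 1 0 by ring.
  by rewrite h11 h10 h01; ring.
(* If M = u N, this numerator is u times the determinant of N. The formula holds whichever entries
   vanish. *)
pose u := (M 0 0 * N 1 1 - N 0 1 * M 1 0) / \det N.
have hu : u * \det N = M 0 0 * N 1 1 - N 0 1 * M 1 0 by rewrite /u divfK.
have hu' : u * \det N = N 0 0 * M 1 1 - M 0 1 * N 1 0 by rewrite hu e; ring.
have MuN : M = u *: N.
  have cancelN (a b : C) : a * \det N = b * \det N -> a = b by exact: mulIf.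
  apply: matrix2P; rewrite !mxE; apply: cancelN; rewrite mulrAC.
  - by rewrite hu det2E; ring: h10.
  - by rewrite hu' det2E; ring: h01.
  - by rewrite hu det2E; ring: h10.
  - by rewrite hu' det2E; ring: h01.
exists u => //; apply: contraNneq M0 => u0; rewrite MuN u0 scale0r det2E !mxE.
by rewrite mulr0 subrr.
Qed.

Lemma det_adj2_neq0 (M : 'M[C]_2) : \det M != 0 -> \det (adj2 M) != 0.
Proof. by rewrite det_adj2. Qed.

Lemma mul_adj2_scal (K : comNzRingType) (M : 'M[K]_2) : M * adj2 M = \det M *: 1.
Proof. by apply: matrix2P; rewrite !mxe2 det2E; ring. Qed.

Lemma adj2_mul_scal (K : comNzRingType) (M : 'M[K]_2) : adj2 M * M = \det M *: 1.
Proof. by apply: matrix2P; rewrite !mxe2 det2E; ring. Qed.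

Lemma mobiusK (M : 'M[C]_2) : \det M != 0 -> cancel (mobius M) (mobius (adj2 M)).
Proof.
move=> M0 p; rewrite -mobiusM ?det_adj2 // adj2_mul_scal mobiusZ ?mobius1 //.
by rewrite det1 oner_neq0.
Qed.

Lemma mobiusVK (M : 'M[C]_2) : \det M != 0 -> cancel (mobius (adj2 M)) (mobius M).
Proof. by move=> M0 p; rewrite -{1}[M]adj2K mobiusK ?det_adj2. Qed.

Lemma mobius_preimage (M : 'M[C]_2) (A : set S) : \det M != 0 ->
  mobius M @` A = mobius (adj2 M) @^-1` A.
Proof.
move=> M0; rewrite eqEsubset; split=> [_ [p Ap <-]|p /= Ap].
  by rewrite /= mobiusK.
by exists (mobius (adj2 M) p) => //; rewrite mobiusVK.
Qed.

End SphereTopology.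

(** * Continuity, and the two sides of a circle *)

Section MobiusContinuity.
Variable R : realType.
Local Notation C := R[i].
Local Notation S := (sphere R).
Local Notation inC := (Some : C -> S).

Lemma mobius_affine (a b : C) p : a != 0 ->
  mobius (mx2 a b 0 1) p = if p is Some z then Some (a * z + b) else None.
Proof.
by move=> a0; case: p => [z|] /=; rewrite !mxe2 ?eqxx // mul0r add0r oner_eq0 divr1.
Qed.

Lemma mobius_swap p :
  mobius (mx2 0 1 1 0) p = if p is Some z then
    (if z == 0 then None else Some z^-1) else Some 0 :> S.
Proof.
case: p => [z|] /=; rewrite !mxe2 ?oner_eq0 ?mul0r ?mul1r ?addr0 //.
by rewrite add0r div1r.
Qed.

Lemma mobius_affine_continuous (a b : C) : a != 0 ->
  continuous (mobius (mx2 a b 0 1) : S -> S).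
Proof.
move=> a0; have -> : mobius (mx2 a b 0 1) =
    (fun p : S => if p is Some z then Some (a * z + b) else None : S).
  by apply: funext => p; rewrite mobius_affine.
case=> [z|] A /=.
  move=> nA; have : {for z, continuous (fun z => a * z + b)}.
    apply: contD; last exact: contK.
    by apply: contM; [exact: contK|exact: cvg_id].
  by move/(_ (inC @^-1` A) nA).
move=> /nbhs_inftyP[A0 [r r0 rA]]; apply/nbhs_inftyP; split => //.
have na : 0 < nrm a by rewrite -ltcR nrmE normr_gt0.
exists ((r + nrm b) / nrm a); first by rewrite divr_gt0 // ltr_pwDl ?nrm_ge0.
move=> z; rewrite -nrmE ltcR ltr_pdivrMr // => h; apply: rA.
have := lerB_normD (a * z) b; rewrite normrM; move: h.
rewrite -!nrmE -!realCM -!realCB !ltcR lecR mulrC; lra.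
Qed.

Lemma mobius_swap_continuous : continuous (mobius (mx2 0 1 1 0) : S -> S).
Proof.
have -> : mobius (mx2 0 1 1 0) = (fun p : S => if p is Some z then
    (if z == 0 then None else Some z^-1) else Some 0 : S).
  by apply: funext => p; rewrite mobius_swap.
case=> [z|] A /=; last first.
  move=> /nbhs_finiteP[e e0 eA]; apply/nbhs_inftyP; split.
    by apply: eA; rewrite subrr normr0 ltcR.
  exists e^-1; first by rewrite invr_gt0.
  move=> z ez; have z0 : z != 0.
    by apply: contraTneq ez => ->; rewrite normr0 -realC0 ltcR lt_gtF ?invr_gt0.
  rewrite /= (negPf z0); apply: eA; rewrite subr0 normfV; move: ez.
  have nz : 0 < nrm z by rewrite -ltcR nrmE normr_gt0.
  by rewrite -nrmE -realCV !ltcR => ez; rewrite invf_plt ?posrE.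
have [->|z0] := eqVneq z 0.
  move=> /nbhs_inftyP[A0 [r r0 rA]]; apply/nbhs_finiteP.
  exists r^-1; first by rewrite invr_gt0.
  move=> w; rewrite subr0 /=; have [//|w0] := eqVneq w 0.
  have nw : 0 < nrm w by rewrite -ltcR nrmE normr_gt0.
  move=> h; apply: rA; move: h; rewrite normfV -nrmE -realCV !ltcR => h.
  by rewrite invf_pgt ?posrE.
move=> nA; have hc : {for z, continuous (fun z : C => z^-1)}.
  by apply: contV => //; exact: cvg_id.
have hA : nbhs z ((fun z : C => z^-1) @^-1` (inC @^-1` A)) by exact: (hc _ nA).
have h0 : nbhs z [set w : C | w != 0].
  apply/nbhs_complexP; exists (nrm z); first by rewrite -ltcR nrmE normr_gt0.
  by move=> w h /=; apply: contraTneq h => ->; rewrite sub0r normrN nrmE ltxx.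
apply: (@filterS _ (nbhs (z : C)) _ _ _ _ (filterI hA h0)) => w [/= wA w0].
by rewrite (negPf w0).
Qed.

Lemma mobius_continuous (M : 'M[C]_2) : \det M != 0 -> continuous (mobius M : S -> S).
Proof.
move=> M0; have [c0|c0] := eqVneq (M 1 0) 0.
  have ad : M 0 0 * M 1 1 != 0 by move: M0; rewrite det2E c0 mulr0 subr0.
  move: (ad); rewrite mulf_eq0 negb_or => /andP[a0 d0].
  have Mm : M = M 1 1 *: mx2 (M 0 0 / M 1 1) (M 0 1 / M 1 1) 0 1.
    by apply: matrix2P; rewrite !mxe2 ?c0; field.
  have da : \det (mx2 (M 0 0 / M 1 1) (M 0 1 / M 1 1) 0 1) != 0.
    by rewrite det2E !mxe2 mulr1 mulr0 subr0 mulf_neq0 ?invr_eq0.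
  have -> : mobius M = mobius (mx2 (M 0 0 / M 1 1) (M 0 1 / M 1 1) 0 1).
    by apply: funext => p; rewrite [in LHS]Mm mobiusZ.
  by apply: mobius_affine_continuous; rewrite mulf_neq0 ?invr_eq0.
(* (a z + b) / (c z + d) = a / c - (det M / c) / (c z + d), which is an affine map after the
   inversion after an affine map. *)
pose c := M 1 0; pose U := mx2 (- \det M / c) (M 0 0 / c) 0 1.
pose V := mx2 c (M 1 1) 0 1.
have dU : \det U != 0.
  by rewrite det2E !mxe2 mulr1 mulr0 subr0 !mulf_neq0 ?invr_eq0 ?oppr_eq0.
have dV : \det V != 0 by rewrite det2E !mxe2 mulr1 mulr0 subr0.
have ds : \det (mx2 0 1 1 0 : 'M[C]_2) != 0.
  by rewrite det2E !mxe2 mulr1 mulr0 sub0r oppr_eq0 oner_eq0.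
have -> : mobius M = mobius U \o (mobius (mx2 0 1 1 0) \o mobius V).
  apply: funext => p /=; rewrite -!mobiusM ?det_mulmx ?mulf_neq0 //.
  congr mobius; apply: matrix2P; rewrite /U /V !mxe2 ?det2E /c; try by ring.
  by rewrite /=; field.
  by field.
move=> p; apply: continuous_comp; last first.
  by apply: mobius_affine_continuous; rewrite mulf_neq0 ?invr_eq0 ?oppr_eq0.
apply: continuous_comp; last exact: mobius_swap_continuous.
exact: mobius_affine_continuous.
Qed.

Lemma mobius_open (M : 'M[C]_2) (A : set S) : \det M != 0 -> open A ->
  open (mobius M @` A).
Proof.
move=> M0 oA; rewrite mobius_preimage //.
by apply: open_comp => // p _; apply: mobius_continuous; rewrite det_adj2.
Qed.

Lemma mobius_closed (M : 'M[C]_2) (A : set S) : \det M != 0 -> closed A ->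
  closed (mobius M @` A).
Proof.
move=> M0 cA; rewrite mobius_preimage //.
by apply: closed_comp => // p _; apply: mobius_continuous; rewrite det_adj2.
Qed.

Lemma mobius_closure (M : 'M[C]_2) (A : set S) : \det M != 0 ->
  mobius M @` closure A = closure (mobius M @` A).
Proof.
move=> M0; rewrite eqEsubset; split.
  move=> _ [p Ap <-] B nB; have [q [Aq Bq]] := Ap _ (mobius_continuous M0 nB).
  by exists (mobius M q); split => //; exists q.
rewrite closureE => p; apply; split; first by apply: mobius_closed => //; exact: closed_closure.
by apply: image_subset; exact: subset_closure.
Qed.

Definition disc : set S := inC @` [set z | `|z| < 1].
Definition circ : set S := inC @` @unit_circle R.
(** This side contains infinity; as an image of the disc it inherits its openness and
    connectedness. *)
Definition ext : set S := mobius (mx2 0 1 1 0) @` disc.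

Lemma det_swap : \det (mx2 0 1 1 0 : 'M[C]_2) != 0.
Proof. by rewrite det2E !mxe2 mulr1 mulr0 sub0r oppr_eq0 oner_eq0. Qed.

Lemma open_disc : open disc.
Proof.
apply: one_point_compactification_open_some; rewrite openE => z /= z1.
apply/nbhs_complexP; exists (1 - nrm z); first by rewrite subr_gt0 -ltcR nrmE realC1.
move=> w; have := lerB_dist w z; move: z1.
by rewrite /= -!nrmE -!realCB lecR -realC1 !ltcR; lra.
Qed.

Lemma open_ext : open ext.
Proof. by apply: mobius_open; [exact: det_swap|exact: open_disc]. Qed.

Lemma connected_some (A : set C) : connected A -> connected (inC @` A).
Proof.
move=> cA; apply: connected_continuous_connected => //; apply: continuous_subspaceT.
exact: one_point_compactification_some_continuous.
Qed.

Lemma connected_mobius (M : 'M[C]_2) (A : set S) : \det M != 0 -> connected A ->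
  connected (mobius M @` A).
Proof.
move=> M0 cA; apply: connected_continuous_connected => //; apply: continuous_subspaceT.
exact: mobius_continuous.
Qed.

Lemma connected_disc : connected disc.
Proof.
apply: connected_some; apply: star_connected => z t /= z1 /andP[t0 t1].
rewrite normrM norm_realC (ger0_norm t0); apply: le_lt_trans z1.
by rewrite ler_piMl // -realC1 lecR.
Qed.

Lemma connected_ext : connected ext.
Proof. by apply: connected_mobius; [exact: det_swap|exact: connected_disc]. Qed.

Lemma discP x y : (x != 0) || (y != 0) -> disc (pt x y) <-> `|x| < `|y|.
Proof.
rewrite /disc /pt => xy0; have [->|y0] := eqVneq y 0.
  by rewrite normr0 normr_lt0; split => // -[].
have ny : 0 < `|y| by rewrite normr_gt0.
have e : (`|x| < `|y|) = (`|x / y| < 1) by rewrite normf_div ltr_pdivrMr // mul1r.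
by rewrite e; split => [[z z1 [<-]]|h] //; exists (x / y).
Qed.

Lemma circP x y : (x != 0) || (y != 0) -> circ (pt x y) <-> `|x| = `|y|.
Proof.
rewrite /circ /unit_circle /pt => xy0; have [y0|y0] := eqVneq y 0.
  rewrite y0 normr0; split => [[]//|/eqP]; rewrite normr_eq0 => x0.
  by move: xy0; rewrite x0 y0 eqxx.
have ny : `|y| != 0 by rewrite normr_eq0.
have e : `|x| = `|y| <-> `|x / y| = 1.
  rewrite normf_div; split => [->|h]; first by rewrite divff.
  by rewrite -[LHS](divfK ny) h mul1r.
by rewrite e; split => [[z z1 [<-]]|h] //; exists (x / y).
Qed.

Lemma extP x y : (x != 0) || (y != 0) -> ext (pt x y) <-> `|y| < `|x|.
Proof.
move=> xy0; rewrite /ext mobius_preimage ?det_swap //.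
have -> : mobius (adj2 (mx2 0 1 1 0)) = mobius (mx2 0 1 1 0) :> (S -> S).
  apply: funext => p; rewrite -[in RHS](mobiusZ p (k := -1)) ?oppr_eq0 ?oner_eq0 ?det_swap //.
  by congr mobius; apply: matrix2P; rewrite !mxe2 ?mulr0 ?mulN1r ?oppr0.
rewrite /= mobius_pt ?det_swap // !mxe2 !mul0r !mul1r addr0 add0r.
by apply: discP; rewrite orbC.
Qed.

Lemma setC_circ : ~` circ = disc `|` ext.
Proof.
rewrite eqEsubset; split => p; have [x [y [xy0 ->]]] := ptP p => /=.
  move=> /circP h; rewrite discP // extP //.
  have hxy : nrm x != nrm y.
    by apply/eqP => e; apply: h => //; rewrite -!nrmE e.
  by rewrite -!nrmE !ltcR; case: ltgtP hxy; auto.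
by rewrite discP // extP // circP // => h e; case: h; rewrite e ltxx.
Qed.

Lemma disc_ext : disc `&` ext = set0.
Proof.
rewrite -subset0 => p; have [x [y [xy0 ->]]] := ptP p; rewrite /= discP // extP //.
by case=> h1 h2; move: (lt_trans h1 h2); rewrite ltxx.
Qed.

Lemma mobius_image_setC (M : 'M[C]_2) (A : set S) : \det M != 0 ->
  mobius M @` (~` A) = ~` (mobius M @` A).
Proof. by move=> M0; rewrite !mobius_preimage. Qed.

Lemma components2 (K A B : set S) : connected A -> connected B ->
    open A -> open B -> A !=set0 -> B !=set0 -> A `&` B = set0 -> ~` K = A `|` B ->
  components (~` K) = [set A; B].
Proof.
move=> cA cB oA oB [a Aa] [b Bb] AB KAB; rewrite /components.
have sepAB : separated A B.
  split; rewrite -subset0 => x [].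
  - move=> clx Bx; have [y [Ay By]] := clx B (open_nbhs_nbhs (conj oB Bx)).
    by have : (A `&` B) y by []; rewrite AB.
  - move=> Ax clx; have [y [By Ay]] := clx A (open_nbhs_nbhs (conj oA Ax)).
    by have : (A `&` B) y by []; rewrite AB.
have main (A' B' : set S) x : connected A' -> separated A' B' ->
    ~` K = A' `|` B' -> A' `&` B' = set0 -> A' x ->
    connected_component (~` K) x = A'.
  move=> cA' sep KAB' AB' A'x; rewrite eqEsubset; split; last first.
    by apply: connected_component_max => //; rewrite KAB'; left.
  have sub : connected_component (~` K) x `<=` A' `|` B'.
    by rewrite -KAB'; exact: connected_component_sub.
  have Kx : (~` K) x by rewrite KAB'; left.
  have [//|/(_ x) Bx] := connected_subset sep sub (@component_connected _ (~` K) x).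
  exfalso; have : (A' `&` B') x by split => //; apply: Bx; exact: connected_component_refl.
  by rewrite AB'.
rewrite eqEsubset; split=> [_ [x Kx <-]|_ [->|->]].
- move: Kx; rewrite KAB => -[Ax|Bx]; [left|right]; rewrite -KAB.
    exact: (main A B).
  by apply: (main B A) => //; rewrite ?(setUC B) ?(setIC B)// separatedC.
- exists a; first by rewrite KAB; left.
  exact: (main A B).
- exists b; first by rewrite KAB; right.
  by apply: (main B A) => //; rewrite ?(setUC B) ?(setIC B)// separatedC.
Qed.

Lemma component_partition (K I O : set S) :
    components (~` K) = [set I; O] -> I <> O ->
  [/\ I `&` O = set0, ~` K = I `|` O, connected I, I !=set0 & O !=set0].
Proof.
move=> KIO neq.
have [x Kx Ix] : components (~` K) I by rewrite KIO; left.
have [y Ky Oy] : components (~` K) O by rewrite KIO; right.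
split.
- rewrite -subset0 => z []; rewrite -Ix -Oy => xz yz; apply: neq.
  rewrite -Ix -Oy (same_connected_component xz).
  by apply/esym; exact: same_connected_component.
- rewrite eqEsubset; split => [z Kz|z].
    have : components (~` K) (connected_component (~` K) z) by exists z.
    by rewrite KIO => -[<-|<-]; [left|right]; exact: connected_component_refl.
  by case; [rewrite -Ix|rewrite -Oy]; exact: connected_component_sub.
- by rewrite -Ix; exact: component_connected.
- by exists x; rewrite -Ix; exact: connected_component_refl.
- by exists y; rewrite -Oy; exact: connected_component_refl.
Qed.

(** A point of I adherent to O could be added to O without disconnecting it, against maximality. So
    I is the open set ~K minus the closure of O: having just two components stands in for local
    connectedness. *)
Lemma component_open (K I O : set S) : closed K ->
  components (~` K) = [set I; O] -> I <> O -> open I.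
Proof.
move=> cK KIO neq; have [IO KE cI I0 O0] := component_partition KIO neq.
have [y Ky Oy] : components (~` K) O by rewrite KIO; right.
rewrite openE => x Ix.
have clx : ~ closure O x.
  move=> clx.
  have cOx : connected (O `|` [set x]).
    have cO : connected O by rewrite -Oy; exact: component_connected.
    apply: contrapT => /connectedPn[E [E0 OE sE]].
    have sO : O `<=` E false `|` E true by rewrite -OE; left.
    have contra (b : bool) : O `<=` E b -> False.
      move=> OEb; have [z Ez] := E0 (~~ b).
      have sb : separated (E b) (E (~~ b)) by case: (b) => //=; rewrite separatedC.
      have : (O `|` [set x]) z by rewrite OE; case: (b) Ez; [left|right].
      case=> [/OEb Eb|zx].
        have : (closure (E b) `&` E (~~ b)) z by split => //; exact: subset_closure.
        by rewrite sb.1.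
      have : (closure (E b) `&` E (~~ b)) z.
        by split => //; rewrite zx; exact: (closure_subset OEb).
      by rewrite sb.1.
    by have [] := connected_subset sE sO cO; exact: contra.
  have : O x.
    rewrite -Oy; apply: (connected_component_max _ _ cOx).
    - by left; rewrite -Oy; exact: connected_component_refl.
    - by rewrite KE => z [Oz|->]; [right|left].
    - by right.
  by move=> Ox; have : (I `&` O) x by []; rewrite IO.
have oK : open (~` K) by exact: closed_openC.
have nK : nbhs x (~` K) by apply: open_nbhs_nbhs; split => //; rewrite KE; left.
have nO : nbhs x (~` closure O).
  by apply: open_nbhs_nbhs; split => //; apply: closed_openC; exact: closed_closure.
apply: (filterS _ (filterI nK nO)) => z []; rewrite KE => -[//|Oz] h.
by exfalso; apply: h; exact: subset_closure.
Qed.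

Lemma connected_sphere : connected [set: S].
Proof.
have -> : [set: S] = closure (inC @` setT).
  rewrite eqEsubset; split => // -[z|] _ A nA.
    by exists (Some z); split; [exists z|exact: nbhs_singleton nA].
  move/nbhs_inftyP: nA => [_ [r r0 rA]]; exists (Some (r + 1)%:C); split.
    by exists (r + 1)%:C.
  by apply: rA; rewrite norm_realC ltcR gtr0_norm; lra.
apply: connected_closure; apply: connected_some.
by apply: star_connected.
Qed.

Lemma jordan_curve_closed (K : set S) : jordan_curve K -> closed K.
Proof.
move=> [f [cf _ <-]]; apply: compact_closed; first exact: hausdorff_sphere.
by apply: continuous_compact => //; exact: compact_unit_circle.
Qed.

Lemma jordan_curve_connected (K : set S) : jordan_curve K -> connected K.
Proof.
move=> [f [cf _ <-]]; apply: connected_continuous_connected => //.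
exact: connected_unit_circle.
Qed.

Lemma jordan_curve_nonempty (K : set S) : jordan_curve K -> K !=set0.
Proof.
move=> [f [_ _ <-]]; exists (f 1); exists 1 => //.
by rewrite /unit_circle /= normr1.
Qed.

Lemma mobius_inj (M : 'M[C]_2) : \det M != 0 -> injective (mobius M : S -> S).
Proof. by move=> M0; exact: can_inj (mobiusK M0). Qed.

Lemma mobius_circ_jordan (M : 'M[C]_2) : \det M != 0 -> jordan_curve (mobius M @` circ).
Proof.
move=> M0; exists (mobius M \o inC); split.
- apply: continuous_subspaceT => z; apply: continuous_comp.
    exact: one_point_compactification_some_continuous.
  exact: mobius_continuous.
- by move=> z w _ _ h; have [] := mobius_inj M0 h.
- by rewrite image_comp.
Qed.

Lemma mobius_circ_components (M : 'M[C]_2) : \det M != 0 ->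
  components (~` (mobius M @` circ)) = [set mobius M @` disc; mobius M @` ext].
Proof.
move=> M0.
have d0 : disc !=set0 by exists (Some 0); exists 0; rewrite //= normr0 ltr01.
apply: components2.
- by apply: connected_mobius => //; exact: connected_disc.
- by apply: connected_mobius => //; exact: connected_ext.
- by apply: mobius_open => //; exact: open_disc.
- by apply: mobius_open => //; exact: open_ext.
- by case: d0 => p dp; exists (mobius M p); exists p.
- by case: d0 => p dp; exists (mobius M (mobius (mx2 0 1 1 0) p)); exists (mobius (mx2 0 1 1 0) p) => //; exists p.
- rewrite -subset0 => _ [[p dp <-] [q eq h]]; have qp := mobius_inj M0 h.
  by have : (disc `&` ext) p; [split => //; rewrite -qp|rewrite disc_ext].
- by rewrite -mobius_image_setC // setC_circ image_setU.
Qed.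

End MobiusContinuity.

(** * Moebius transformations that absorb an open set *)

Section Absorbing.
Variable R : realType.
Local Notation C := R[i].
Local Notation S := (sphere R).
Local Notation inC := (Some : C -> S).

(** The point p is what rotations contradict, by recurrence, and q is what translations contradict,
    whose orbits tend to infinity in both directions. *)
Definition absorbing (f : S -> S) (U : set S) :=
  [/\ open U, f @` closure U `<=` U, exists2 p, U p & ~ (f @` closure U) p &
      exists q, ~ U q].

Lemma absorbing_iter f U n p : absorbing f U -> U p -> U (iter n f p).
Proof.
move=> [_ fU _ _] Up; elim: n => //= n IHn; apply: fU; exists (iter n f p) => //.
exact: subset_closure.
Qed.

Lemma archi_expr (k r : R) : 1 < k -> exists n, r < k ^+ n.
Proof.
move=> k1; have bern n : 1 + n%:R * (k - 1) <= k ^+ n.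
  elim: n => [|n IHn]; first by rewrite mul0r addr0 expr0.
  have k0 : 0 <= n%:R :> R by [].
  rewrite exprS -natr1; move: IHn; set x := k ^+ n; set m := n%:R in k0 * => IHn.
  have : k * (1 + m * (k - 1)) <= k * x by rewrite ler_pM2l //; lra.
  have : 0 <= m * ((k - 1) * (k - 1)) by rewrite mulr_ge0 // mulr_ge0; lra.
  nra.
have [n hn] : exists n : nat, `|r| / (k - 1) < n%:R.
  by exists (Num.bound (`|r| / (k - 1))); rewrite archi_boundP // divr_ge0 //; lra.
exists n; apply: lt_le_trans (bern n).
have := hn; rewrite ltr_pdivrMr ?subr_gt0 // => h.
by rewrite (le_lt_trans (ler_norm r)) // (lt_trans h) // ltrDr.
Qed.

(** The powers of w accumulate on the compact circle, and the quotient of two neighbouring ones is a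
    positive power near 1. *)
Lemma circle_recurrence (w : C) (e : R) : `|w| = 1 -> 0 < e ->
  exists n : nat, `|w ^+ n.+1 - 1| < e%:C.
Proof.
move=> w1 e0; pose u n := w ^+ n.
have un : (u @ \oo) (@unit_circle R).
  by exists 0%N => // n _ /=; rewrite /unit_circle /= normrX w1 expr1n.
have [c [_ cc]] := @compact_unit_circle R (u @ \oo) _ un.
have near N : exists2 n, (N <= n)%N & `|u n - c| < (e / 2)%:C.
  have nB : nbhs c [set z | `|z - c| < (e / 2)%:C].
    by apply/nbhs_complexP; exists (e / 2) => //; rewrite divr_gt0.
  have nA : (u @ \oo) (u @` [set n | (N <= n)%N]).
    by exists N => // n /= Nn; exists n.
  by have [z [[n Nn <-] h]] := cc _ _ nA nB; exists n.
have [n1 _ h1] := near 0%N; have [n2 n12 h2] := near n1.+1.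
exists (n2 - n1).-1; rewrite prednK ?subn_gt0 //.
have <- : `|u n2 - u n1| = `|w ^+ (n2 - n1) - 1|.
  rewrite /u -{1}(subnK (ltnW n12)) exprD -{2}[w ^+ n1]mul1r -mulrBl normrM normrX w1.
  by rewrite expr1n mulr1.
apply: le_lt_trans (ler_distD c _ _) _; rewrite [`|c - _|]distrC.
have -> : e%:C = (e / 2)%:C + (e / 2)%:C by rewrite -realCD -splitr.
exact: ltrD.
Qed.

Lemma closed_image_closure (M : 'M[C]_2) (U : set S) : \det M != 0 ->
  closed (mobius M @` closure U).
Proof. by move=> M0; apply: mobius_closed => //; exact: closed_closure. Qed.

(** The point p off the closed set f(closure U) would be approached by its own images, which all lie
    in that set. *)
Lemma absorbing_rotation (M : 'M[C]_2) (w : C) (U : set S) : \det M != 0 ->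
    `|w| = 1 -> (forall p, mobius M p = omap ( *%R w) p) ->
  ~ absorbing (mobius M) U.
Proof.
move=> M0 w1 fE absU; have [oU fU [p Up np] _] := absU.
have np' : nbhs p (~` (mobius M @` closure U)).
  apply: open_nbhs_nbhs; split=> //; apply: closed_openC; exact: closed_image_closure.
have fn z n : iter n (mobius M) (Some z) = Some (w ^+ n * z).
  by elim: n => [|n /= ->]; rewrite ?mul1r // fE /= mulrA exprS.
case: p Up np np' => [z|] Up np; last first.
  by case: np; exists None; [exact: subset_closure|rewrite fE].
move=> /nbhs_finiteP[e e0 he].
have [n hn] := circle_recurrence w1 (divr_gt0 e0 (ltr_wpDl (nrm_ge0 z) ltr01)).
apply: (he (w ^+ n.+1 * z)); last first.
  exists (iter n (mobius M) (Some z)); last by rewrite fn fE /= mulrA exprS.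
  by apply: subset_closure; exact: absorbing_iter.
rewrite -{2}[z]mul1r -mulrBl normrM; move: hn.
rewrite -!nrmE -!realCM !ltcR ltr_pdivlMr ?ltr_wpDl ?nrm_ge0 // => hn.
apply: le_lt_trans hn; rewrite ler_wpM2l ?nrm_ge0 //; lra.
Qed.

Lemma infty_in_absorbing (M : 'M[C]_2) (U : set S) : absorbing (mobius M) U ->
    mobius M None = None ->
    (forall r : R, exists2 z : C, U (Some z) & r%:C < `|z|) \/ U None ->
  U None.
Proof.
move=> [oU fU _ _] f0 [h|//]; apply: fU; exists None => // A /nbhs_inftyP[A0 [r r0 rA]].
by have [z Uz rz] := h r; exists (Some z); split => //; exact: rA.
Qed.

(** Nonzero points of U escape to infinity, which is thus in the closure of U and, being fixed, in
    U. *)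
Lemma absorbing_dilation (M : 'M[C]_2) (k : C) (U : set S) :
    1 < `|k| -> (forall p, mobius M p = omap ( *%R k) p) ->
  absorbing (mobius M) U -> U None.
Proof.
move=> k1 fE absU; apply: (infty_in_absorbing absU); first by rewrite fE.
have [oU fU [p Up _] _] := absU.
have fn z n : iter n (mobius M) (Some z) = Some (k ^+ n * z).
  by elim: n => [|n /= ->]; rewrite ?mul1r // fE /= mulrA exprS.
case: p Up => [z|] Up; [left|by right].
have [z' Uz' z'0] : exists2 z', U (Some z') & z' != 0.
  have [z0|z0] := eqVneq z 0; last by exists z.
  have /nbhs_finiteP[e e0 he] : nbhs (Some z : S) U by exact: open_nbhs_nbhs.
  exists (z + (e / 2)%:C).
    by apply: he; rewrite addrC addKr norm_realC ltcR gtr0_norm; lra.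
  by rewrite z0 add0r -realC0 (inj_eq (@complexI _)); apply: lt0r_neq0; lra.
move=> r; have nz : 0 < nrm z' by rewrite -ltcR nrmE normr_gt0.
have [|n hn] := @archi_expr (nrm k) (r / nrm z'); first by rewrite -ltcR nrmE.
exists (k ^+ n * z'); first by rewrite -fn; exact: absorbing_iter.
by rewrite normrM normrX -!nrmE -realCX -realCM ltcR -ltr_pdivrMr.
Qed.

(** A forward orbit puts the fixed point infinity into U. Then U contains a point far back on the
    orbit of q, hence q itself. *)
Lemma absorbing_translation (M : 'M[C]_2) (b : C) (U : set S) : b != 0 ->
  (forall p, mobius M p = omap ( +%R b) p) -> ~ absorbing (mobius M) U.
Proof.
move=> b0 fE absU; have [oU fU [p Up _] [q nq]] := absU.
have fn z n : iter n (mobius M) (Some z) = Some (b *+ n + z).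
  by elim: n => [|n /= ->]; rewrite ?add0r // fE /= addrA mulrS.
have nb : 0 < nrm b by rewrite -ltcR nrmE normr_gt0.
have far z (r : R) : exists2 n, r%:C < `|b *+ n + z| & r%:C < `|z - b *+ n|.
  pose n := Num.bound ((`|r| + nrm z) / nrm b).
  have : (`|r| + nrm z) / nrm b < n%:R.
    by rewrite archi_boundP // divr_ge0 // ?addr_ge0 // nrm_ge0.
  rewrite ltr_pdivrMr // => hn; have rr := ler_norm r.
  have nE : `|b *+ n| = (n%:R * nrm b)%:C.
    by rewrite normrMn realCM nrmE realCn mulr_natl.
  exists n.
    have := lerB_normD (b *+ n) z; rewrite nE.
    by rewrite -!nrmE -realCB ltcR lecR; lra.
  have := lerB_dist (b *+ n) z; rewrite distrC nE.
  by rewrite -!nrmE -realCB ltcR lecR; lra.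
have U0 : U None.
  apply: (infty_in_absorbing absU); first by rewrite fE.
  case: p Up => [z|] Up; [left|by right].
  move=> r; have [n hn _] := far z r; exists (b *+ n + z) => //.
  by rewrite -fn; exact: absorbing_iter.
have /nbhs_inftyP[_ [r r0 rA]] : nbhs (None : S) U by exact: open_nbhs_nbhs.
case: q nq => [z|] // nq; have [n _ hn] := far z r.
apply: nq; have := absorbing_iter n absU (rA _ hn).
by rewrite fn addrC subrK.
Qed.

Lemma absorbing_conj (M P : 'M[C]_2) (U : set S) : \det M != 0 -> \det P != 0 ->
  absorbing (mobius M) U ->
  absorbing (mobius (adj2 P * M * P)) (mobius P @^-1` U).
Proof.
move=> M0 P0 [oU fU [p Up np] [q nq]].
have fE x : mobius (adj2 P * M * P) x = mobius (adj2 P) (mobius M (mobius P x)).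
  by rewrite !mobiusM ?det_mulmx ?mulf_neq0 ?det_adj2.
have clE : mobius P @` closure (mobius P @^-1` U) = closure U.
  rewrite mobius_closure // eqEsubset; split; apply: closure_subset.
    by move=> _ [x Ux <-].
  by move=> x Ux; exists (mobius (adj2 P) x); rewrite /= ?mobiusVK.
split.
- by apply: open_comp => // x _; exact: mobius_continuous.
- move=> _ [x clx <-]; rewrite /= fE mobiusVK //; apply: fU.
  by exists (mobius P x) => //; rewrite -clE; exists x.
- exists (mobius (adj2 P) p); first by rewrite /= mobiusVK.
  move=> [x clx]; rewrite fE => /(mobius_inj (det_adj2_neq0 P0)) h; apply: np.
  by exists (mobius P x) => //; rewrite -clE; exists x.
- by exists (mobius (adj2 P) q); rewrite /= mobiusVK.
Qed.

End Absorbing.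

(** * Eigenvectors, and the types of real transformations *)

Section Eigen.
Variable F : fieldType.

Lemma eigenvector2 (M : 'M[F]_2) (k : F) : k ^+ 2 - \tr M * k + \det M = 0 ->
  exists x y, [/\ (x != 0) || (y != 0), M 0 0 * x + M 0 1 * y = k * x &
                  M 1 0 * x + M 1 1 * y = k * y].
Proof.
rewrite tr2E det2E => ch; have o0 : (1 : F) != 0 by exact: oner_neq0.
have [c0|c0] := eqVneq (M 1 0) 0; last first.
  exists (k - M 1 1), (M 1 0); split; first by rewrite c0 orbT.
    by apply/eqP; rewrite -subr_eq0 -oppr_eq0 -ch; apply/eqP; ring.
  by ring.
have [b0|b0] := eqVneq (M 0 1) 0; last first.
  exists (M 0 1), (k - M 0 0); split; first by rewrite b0.
    by ring.
  by apply/eqP; rewrite -subr_eq0 -oppr_eq0 -ch c0; apply/eqP; ring.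
have : (k - M 0 0) * (k - M 1 1) = 0 by rewrite -[RHS]ch c0; ring.
move=> /eqP; rewrite mulf_eq0 !subr_eq0 c0 b0 => /orP[]/eqP ->.
  by exists 1, 0; split; rewrite ?o0 //; ring.
by exists 0, 1; split; rewrite ?o0 ?orbT //; ring.
Qed.

Lemma eigenvector2_det (M : 'M[F]_2) (k l x y z t : F) : k != l ->
    (x != 0) || (y != 0) -> (z != 0) || (t != 0) ->
    M 0 0 * x + M 0 1 * y = k * x -> M 1 0 * x + M 1 1 * y = k * y ->
    M 0 0 * z + M 0 1 * t = l * z -> M 1 0 * z + M 1 1 * t = l * t ->
  x * t - z * y != 0.
Proof.
move=> kl xy0 zt0 e1 e2 e3 e4; apply/negP; rewrite subr_eq0 => /eqP d.
have kl0 : k - l != 0 by rewrite subr_eq0.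
have xz : x * z = 0.
  apply: (mulfI kl0); rewrite mulr0 mulrBl [k * _]mulrA -e1 [l * _]mulrCA -e3.
  by transitivity (M 0 1 * (z * y - x * t)); [ring|rewrite d subrr mulr0].
have yt : y * t = 0.
  apply: (mulfI kl0); rewrite mulr0 mulrBl [k * _]mulrA -e2 [l * _]mulrCA -e4.
  by transitivity (M 1 0 * (x * t - z * y)); [ring|rewrite d subrr mulr0].
have xt : x * t = 0.
  apply: (mulfI kl0); rewrite mulr0 mulrBl [l * _]mulrCA -e4 d [z * y]mulrC [k * _]mulrA -e2.
  by transitivity (M 1 1 * (z * y - x * t)); [ring|rewrite d subrr mulr0].
have zy : z * y = 0 by rewrite -d.
move/eqP: xz; move/eqP: yt; move/eqP: xt; move/eqP: zy; rewrite !mulf_eq0.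
by move: xy0 zt0; case: (x == 0); case: (y == 0); case: (z == 0); case: (t == 0).
Qed.
End Eigen.

Section AbsorbingReal.
Variable R : realType.
Local Notation C := R[i].
Local Notation S := (sphere R).

Lemma mobius_diag (a d : C) p : a != 0 -> d != 0 ->
  mobius (mx2 a 0 0 d) p = omap ( *%R (a / d)) p.
Proof.
move=> a0 d0; case: p => [z|] /=; rewrite !mxe2 ?eqxx // mul0r add0r addr0 (negPf d0).
by congr Some; rewrite mulrAC.
Qed.

Lemma det_realC (M : 'M[R]_2) : \det (map_mx (real_complex R) M) = (\det M)%:C.
Proof. exact: det_map_mx. Qed.

Lemma adj2_mul_eigen (K : comNzRingType) (M : 'M[K]_2) (k l x y z t : K) :
    M 0 0 * x + M 0 1 * y = k * x -> M 1 0 * x + M 1 1 * y = k * y ->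
    M 0 0 * z + M 0 1 * t = l * z -> M 1 0 * z + M 1 1 * t = l * t ->
  adj2 (mx2 x z y t) * M * mx2 x z y t = (x * t - z * y) *: mx2 k 0 0 l.
Proof.
move=> e1 e2 e3 e4; rewrite -mulrA.
have -> : M * mx2 x z y t = mx2 x z y t * mx2 k 0 0 l.
  by apply: matrix2P; rewrite !mxe2 ?e1 ?e2 ?e3 ?e4; ring.
rewrite mulrA adj2_mul_scal -scalerAl mul1r; congr (_ *: _).
by rewrite det2E !mxe2.
Qed.

(* A real matrix that is not hyperbolic is conjugate to a rotation or a
   translation, which no open set absorbs. *)
Lemma absorbing_real (M : 'M[R]_2) (U : set S) : \det M = 1 ->
    absorbing (real_mobius M) U ->
  exists k x y : R, [/\ 1 < `|k|, (x != 0) || (y != 0),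
    M 0 0 * x + M 0 1 * y = k * x, M 1 0 * x + M 1 1 * y = k * y &
    U (pt x%:C y%:C)].
Proof.
move=> M1 absU; pose N := map_mx (real_complex R) M.
have N1 : \det N = 1 by rewrite det_realC M1.
have N0 : \det N != 0 by rewrite N1 oner_neq0.
have NE i j : N i j = (M i j)%:C by rewrite mxE.
pose t := \tr M; have tN : \tr N = t%:C by rewrite /t !tr2E !NE realCD.
have diag_conj (k l x y z w : C) : k != l -> k * l != 0 ->
    (x != 0) || (y != 0) -> (z != 0) || (w != 0) ->
    N 0 0 * x + N 0 1 * y = k * x -> N 1 0 * x + N 1 1 * y = k * y ->
    N 0 0 * z + N 0 1 * w = l * z -> N 1 0 * z + N 1 1 * w = l * w ->
    exists P : 'M[C]_2, [/\ \det P != 0, mobius P None = pt x y,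
      \det (adj2 P * N * P) != 0,
      absorbing (mobius (adj2 P * N * P)) (mobius P @^-1` U) &
      forall p, mobius (adj2 P * N * P) p = omap ( *%R (k / l)) p].
  move=> kl klu xy0 zw0 e1 e2 e3 e4.
  have d0 := eigenvector2_det kl xy0 zw0 e1 e2 e3 e4.
  have P0 : \det (mx2 x z y w) != 0 by rewrite det2E !mxe2.
  move: (klu); rewrite mulf_eq0 negb_or => /andP[k0 l0].
  exists (mx2 x z y w); split => //.
  - by rewrite /= !mxe2.
  - by rewrite !det_mulmx !mulf_neq0 ?det_adj2.
  - exact: absorbing_conj.
  - move=> p; rewrite (adj2_mul_eigen e1 e2 e3 e4) mobiusZ ?mobius_diag //.
    by rewrite det2E !mxe2 mulr0 subr0.
have [t4|t4] := ltP 4 (t ^+ 2).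
  pose s := Num.sqrt (t ^+ 2 - 4).
  have s2 : s ^+ 2 = t ^+ 2 - 4 by rewrite sqr_sqrtr //; lra.
  have s0 : 0 < s by rewrite sqrtr_gt0; lra.
  (* Here k is the eigenvalue of larger modulus, so the sign of s in it is that of t. *)
  have [k [l [k1 kl_t kl1]]] : exists k l : R, [/\ 1 < `|k|, k + l = t & k * l = 1].
    have [tp|tn] := leP 0 t.
      exists ((t + s) / 2), ((t - s) / 2); split; [|lra|].
        have : 2 < t by nra.
        by rewrite gtr0_norm; lra.
      by transitivity ((t ^+ 2 - s ^+ 2) / 4); [field|rewrite s2; lra].
    exists ((t - s) / 2), ((t + s) / 2); split; [|lra|].
      have : t < - 2 by nra.
      by rewrite ltr0_norm; lra.
    by transitivity ((t ^+ 2 - s ^+ 2) / 4); [field|rewrite s2; lra].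
  have k0 : k != 0 by apply: contra_eqN kl1 => /eqP ->; rewrite mul0r eq_sym oner_eq0.
  have l0 : l != 0 by apply: contra_eqN kl1 => /eqP ->; rewrite mulr0 eq_sym oner_eq0.
  have chk : k ^+ 2 - \tr M * k + \det M = 0 by rewrite M1 -/t -kl_t -kl1; ring.
  have chl : l ^+ 2 - \tr M * l + \det M = 0 by rewrite M1 -/t -kl_t -kl1; ring.
  have [x [y [xy0 e1 e2]]] := eigenvector2 chk.
  have [z [w [zw0 e3 e4]]] := eigenvector2 chl.
  have absl : `|l| < 1.
    have := congr1 Num.norm kl1; rewrite normrM normr1; have := normr_ge0 l; nra.
  have kl : k != l by apply: contraTneq absl => <-; rewrite -leNgt ltW.
  have nzC (a b : R) : (a != 0) || (b != 0) -> (a%:C != 0) || (b%:C != 0).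
    by rewrite -!realC0 !(inj_eq (@complexI _)).
  have [||||||||P [P0 Pinf _ absP PE]] :=
      diag_conj k%:C l%:C x%:C y%:C z%:C w%:C; rewrite ?NE -?realCM.
  - by rewrite (inj_eq (@complexI _)).
  - by rewrite kl1 oner_neq0.
  - exact: nzC.
  - exact: nzC.
  - by rewrite -realCD e1.
  - by rewrite -realCD e2.
  - by rewrite -realCD e3.
  - by rewrite -realCD e4.
  exists k, x, y; split => //; rewrite -Pinf.
  apply: (absorbing_dilation _ PE absP).
  rewrite -realCV -realCM norm_realC -realC1 ltcR normf_div ltr_pdivlMr ?normr_gt0 //.
  by rewrite mul1r (lt_trans absl).
exfalso.
(* The elliptic case: conjugate eigenvalues of modulus 1, thus a rotation by k / l. After it comes
   the parabolic case, with the double eigenvalue e = 1 or -1. *)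
have [t4'|t4'] := eqVneq (t ^+ 2) 4; last first.
  have s2 : Num.sqrt (4 - t ^+ 2) ^+ 2 = 4 - t ^+ 2 by rewrite sqr_sqrtr //; lra.
  set s := Num.sqrt _ in s2.
  have s0 : 0 < s by rewrite sqrtr_gt0; move: t4 t4'; case: ltgtP => //; lra.
  pose k : C := (t / 2) +i* (s / 2); pose l : C := (t / 2) +i* (- (s / 2)).
  have kl1 : k * l = 1.
    apply/eqP; rewrite eq_complex /=; apply/andP; split; apply/eqP; last by ring.
    by transitivity ((t ^+ 2 + s ^+ 2) / 4); [field|rewrite s2; field].
  have kl_t : k + l = t%:C.
    by apply/eqP; rewrite eq_complex /=; apply/andP; split; apply/eqP; field.
  have kl : k != l.
    by rewrite eq_complex /= negb_and; apply/orP; right; apply/eqP; lra.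
  have chk : k ^+ 2 - \tr N * k + \det N = 0 by rewrite N1 tN -kl_t -kl1; ring.
  have chl : l ^+ 2 - \tr N * l + \det N = 0 by rewrite N1 tN -kl_t -kl1; ring.
  have [x [y [xy0 e1 e2]]] := eigenvector2 chk.
  have [z [w [zw0 e3 e4]]] := eigenvector2 chl.
  have klu : k * l != 0 by rewrite kl1 oner_neq0.
  have [P [P0 _ Q0 absP PE]] := diag_conj _ _ _ _ _ _ kl klu xy0 zw0 e1 e2 e3 e4.
  apply: (absorbing_rotation Q0 _ PE absP).
  have nk : `|k| = 1 by apply: (unit_circleE k).2 => /=; nra.
  have nl : `|l| = 1 by apply: (unit_circleE l).2 => /=; nra.
  by rewrite normf_div nk nl divr1.
have [e e2 et] : exists2 e : R, e ^+ 2 = 1 & t = e *+ 2.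
  by exists (t / 2); [rewrite expr_div_n t4'; field|rewrite mulr2n; lra].
have e0 : e != 0 by apply: contra_eqN e2 => /eqP ->; rewrite expr0n /= eq_sym oner_eq0.
have [c0|c0] := eqVneq (M 1 0) 0.
  have ad : M 0 0 * M 1 1 = 1 by rewrite -M1 det2E c0 mulr0 subr0.
  have apd : M 0 0 + M 1 1 = e *+ 2 by rewrite -et /t tr2E.
  have ae : M 0 0 = e.
    have : (M 0 0 - e) ^+ 2 = 0 by nra.
    by move/eqP; rewrite sqrf_eq0 subr_eq0 => /eqP.
  have de : M 1 1 = e by move: apd; rewrite ae mulr2n; lra.
  have fE p : real_mobius M p = omap ( +%R (M 0 1 / e)%:C) p.
    case: p => [z|]; rewrite /real_mobius /= -/N !NE c0 realC0 ?eqxx // mul0r add0r.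
    rewrite ae de -realC0 (inj_eq (@complexI _)) (negPf e0); congr Some.
    have e0' : e%:C != 0 by rewrite -realC0 (inj_eq (@complexI _)).
    by rewrite realCM realCV mulrDl mulrAC divff // mul1r addrC.
  (* The matrices 1 and -1 count as trivial rotations. *)
  have [b0|b0] := eqVneq (M 0 1) 0.
    apply: (absorbing_rotation N0 (w := 1) _ _ absU); first by rewrite normr1.
    move=> p; rewrite [LHS]fE b0 mul0r realC0; case: p => //= z.
    by rewrite add0r mul1r.
  apply: (absorbing_translation (b := (M 0 1 / e)%:C) _ fE absU).
  by rewrite -realC0 (inj_eq (@complexI _)) mulf_neq0 ?invr_eq0.
(* The first column is an eigenvector, and P brings N to its Jordan form, a translation by 1 / e. *)
pose P : 'M[C]_2 := mx2 (N 0 0 - e%:C) 1 (N 1 0) 0.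
have c0' : N 1 0 != 0 by rewrite NE -realC0 (inj_eq (@complexI _)).
have P0 : \det P != 0 by rewrite det2E !mxe2 mulr0 mul1r sub0r oppr_eq0.
have absP := absorbing_conj N0 P0 absU.
have e0' : e%:C != 0 by rewrite -realC0 (inj_eq (@complexI _)).
have NP : N * P = P * mx2 e%:C 1 0 e%:C.
  have dE : M 1 1 = e + e - M 0 0 by rewrite -mulr2n -et /t tr2E; ring.
  have bE : M 0 1 * M 1 0 = M 0 0 * M 1 1 - 1 by rewrite -M1 det2E; ring.
  apply: matrix2P; rewrite !mxe2 !NE; try by rewrite ?dE ?(realCB, realCD); ring.
  rewrite mul1r addr0 -realCB -!realCM bE -realCD dE -e2; congr (_%:C); ring.
apply: (absorbing_translation (b := e%:C^-1) (M := adj2 P * N * P) _ _ absP).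
  by rewrite invr_eq0.
move=> p; rewrite -mulrA NP mulrA adj2_mul_scal -scalerAl mul1r mobiusZ //.
  case: p => [z|] /=; rewrite !mxe2 ?eqxx // mul0r add0r (negPf e0'); congr Some.
  by field.
by rewrite det2E !mxe2 mulr0 subr0 mulf_neq0.
Qed.

End AbsorbingReal.

(** * Ping-pong *)

Section PingPong.
Variables (R : realType) (g : nat).
Local Notation S := (sphere R).
Local Notation letter := ('I_g * bool)%type.
Variables (m : 'I_g -> 'M[R[i]]_2) (C I O : letter -> set S).
Hypothesis m0 : forall i, \det (m i) != 0.
Hypothesis jC : forall k, jordan_curve (C k).
Hypothesis sch : schottky_curves (fun i => mobius (m i)) C I O.

Let disjC k l : k <> l -> C k `&` C l = set0.
Proof.
have [tC _ _ _] := sch; move=> kl; rewrite -subset0 => p Ckl.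
by apply: kl; apply: (tC k l) => //; exists p.
Qed.

Let disjI k l : k <> l -> closure (I k) `&` closure (I l) = set0.
Proof.
have [_ _ tI _] := sch; move=> kl; rewrite -subset0 => p Ckl.
by apply: kl; apply: (tI k l) => //; exists p.
Qed.

Let parts k : [/\ I k `&` O k = set0, ~` C k = I k `|` O k, connected (I k),
  I k !=set0 & O k !=set0].
Proof. by have [_ /(_ k)[neq comp] _ _] := sch; exact: component_partition. Qed.

Lemma inside_open k : open (I k).
Proof.
have [_ /(_ k)[neq comp] _ _] := sch; apply: component_open comp neq.
exact: jordan_curve_closed.
Qed.

Lemma outside_open k : open (O k).
Proof.
have [_ /(_ k)[neq comp] _ _] := sch.
apply: (component_open (K := C k) (O := I k)); first exact: jordan_curve_closed.
  by rewrite comp setUC.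
exact: nesym.
Qed.

(** As the complement of the outside, this is a closed set containing the closure of [I k]. It
    stands in for that closure, of which [C k] is not known to be a part. *)
Definition inside_closed k := I k `|` C k.

Lemma setC_inside_closed k : ~` inside_closed k = O k.
Proof.
have [IO CE _ _ _] := parts k; rewrite /inside_closed setCU CE.
rewrite eqEsubset; split => [p [nI []]//|p Op].
by split; [move=> Ip; have : (I k `&` O k) p by []; rewrite IO|right].
Qed.

Lemma setC_inside k : ~` I k = O k `|` C k.
Proof.
rewrite -(setCK (O k `|` C k)) setCU -setC_inside_closed setCK.
rewrite /inside_closed; congr (~` _); have [_ CE _ _ _] := parts k.
rewrite eqEsubset; split => [p Ip|p [[]]//]; split; first by left.
by move=> Cp; have : (~` C k) p by rewrite CE; left.
Qed.

Lemma closure_inside k : closure (I k) `<=` inside_closed k.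
Proof.
have cD : closed (inside_closed k).
  by rewrite -(setCK (inside_closed k)) setC_inside_closed; apply: open_closedC; exact: outside_open.
by move=> p; rewrite [inside_closed k](closure_id _).1 //; apply: closure_subset; left.
Qed.

(* A connected curve C k not lying outside C l would lie inside it, but C k meets
   the closure of I k, since the sphere is connected. *)
Lemma curve_outside k l : k <> l -> C k `<=` O l.
Proof.
move=> kl; have [IOl CEl cIl _ _] := parts l.
have sub : C k `<=` I l `|` O l.
  by rewrite -CEl => p Ck Cl; have : (C k `&` C l) p by []; rewrite disjC.
have sep : separated (I l) (O l).
  split; rewrite -subset0 => p [].
  - move=> clp Op; have [q [Iq Oq]] := clp _ (open_nbhs_nbhs (conj (@outside_open l) Op)).
    by have : (I l `&` O l) q by []; rewrite IOl.
  - move=> Ip clp; have [q [Oq Iq]] := clp _ (open_nbhs_nbhs (conj (@inside_open l) Ip)).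
    by have : (I l `&` O l) q by []; rewrite IOl.
have [CI|//] := connected_subset sep sub (jordan_curve_connected (jC k)).
exfalso; have [IOk CEk _ [i0 Ii0] _] := parts k.
have [c Cc] := jordan_curve_nonempty (jC k).
have [p clp Cp] : exists2 p, closure (I k) p & C k p.
  apply: contrapT => nex.
  have clI : closed (I k).
    move=> p clp; have [//|Cp] := closure_inside clp.
    by case: nex; exists p.
  have IT : I k = [set: S].
    apply: connected_sphere; first by exists i0.
      by exists (I k); [exact: inside_open|rewrite setTI].
    by exists (I k) => //; rewrite setTI.
  by have : (~` C k) c; [rewrite CEk IT; left|].
have : (closure (I k) `&` closure (I l)) p by split => //; apply: subset_closure; exact: CI.
by rewrite disjI.
Qed.

Lemma inside_closed_outside k l : k <> l -> inside_closed k `<=` O l.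
Proof.
move=> kl p [Ip|]; last exact: curve_outside.
rewrite -setC_inside_closed => -[Il|Cl].
  have : (closure (I k) `&` closure (I l)) p by split; exact: subset_closure.
  by rewrite disjI.
have Ok : O k p by apply: (@curve_outside l k) => //; exact: nesym.
have [IOk _ _ _ _] := parts k.
by have : (I k `&` O k) p by []; rewrite IOk.
Qed.

Definition lact (l : letter) : S -> S := mobius (lmx m l).

Lemma det_lmx_neq0 l : \det (lmx m l) != 0.
Proof. by rewrite /lmx; case: l.2; rewrite ?det_adj2 m0. Qed.

Lemma lactK l p : lact l (lact (flip l) p) = p.
Proof.
rewrite /lact /lmx; case: l => i [] /=; first by rewrite mobiusK.
by rewrite mobiusVK.
Qed.

(** For an inverse letter, take complements: the bijection A_i also maps the inside of C_i onto the
    outside of C_i'. *)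
Lemma lact_image l : lact l @` C l = C (flip l) /\ lact l @` O l = I (flip l).
Proof.
have [_ _ _ act] := sch; case: l => i [] /=; rewrite /lact /flip /lmx /=; last exact: act.
have [AC AO] := act i; have mK := mobiusK (m0 i).
have im (X Y : set S) : mobius (m i) @` X = Y -> mobius (adj2 (m i)) @` Y = X.
  move=> <-; rewrite eqEsubset; split=> [_ [_ [p Xp <-] <-]|p Xp]; first by rewrite mK.
  by exists (mobius (m i) p); [exists p|rewrite mK].
split; first exact: im.
have AIO : mobius (m i) @` (~` (O (i, false) `|` C (i, false))) =
           ~` (I (i, true) `|` C (i, true)).
  by rewrite mobius_image_setC // image_setU AC AO.
by apply: im; rewrite -setC_inside setCK in AIO; rewrite AIO; exact: setC_inside_closed.
Qed.

Lemma lact_outside l p : O l p -> I (flip l) (lact l p).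
Proof. by move=> Op; rewrite -(lact_image l).2; exists p. Qed.

Lemma flip_neq (l : letter) : flip l <> l.
Proof. by case: l => i []. Qed.

(** The last letter acts first. Each letter ends inside its flipped curve, which is outside the
    curve of the next letter to act because the word is reduced. *)
Lemma word_outside l w p : reduced (l :: w) -> O (last l w) p ->
  I (flip l) (foldr lact p (l :: w)).
Proof.
elim: w l => [|l' w IHw] l /= ; first by move=> _ Op; exact: lact_outside.
move=> /andP[ll' red] Op; apply: lact_outside; apply: (@inside_closed_outside (flip l')).
  by move=> e; move/eqP: ll'; apply; rewrite -e flipK.
by left; exact: IHw.
Qed.

(** Here the genus enters: among at least four curves, one differs from the two attached to the ends
    of a word. *)
Lemma third_letter (a b : letter) : (2 <= g)%N -> exists2 k, k <> a & k <> b.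
Proof.
move=> g2; have [k kl] : exists k, k \notin [:: a; b].
  apply/existsP; rewrite -negb_forall; apply: contraL g2 => /forallP full.
  have : (#|{: letter}| <= #|[:: a; b]|)%N by apply: subset_leq_card; apply/fintype.subsetP => k _.
  rewrite card_prod card_ord card_bool => h; have := leq_trans h (card_size [:: a; b]).
  by rewrite /= -ltnNge; lia.
by move: kl; rewrite !inE negb_or => /andP[/eqP ka /eqP kb]; exists k.
Qed.

Lemma inside_outside k p : I k p -> O k p -> False.
Proof. by have [IO _ _ _ _] := parts k; move=> Ip Op; have : (I k `&` O k) p by []; rewrite IO. Qed.

(** A point of a third curve is outside the curves of both [last l w] and [flip l], and the word
    takes it inside the latter. *)
Lemma word_nontrivial w : (2 <= g)%N -> reduced w -> w != [::] ->
  exists p, foldr lact p w <> p.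
Proof.
move=> g2; case: w => // l w red _.
have [k kl klast] := third_letter (flip l) (last l w) g2.
have [p Cp] := jordan_curve_nonempty (jC k); exists p => e.
apply: (@inside_outside (flip l) p); last exact: (@curve_outside k).
by rewrite -e; apply: word_outside => //; exact: (@curve_outside k).
Qed.

Lemma foldr_lact_inj w : injective (fun p => foldr lact p w).
Proof.
elim: w => //= l w IHw p q /= e; apply: IHw.
have K x : lact (flip l) (lact l x) = x by rewrite -{2}[l]flipK lactK.
by rewrite -[LHS]K e K.
Qed.

(** The hypothesis on the last letter makes the word cyclically reduced, so that [I (flip l)] lies
    where [word_outside] applies. The image of a point c of a third curve witnesses strictness,
    since c is off the closure of that inside. *)
Lemma word_absorbing l w : (2 <= g)%N -> reduced (l :: w) -> last l w <> flip l ->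
  absorbing (fun p => foldr lact p (l :: w)) (I (flip l)).
Proof.
move=> g2 red lastl; have [k kl klast] := third_letter (flip l) (last l w) g2.
have [c Cc] := jordan_curve_nonempty (jC k).
split.
- exact: inside_open.
- move=> _ [p /closure_inside Dp <-]; apply: word_outside => //.
  exact: (@inside_closed_outside (flip l)) (nesym lastl) _ Dp.
- exists (foldr lact c (l :: w)).
    by apply: word_outside => //; exact: (@curve_outside k).
  move=> [p clp /foldr_lact_inj pc]; have Dc : inside_closed (flip l) c.
    by rewrite -pc; exact: closure_inside.
  have : (~` inside_closed (flip l)) c by rewrite setC_inside_closed; exact: (@curve_outside k).
  by [].
- have [q Cq] := jordan_curve_nonempty (jC (flip l)); exists q => Iq.
  by have : (~` I (flip l)) q; [rewrite setC_inside; right|].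
Qed.

Lemma foldr_lact_wmx w : (fun p => foldr lact p w) = mobius (wmx m w).
Proof.
apply: funext => p; have dw w' : \det (wmx m w') != 0.
  by elim: w' => [|l w' IHw']; rewrite /= ?det1 ?oner_neq0 // det_mulmx mulf_neq0 ?det_lmx_neq0.
elim: w => [|l w IHw] /=; first by rewrite mobius1.
by rewrite IHw mobiusM ?det_lmx_neq0.
Qed.

End PingPong.

(** * Pairs of hyperbolic real matrices *)

Section RealPlane.
Variable R : realFieldType.
Implicit Types (u v w x p q : R * R) (a b : 'M[R]_2) (k l : R).

(** Vectors stand for points of the real projective line. The sign of a product of brackets depends
    on the points alone if each vector occurs an even number of times. *)
Definition br u v : R := u.1 * v.2 - u.2 * v.1.

Lemma sqr_gt0 (x : R) : x != 0 -> 0 < x ^+ 2.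
Proof. by move=> x0; rewrite lt_neqAle sqr_ge0 andbT eq_sym sqrf_eq0. Qed.

Lemma brC u v : br u v = - br v u. Proof. by rewrite /br; ring. Qed.

Lemma plucker u v w x : br u v * br w x = br u w * br v x - br u x * br v w.
Proof. by rewrite /br; ring. Qed.

(** The sign of such a form tells the two sides of a circle apart on the extended real line, see
    [side_quad]. *)
Definition quad (c : R * R * R) u : R :=
  c.1.1 * u.1 ^+ 2 + c.1.2 * (u.1 * u.2) + c.2 * u.2 ^+ 2.

Lemma sqr_sum_gt0 u : u != 0 -> 0 < u.1 ^+ 2 + u.2 ^+ 2.
Proof.
move=> u0; rewrite lt_neqAle addr_ge0 ?sqr_ge0 // andbT eq_sym paddr_eq0 ?sqr_ge0 // !sqrf_eq0.
by apply: contra u0; case: u => x y /= /andP[/eqP -> /eqP ->].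
Qed.

Lemma quad_br_neq0 c u w : 0 < quad c u -> quad c w <= 0 -> w != 0 -> br u w != 0.
Proof.
move=> qu qw w0; apply: contraTneq qw => uw; rewrite -ltNge.
have u2 : u.1 ^+ 2 * quad c w = w.1 ^+ 2 * quad c u.
  have : (u.1 * w.2 - u.2 * w.1) * (c.1.2 * (u.1 * w.1) + c.2 * (u.1 * w.2 + u.2 * w.1)) = 0.
    by rewrite -/(br u w) uw mul0r.
  by rewrite /quad => h; apply/eqP; rewrite -subr_eq0 -h; apply/eqP; ring.
have u2' : u.2 ^+ 2 * quad c w = w.2 ^+ 2 * quad c u.
  have : (u.1 * w.2 - u.2 * w.1) * (c.1.1 * (u.1 * w.2 + u.2 * w.1) + c.1.2 * (u.2 * w.2)) = 0.
    by rewrite -/(br u w) uw mul0r.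
  by rewrite /quad => h; apply/eqP; rewrite -subr_eq0 -oppr_eq0 -h; apply/eqP; ring.
have u0 : u != 0.
  by apply: contraTneq qu => ->; have -> : quad c 0 = 0; [rewrite /quad /=; ring|rewrite ltxx].
have hs : (u.1 ^+ 2 + u.2 ^+ 2) * quad c w = (w.1 ^+ 2 + w.2 ^+ 2) * quad c u.
  by rewrite mulrDl u2 u2' mulrDl.
by rewrite -(pmulr_rgt0 _ (sqr_sum_gt0 u0)) hs mulr_gt0 // sqr_sum_gt0.
Qed.

(* A quadratic form is positive on one of the two arcs of the projective line cut
   out by its zeros. *)
Lemma quad_unlinked c u v w x : 0 < quad c u -> 0 < quad c v ->
    quad c w <= 0 -> quad c x <= 0 -> w != 0 -> x != 0 ->
  0 < br u w * br v w * (br u x * br v x).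
Proof.
move=> qu qv qw qx w0 x0.
have uw := quad_br_neq0 qu qw w0; have vw := quad_br_neq0 qv qw w0.
have ux := quad_br_neq0 qu qx x0; have vx := quad_br_neq0 qv qx x0.
have [uv|uv] := eqVneq (br u v) 0.
  have e : br u w * br v x = br u x * br v w.
    by apply/eqP; rewrite -subr_eq0 -plucker uv mul0r.
  have -> : br u w * br v w * (br u x * br v x) = (br u w * br v x) ^+ 2.
    by transitivity ((br u w * br v x) * (br u x * br v w)); [ring|rewrite -e].
  by rewrite lt_neqAle sqr_ge0 andbT eq_sym sqrf_eq0 mulf_neq0.
(* The polar form at u and v. Expanding the form at y by Cramer's rule, br u v y = br y v u + br u y
   v, shows that br u y br v y has the sign of b wherever the form is not positive. *)
pose b := 2 * c.1.1 * u.1 * v.1 + c.1.2 * (u.1 * v.2 + u.2 * v.1) + 2 * c.2 * u.2 * v.2.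
have key y : br u v ^+ 2 * quad c y =
    br y v ^+ 2 * quad c u + br u y ^+ 2 * quad c v + br y v * br u y * b.
  by rewrite /quad /br /b; ring.
have main y : quad c y <= 0 -> br u y != 0 -> br v y != 0 -> 0 < br u y * br v y * b.
  move=> qy uy vy; have : br u v ^+ 2 * quad c y <= 0.
    by rewrite mulr_ge0_le0 ?sqr_ge0.
  rewrite key; have : 0 < br y v ^+ 2 * quad c u.
    by rewrite mulr_gt0 // lt_neqAle sqr_ge0 andbT eq_sym sqrf_eq0 brC oppr_eq0.
  have : 0 <= br u y ^+ 2 * quad c v by rewrite mulr_ge0 ?sqr_ge0 // ltW.
  rewrite (brC y v); nra.
have h1 := main _ qw uw vw; have h2 := main _ qx ux vx.
have b2 : 0 < b ^+ 2.
  rewrite lt_neqAle sqr_ge0 andbT eq_sym sqrf_eq0.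
  by apply: contraTneq h1 => ->; rewrite mulr0 ltxx.
rewrite -(pmulr_lgt0 _ b2).
have -> : br u w * br v w * (br u x * br v x) * b ^+ 2 =
  br u w * br v w * b * (br u x * br v x * b) by ring.
exact: mulr_gt0.
Qed.

Definition app a u : R * R := (a 0 0 * u.1 + a 0 1 * u.2, a 1 0 * u.1 + a 1 1 * u.2).

Lemma br_app a u v : br (app a u) (app a v) = \det a * br u v.
Proof. by rewrite /br /app /= det2E; ring. Qed.

Lemma appM a b u : app (a * b) u = app a (app b u).
Proof. by rewrite /app /= !mulmx2E; congr (_, _); ring. Qed.

Lemma app1 u : app 1 u = u.
Proof. by case: u => x y; rewrite /app /= !one2E; congr (_, _); ring. Qed.

Definition scal k u : R * R := (k * u.1, k * u.2).

Lemma app_scal a k u : app a (scal k u) = scal k (app a u).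
Proof. by rewrite /app /scal /=; congr (_, _); ring. Qed.

Lemma br_scall k u v : br (scal k u) v = k * br u v.
Proof. by rewrite /br /scal /=; ring. Qed.

Lemma br_scalr k u v : br u (scal k v) = k * br u v.
Proof. by rewrite /br /scal /=; ring. Qed.

Lemma eigen_trace a k u : \det a = 1 -> u != 0 -> app a u = scal k u ->
  k * \tr a = k ^+ 2 + 1.
Proof.
rewrite det2E tr2E /app /scal => a1 u0 [e1 e2].
have h1 : (k * (a 0 0 + a 1 1) - k ^+ 2 - 1) * u.1 = 0.
  have d1 : (a 0 0 * u.1 + a 0 1 * u.2 - k * u.1) * (a 1 1 - k)
     - a 0 1 * (a 1 0 * u.1 + a 1 1 * u.2 - k * u.2) = 0.
    by rewrite e1 e2 !subrr mul0r mulr0 subrr.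
  by apply/eqP; rewrite -oppr_eq0 -a1 -d1; apply/eqP; ring.
have h2 : (k * (a 0 0 + a 1 1) - k ^+ 2 - 1) * u.2 = 0.
  have d1 : (a 1 0 * u.1 + a 1 1 * u.2 - k * u.2) * (a 0 0 - k)
     - a 1 0 * (a 0 0 * u.1 + a 0 1 * u.2 - k * u.1) = 0.
    by rewrite e1 e2 !subrr mul0r mulr0 subrr.
  by apply/eqP; rewrite -oppr_eq0 -a1 -d1; apply/eqP; ring.
apply/eqP; rewrite -subr_eq0 opprD addrA; apply: contraT => n0.
move/eqP: h1; move/eqP: h2; rewrite !mulf_eq0 (negPf n0) /=.
by case: u u0 {e1 e2} => x y /= + /eqP y0 /eqP x0; rewrite x0 y0 eqxx.
Qed.

Definition attracting a k u := [/\ u != 0, 1 < `|k| & app a u = scal k u].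

Lemma attracting_neq0 a k u : attracting a k u -> k != 0.
Proof. by case=> _ k1 _; rewrite -normr_gt0; apply: lt_trans k1. Qed.

Lemma attracting_trace a k u : \det a = 1 -> attracting a k u -> 0 < k * \tr a /\ 4 < \tr a ^+ 2.
Proof.
move=> a1 h; have k0 := attracting_neq0 h; case: h => u0 k1 e.
have h := eigen_trace a1 u0 e; have k2 : 1 < k ^+ 2 by rewrite -real_normK ?num_real // exprn_egt1.
split; first by rewrite h; lra.
have h4 : 0 < (k ^+ 2 - 1) ^+ 2 by rewrite exprn_gt0 // subr_gt0.
have : 0 < k ^+ 2 * (\tr a ^+ 2 - 4).
  have -> : k ^+ 2 * (\tr a ^+ 2 - 4) = (k * \tr a) ^+ 2 - 4 * k ^+ 2 by ring.
  by rewrite h; move: h4; nra.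
by rewrite pmulr_rgt0; lra.
Qed.

(** A matrix and its inverse have the same trace, hence the same eigenvalue of modulus greater than
    1. The second conclusion describes the repelling fixed point of a. *)
Lemma attracting_unique a k l u v : \det a = 1 -> attracting a k u -> attracting (adj2 a) l v ->
  k = l /\ app a v = scal k^-1 v.
Proof.
move=> a1 hu hv; have k0 := attracting_neq0 hu; have l0 := attracting_neq0 hv.
have [u0 k1 eu] := hu; have [v0 l1 ev] := hv.
have da1 : \det (adj2 a) = 1 by rewrite det_adj2.
have trV : \tr (adj2 a) = \tr a by rewrite !tr2E !mxe2 addrC.
have hk := eigen_trace a1 u0 eu; have hl := eigen_trace da1 v0 ev; rewrite trV in hl.
have kl : k = l.
  have : (k - l) * (k * l - 1) = 0.
    have -> : (k - l) * (k * l - 1) = l * (k ^+ 2 + 1) - k * (l ^+ 2 + 1) by ring.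
    by rewrite -hk -hl; ring.
  move=> /eqP; rewrite mulf_eq0 !subr_eq0 => /orP[/eqP//|/eqP e].
  have := congr1 Num.norm e; rewrite normrM normr1 => h.
  have : 1 < `|k| * `|l| by rewrite -[1]mulr1 ltr_pM.
  by rewrite h ltxx.
split=> //; have := congr1 (app a) ev; rewrite -appM mulmx_adj2 // app1 app_scal => e.
have scalK x : scal k^-1 (scal k x) = x.
  by case: x => x y; rewrite /scal /= !mulrA mulVf // !mul1r.
by rewrite -[LHS]scalK; congr scal; rewrite [RHS]e kl.
Qed.

(** Up to squares, kappa is the product of the four brackets between fixed points of a and of b,
    which is negative exactly when the two pairs are linked. *)
Lemma kappa_eigen a b k m l n p p' q q' :
    app a p = scal k p -> app a p' = scal m p' ->
    app b q = scal l q -> app b q' = scal n q' ->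
  kappa a b * (br p p' * br q q') ^+ 2 =
    ((k - m) * (l - n)) ^+ 2 * (br p q * br p q' * (br p' q * br p' q')).
Proof.
move=> ep ep' eq eq'.
(* The spectral decomposition, with its denominator [br x y] cleared. *)
have spec (c : 'M[R]_2) (s t : R) (x y : R * R) : app c x = scal s x -> app c y = scal t y ->
   br x y *: c = mx2 (s * x.1 * y.2 - t * x.2 * y.1) (- (s - t) * x.1 * y.1)
     ((s - t) * x.2 * y.2) (t * x.1 * y.2 - s * x.2 * y.1).
  rewrite /app /scal /br => -[h1 h2] [h3 h4]; apply: matrix2P; rewrite !mxe2.
  - transitivity (y.2 * (c 0 0 * x.1 + c 0 1 * x.2) - x.2 * (c 0 0 * y.1 + c 0 1 * y.2)).
      by ring.
    by rewrite h1 h3; ring.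
  - transitivity (x.1 * (c 0 0 * y.1 + c 0 1 * y.2) - y.1 * (c 0 0 * x.1 + c 0 1 * x.2)).
      by ring.
    by rewrite h1 h3; ring.
  - transitivity (y.2 * (c 1 0 * x.1 + c 1 1 * x.2) - x.2 * (c 1 0 * y.1 + c 1 1 * y.2)).
      by ring.
    by rewrite h2 h4; ring.
  - transitivity (x.1 * (c 1 0 * y.1 + c 1 1 * y.2) - y.1 * (c 1 0 * x.1 + c 1 1 * x.2)).
      by ring.
    by rewrite h2 h4; ring.
transitivity (kappa (br p p' *: a) (br q q' *: b)).
  by rewrite /kappa !det2E !mxe2; ring.
by rewrite (spec _ _ _ _ _ ep ep') (spec _ _ _ _ _ eq eq') /kappa /br !det2E !mxe2; ring.
Qed.

Lemma kappa_sign a b k l p p' q q' : \det a = 1 -> \det b = 1 ->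
    attracting a k p -> attracting (adj2 a) k p' -> attracting b l q -> attracting (adj2 b) l q' ->
    br p p' != 0 -> br q q' != 0 ->
  (kappa a b < 0) = (br p q * br p q' * (br p' q * br p' q') < 0).
Proof.
move=> a1 b1 hp hp' hq hq' pp qq.
have [_ ep'] := attracting_unique a1 hp hp'; have [_ eq'] := attracting_unique b1 hq hq'.
have [_ _ ep] := hp; have [_ _ eq] := hq.
have inv1 (m : R) : 1 < `|m| -> m - m^-1 != 0.
  move=> m1; have m0 : m != 0 by rewrite -normr_gt0; apply: lt_trans m1.
  apply: contraTneq m1 => /eqP; rewrite subr_eq0 => /eqP e.
  have : m ^+ 2 = 1 by rewrite expr2 {2}e divff.
  by move=> /eqP; rewrite sqrf_eq1 => /orP[]/eqP ->; rewrite ?normrN normr1 ltxx.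
have D : 0 < (br p p' * br q q') ^+ 2 by rewrite sqr_gt0 // mulf_neq0.
have K : 0 < ((k - k^-1) * (l - l^-1)) ^+ 2.
  by rewrite sqr_gt0 // mulf_neq0 // inv1 //; [case: hp|case: hq].
by rewrite -(pmulr_llt0 _ D) (kappa_eigen ep ep' eq eq') pmulr_rlt0.
Qed.

(* The eigenvector f of ab with eigenvalue n and its image under b, followed from
   the inside c of the attracting side of a to the inside d of that of b. *)
Lemma trace_product_sign a b k l n p p' q q' f c d : \det a = 1 -> \det b = 1 ->
    attracting a k p -> attracting (adj2 a) k p' -> attracting b l q -> attracting (adj2 b) l q' ->
    attracting (a * b) n f ->
    0 < quad c p -> 0 < quad c f -> quad c p' <= 0 -> quad c q' <= 0 ->
    0 < quad d q -> 0 < quad d (app b f) -> quad d p' <= 0 -> quad d q' <= 0 ->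
  0 < \tr a * \tr b * \tr (a * b) * (br p p' * br p q' * (br q p' * br q q')).
Proof.
move=> a1 b1 hp hp' hq hq' hf cp cf cp' cq' dq dg dp' dq'.
have [_ ep'] := attracting_unique a1 hp hp'; have [_ eq'] := attracting_unique b1 hq hq'.
have k0 := attracting_neq0 hp; have l0 := attracting_neq0 hq; have n0 := attracting_neq0 hf.
have [p0' _ _] := hp'; have [q0' _ _] := hq'; have [f0 _ ef] := hf.
have ab1 : \det (a * b) = 1 by rewrite det_mulmx a1 b1 mulr1.
have [ta _] := attracting_trace a1 hp; have [tb _] := attracting_trace b1 hq.
have [tab _] := attracting_trace ab1 hf.
set g := app b f in dg.
(* As a has determinant 1, it preserves the bracket of g and p', which it sends to n f and k^-1 p'.
   In [h2], b does the same with f and q'. *)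
have h1 : n * br f p' = k * br g p'.
  have := br_app a g p'; rewrite a1 mul1r -appM ef ep' br_scall br_scalr => e.
  by rewrite -e; field.
have h2 : br g q' = l * br f q'.
  have := br_app b f q'; rewrite b1 mul1r -/g eq' br_scalr => e.
  by rewrite -e; field.
have gp' := quad_br_neq0 dg dp' p0'; have fq' := quad_br_neq0 cf cq' q0'.
have s1 := quad_unlinked cp cf cp' cq' p0' q0'.
have s2 := quad_unlinked dq dg dp' dq' p0' q0'.
(* Eliminating f and g from [s1] and [s2] leaves the sign of n k l, which by [T] is that of the
   product of the traces. *)
have P1 : 0 < n * k * l * (br p p' * br p q' * (br q p' * br q q')).
  have S : 0 < (k * br g p' * (l * br f q') ) ^+ 2 by rewrite sqr_gt0 // !mulf_neq0.
  have := mulr_gt0 s1 s2; have nn := sqr_gt0 n0.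
  move=> /(mulr_gt0 nn).
  have -> : n ^+ 2 * (br p p' * br f p' * (br p q' * br f q') * (br q p' * br g p' * (br q q' * br g q')))
     = (n * br f p') * br g p' * (br f q' * br g q') * (n * (br p p' * br p q' * (br q p' * br q q'))).
    by ring.
  rewrite h1 h2.
  have -> : k * br g p' * br g p' * (br f q' * (l * br f q')) * (n * (br p p' * br p q' * (br q p' * br q q'))) =
     (br g p' * br f q') ^+ 2 * (n * k * l * (br p p' * br p q' * (br q p' * br q q'))) by ring.
  by rewrite pmulr_rgt0 // sqr_gt0 // mulf_neq0.
have T : 0 < (k * \tr a) * (l * \tr b) * (n * \tr (a * b)) by rewrite (mulr_gt0 (mulr_gt0 ta tb) tab).
have NKL : 0 < (n * k * l) ^+ 2 by rewrite sqr_gt0 // !mulf_neq0.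
have := mulr_gt0 T P1.
have -> : k * \tr a * (l * \tr b) * (n * \tr (a * b)) *
   (n * k * l * (br p p' * br p q' * (br q p' * br q q'))) = (n * k * l) ^+ 2 *
   (\tr a * \tr b * \tr (a * b) * (br p p' * br p q' * (br q p' * br q q'))) by ring.
by rewrite pmulr_rgt0.
Qed.

(** The two products are D X and D Y, where X + Y = D is a Pluecker relation. For unlinked pairs X Y
    < 0, so one of the products is negative. *)
Lemma linked_pairing p p' q q' :
    br p q * br p q' * (br p' q * br p' q') > 0 -> br p p' != 0 -> br q q' != 0 ->
  br p p' * br p q' * (br q p' * br q q') < 0 \/ br p p' * br p q * (br q' p' * br q' q) < 0.
Proof.
move=> h pp qq; pose D := br p p' * br q q'.
have D2 : 0 < D ^+ 2 by rewrite lt_neqAle sqr_ge0 andbT eq_sym sqrf_eq0 mulf_neq0.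
pose X := br q p' * br p q'; pose Y := - (br p q * br q' p').
have XY : X + Y = D.
  by rewrite /X /Y /D /br; ring.
have -> : br p p' * br p q' * (br q p' * br q q') = D * X by rewrite /D /X; ring.
have -> : br p p' * br p q * (br q' p' * br q' q) = D * Y.
  by rewrite /D /Y (brC q' q); ring.
have XYn : X * Y < 0.
  have -> : X * Y = - (br p q * br p q' * (br p' q * br p' q')).
    by rewrite /X /Y (brC q p') (brC q' p'); ring.
  by rewrite oppr_lt0.
have [DX|DX] := ltP (D * X) 0; [by left|right].
have : D * X * (D * Y) < 0.
  have -> : D * X * (D * Y) = D ^+ 2 * (X * Y) by ring.
  by rewrite pmulr_rlt0.
by move: DX; nra.
Qed.

(* When a and b generate the group of a pair of pants, a^2 b is not a boundary
   curve, and (a, a^2 b) has none of the sign patterns of [classical_pair]. *)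
Lemma trace_twist a b : \det a = 1 -> \det b = 1 ->
    4 < \tr a ^+ 2 -> \tr a * \tr b * \tr (a * b) < 0 ->
  let c := a * (a * b) in
  ~ [\/ kappa a c < 0, \tr a * \tr c * \tr (a * c) < 0 |
        \tr a * \tr c * \tr (a * adj2 c) < 0].
Proof.
move=> a1 b1 a4 neg c.
have c1 : \det c = 1 by rewrite !det_mulmx a1 b1 !mulr1.
have ab1 : \det (a * b) = 1 by rewrite !det_mulmx a1 b1 !mulr1.
have mulE (x y : 'M[R]_2) : \det x = 1 -> \tr (x * (x * y)) = \tr x * \tr (x * y) - \tr y.
  move=> x1; have -> : \tr (x * (x * y)) = \tr x * \tr (x * y) - \det x * \tr y.
    by rewrite !tr2E !mxe2 !det2E; ring.
  by rewrite x1 mul1r.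
have tc : \tr c = \tr a * \tr (a * b) - \tr b := mulE _ _ a1.
have tac : \tr (a * c) = \tr a * \tr c - \tr (a * b) := mulE _ _ a1.
have tac' : \tr (a * adj2 c) = \tr (a * b).
  have -> : a * adj2 c = a * adj2 b * adj2 a * adj2 a.
    by rewrite /c !adj2M !mulrA.
  have -> : \tr (a * adj2 b * adj2 a * adj2 a) = \det a * \tr (a * b).
    rewrite !tr2E !mxe2 !det2E; ring.
  by rewrite a1 mul1r.
move: neg; rewrite (kappaE a1 c1) tac' tac tc.
set u := \tr a in a4 *; set v := \tr b; set w := \tr (a * b).
move=> neg.
have W0 : 0 < (u * w) ^+ 2.
  by rewrite lt_neqAle sqr_ge0 andbT eq_sym sqrf_eq0; apply: contraTneq neg => h;
    rewrite mulrAC h mul0r ltxx.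
have v2 := sqr_ge0 v; have w2 := sqr_ge0 w.
(* The first quantity is kappa a b again. As u v w < 0 and u^2 > 4, all three expand into
   nonnegative terms of positive sum. *)
case.
- have -> : u ^+ 2 + (u * w - v) ^+ 2 + (u * (u * w - v) - w) ^+ 2 -
    u * (u * w - v) * (u * (u * w - v) - w) - 4 = u ^+ 2 + v ^+ 2 + w ^+ 2 - u * v * w - 4 by ring.
  by lra.
- have -> : u * (u * w - v) * (u * (u * w - v) - w) =
     (u ^+ 2 - 1) * (u * w) ^+ 2 + (2 * u ^+ 2 - 1) * (- (u * v * w)) + u ^+ 2 * v ^+ 2 by ring.
  have := mulr_ge0 (sqr_ge0 u) v2.
  have : 0 < (u ^+ 2 - 1) * (u * w) ^+ 2 by rewrite mulr_gt0 //; lra.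
  have : 0 < (2 * u ^+ 2 - 1) * (- (u * v * w)) by rewrite mulr_gt0 //; lra.
  by lra.
- have -> : u * (u * w - v) * w = (u * w) ^+ 2 - u * v * w by ring.
  by lra.
Qed.

End RealPlane.

(** * Classical systems of real generators *)

Section CircleForms.
Variable R : realType.
Local Notation C := R[i].
Local Notation S := (sphere R).

Lemma geometric_circle_mobius (K : set S) : geometric_circle K ->
  exists2 P : 'M[C]_2, \det P != 0 & K = mobius P @` @circ R.
Proof.
have im (P : 'M[C]_2) : \det P != 0 ->
    (forall p, K p <-> @circ R (mobius (adj2 P) p)) -> K = mobius P @` @circ R.
  move=> P0 h; rewrite mobius_preimage // eqEsubset.
  by split=> p; rewrite /= -?h // => Kp; exact/h.
case=> [[c [r [r0 KE]]]|[a [b [b0 KE]]]].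
  have rc0 : r%:C != 0 by rewrite -realC0 (inj_eq (@complexI _)) gt_eqF.
  have P0 : \det (mx2 r%:C c 0 1) != 0 by rewrite det2E !mxe2 mulr1 mulr0 subr0.
  exists (mx2 r%:C c 0 1); first exact: P0.
  apply: im => // -[z|].
    rewrite -[Some z]/(Some z : S); have -> : (Some z : S) = pt z 1 by rewrite /pt oner_eq0 divr1.
    rewrite mobius_pt ?det_adj2 ?oner_neq0 ?orbT // !mxe2 circP; last first.
      by apply/orP; right; rewrite oppr0 mul0r add0r mulr1.
    rewrite oppr0 mul0r add0r !mulr1 mul1r norm_realC (gtr0_norm r0) KE /pt oner_eq0 divr1.
    by split=> [[w /= wr [<-]]|h] //; exists z.
  have -> : (None : S) = pt 1 0 by rewrite /pt eqxx.
  rewrite mobius_pt ?det_adj2 ?oner_neq0 // !mxe2 circP; last first.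
    by rewrite !mulr0 !addr0 mulr1 oner_neq0.
  rewrite !mulr0 !addr0 mulr1 oppr0 mul0r normr1 normr0 KE /pt eqxx; split=> [[]//|/eqP].
  by rewrite oner_eq0.
(* The Cayley map i (1 + z) / (1 - z), which takes the unit circle to the extended real line,
   followed by t -> a + b t. *)
pose P : 'M[C]_2 := mx2 (b * 'i - a) (b * 'i + a) (- 1) 1.
have i0 : ('i : C) != 0 by rewrite eq_complex /= oner_eq0 andbF.
have P0 : \det P != 0.
  rewrite det2E !mxe2; have -> : (b * 'i - a) * 1 - (b * 'i + a) * -1 = 2 * (b * 'i) by ring.
  by rewrite !mulf_neq0 // pnatr_eq0.
exists P => //; apply: im => // p.
have [x [y [xy0 ->]]] := ptP p; rewrite mobius_pt ?det_adj2 // circP; last first.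
  by apply: det_coord_neq0; rewrite ?det_adj2.
rewrite !mxe2 opprK mul1r; have [y0|y0] := eqVneq y 0.
  rewrite y0 !mulr0 !addr0 KE /pt eqxx; split => // _; by right.
pose w := (x / y - a) / b.
have hx : x / y = a + w * b by rewrite /w divfK // addrC subrK.
have -> : x + - (b * 'i + a) * y = (w - 'i) * (b * y).
  by rewrite -[x in LHS](divfK y0) hx; ring.
have -> : x + (b * 'i - a) * y = (w + 'i) * (b * y).
  by rewrite -[x in LHS](divfK y0) hx; ring.
have by0 : `|b * y| != 0 by rewrite normr_eq0 mulf_neq0.
have main : `|w - 'i| = `|w + 'i| <-> complex.Im w = 0.
  have sq (z1 z2 : C) : `|z1| = `|z2| <->
      complex.Re z1 ^+ 2 + complex.Im z1 ^+ 2 = complex.Re z2 ^+ 2 + complex.Im z2 ^+ 2.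
    split=> [e|e]; last by rewrite !normc_def e.
    by apply: complexI; rewrite !add_Re2_Im2 e.
  rewrite sq; case: w {hx} => s t /=; rewrite oppr0 !addr0.
  by split=> [|->]; [nra|rewrite !add0r sqrrN].
rewrite (normrM (_ - _)) (normrM (_ + _)); split.
  rewrite KE /pt (negPf y0) => -[[z [t _ <-]] [e]|//]; congr (_ * _); apply/main.
  have -> : w = t%:C by rewrite /w -e addrAC subrr add0r mulfK.
  by [].
move=> e; have /main w0 := mulIf by0 e; rewrite KE /pt (negPf y0); left; exists (x / y) => //.
exists (complex.Re w) => //; rewrite hx; congr (_ + _ * _).
by case: (w) w0 => s t /= ->.
Qed.

Definition ptR (u : R * R) : S := pt u.1%:C u.2%:C.

Lemma nonzeroC (u : R * R) : u != 0 -> (u.1%:C != 0) || (u.2%:C != 0).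
Proof. by case: u => x y; rewrite -!realC0 !(inj_eq (@complexI _)) -negb_and. Qed.

Lemma real_mobius_ptR (M : 'M[R]_2) (u : R * R) : \det M != 0 -> u != 0 ->
  real_mobius M (ptR u) = ptR (app M u).
Proof.
move=> M0 u0; rewrite /real_mobius /ptR mobius_pt ?nonzeroC //.
  by rewrite !mxE -!realCM -!realCD.
by rewrite det_realC -realC0 (inj_eq (@complexI _)).
Qed.

Lemma ltr_normC (z w : C) : `|z| < `|w| <->
  complex.Re z ^+ 2 + complex.Im z ^+ 2 < complex.Re w ^+ 2 + complex.Im w ^+ 2.
Proof.
by rewrite -[_ ^+ 2 + _ < _]ltcR !add_Re2_Im2 ltr_pXn2r ?nnegrE.
Qed.

(** The side of a point depends on which coordinate of its preimage under P has the larger modulus.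
    For real u, the difference of the squared moduli is a real form in u. *)
Lemma side_quad (P : 'M[C]_2) : \det P != 0 -> exists c, forall u : R * R, u != 0 ->
  ((mobius P @` @disc R) (ptR u) <-> 0 < quad c u) /\
  ((mobius P @` @ext R) (ptR u) <-> 0 < quad (- c.1.1, - c.1.2, - c.2) u).
Proof.
move=> P0; pose Q := adj2 P; pose re i j := complex.Re (Q i j); pose im i j := complex.Im (Q i j).
pose f (i j k l : 'I_2) := re i j * re k l + im i j * im k l.
exists (f 1 0 1 0 - f 0 0 0 0, 2 * (f 1 0 1 1 - f 0 0 0 1), f 1 1 1 1 - f 0 1 0 1).
move=> u u0; rewrite !mobius_preimage // /= /ptR.
have nz := nonzeroC u0; have dQ : \det Q != 0 by rewrite det_adj2.
rewrite mobius_pt // discP ?extP ?det_coord_neq0 // !ltr_normC.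
have reE i : complex.Re (Q i 0 * u.1%:C + Q i 1 * u.2%:C) = re i 0 * u.1 + re i 1 * u.2.
  rewrite /re; case: (Q i 0) (Q i 1) => [s t] [s' t'] /=; ring.
have imE i : complex.Im (Q i 0 * u.1%:C + Q i 1 * u.2%:C) = im i 0 * u.1 + im i 1 * u.2.
  rewrite /im; case: (Q i 0) (Q i 1) => [s t] [s' t'] /=; ring.
rewrite !reE !imE /quad /f /=; split; rewrite -subr_gt0;
  [set e := (X in 0 < X <-> _)|set e := (X in 0 < X <-> _)].
all: match goal with |- _ <-> is_true (0 < ?e') => have -> : e = e' by rewrite /e; ring end; by [].
Qed.

End CircleForms.

(** * Generated groups and lifts to SL(2, R) *)

Section Groups.
Variable R : realType.
Local Notation C := R[i].
Local Notation S := (sphere R).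
Implicit Types (a b : 'M[R]_2) (G H : set (S -> S)).

Lemma real_det_neq0 a : \det a = 1 -> \det (map_mx (real_complex R) a) != 0.
Proof. by move=> a1; rewrite det_realC a1 oner_neq0. Qed.

Lemma real_mobiusM a b : \det a = 1 -> \det b = 1 ->
  real_mobius (a * b) = real_mobius a \o real_mobius b.
Proof.
move=> a1 b1; apply: funext => p.
by rewrite /real_mobius /= map_mx2M mobiusM ?real_det_neq0.
Qed.

Lemma map_adj2 a : map_mx (real_complex R) (adj2 a) = adj2 (map_mx (real_complex R) a).
Proof. by apply: matrix2P; rewrite ![in RHS]mxE /= ![in LHS]mxE /= ?realCN. Qed.

Lemma group_mul H a b : mobius_group H -> \det a = 1 -> \det b = 1 ->
  H (real_mobius a) -> H (real_mobius b) -> H (real_mobius (a * b)).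
Proof. by move=> [_ _ HM _] a1 b1 Ha Hb; rewrite real_mobiusM //; exact: HM. Qed.

Lemma group_adj2 H a : mobius_group H -> \det a = 1 ->
  H (real_mobius a) -> H (real_mobius (adj2 a)).
Proof.
move=> [_ _ _ HV] a1 /HV[h Hh [fh hf]]; suff -> : real_mobius (adj2 a) = h by [].
apply: funext => p; by rewrite -[LHS]fh /real_mobius map_adj2 mobiusVK ?real_det_neq0.
Qed.

(** Without a group H containing X, [smallest] would be an empty intersection, that is, the set of
    all maps. *)
Lemma generated_group (X H : set (S -> S)) : mobius_group H -> X `<=` H ->
  mobius_group (generated X).
Proof.
move=> gH XH; have gen h : generated X h <-> forall K, mobius_group K -> X `<=` K -> K h.
  by split=> [Xh K gK XK|Xh K []]; [exact: Xh|exact: Xh].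
split.
- by move=> f /gen/(_ _ gH XH); case: gH => + _ _ _; exact.
- by apply/gen => K [].
- by move=> f h /gen Xf /gen Xh; apply/gen => K gK XK; case: (gK) => _ _ + _; apply; [exact: Xf|exact: Xh].
- move=> f /gen Xf; have [_ _ _ HV] := gH; have [h Hh [fh hf]] := HV _ (Xf _ gH XH).
  exists h => //; apply/gen => K gK XK; have [_ _ _ KV] := gK.
  have [h' Kh' [fh' hf']] := KV _ (Xf _ gK XK).
  suff -> : h = h' by [].
  by apply: funext => p; rewrite -{1}[p]hf' fh.
Qed.

Lemma sub_generated (X : set (S -> S)) : X `<=` generated X.
Proof. by move=> f Xf K [_ XK]; exact: XK. Qed.

Lemma generated_min (X H : set (S -> S)) : mobius_group H -> X `<=` H ->
  generated X `<=` H.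
Proof. by move=> gH XH f; apply. Qed.

Lemma generated_eq (X Y : set (S -> S)) H : mobius_group H -> H = generated X ->
  Y `<=` H -> X `<=` generated Y -> H = generated Y.
Proof.
move=> gH HX YH XY; rewrite eqEsubset; split; last exact: generated_min.
by rewrite HX; apply: generated_min => //; exact: generated_group gH YH.
Qed.

Lemma PSL2R_lift (I : finType) (A : I -> S -> S) : (forall i, PSL2R (A i)) ->
  exists a : I -> 'M[R]_2, forall i, \det (a i) = 1 /\ A i = real_mobius (a i).
Proof.
move=> h; have /fin_all_exists[a ha] : forall i, exists M : 'M[R]_2,
    \det M = 1 /\ A i = real_mobius M.
  by move=> i; case: (h i) => M M1 AM; exists M.
by exists a.
Qed.

End Groups.

(** * Fixed points in a classical system *)

Section Classical.
Variables (R : realType) (g : nat).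
Local Notation C := R[i].
Local Notation S := (sphere R).
Local Notation letter := ('I_g * bool)%type.

Lemma real_wmx (a : 'I_g -> 'M[R]_2) w :
  mobius (wmx (fun i => map_mx (real_complex R) (a i)) w) = real_mobius (wmx a w) :> (S -> S).
Proof. by rewrite -wmx_map. Qed.

(** A cyclically reduced word absorbs an inside, so it is hyperbolic with its attracting fixed point
    there. Any Jordan curves will do, which the converse uses for a commutator. *)
Lemma word_attracting (a : 'I_g -> 'M[R]_2) (K I O : letter -> set S) l w : (2 <= g)%N ->
    (forall i, \det (a i) = 1) -> (forall k, jordan_curve (K k)) ->
    schottky_curves (fun i => real_mobius (a i)) K I O ->
    reduced (l :: w) -> last l w <> flip l ->
  exists k u, attracting (wmx a (l :: w)) k u /\ I (flip l) (ptR u).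
Proof.
move=> g2 a1 jK sch red lastl; pose m i := map_mx (real_complex R) (a i).
have m0 i : \det (m i) != 0 by exact: real_det_neq0.
have := word_absorbing m0 jK sch g2 red lastl.
rewrite (foldr_lact_wmx m0) real_wmx => /absorbing_real[].
  exact: det_wmx.
move=> k [x [y [k1 xy0 e1 e2 Uxy]]]; exists k, (x, y); split => //; split => //.
  by move: xy0; rewrite -negb_and.
by rewrite /app /scal /= e1 e2.
Qed.

Lemma letter_attracting (a : 'I_g -> 'M[R]_2) (K I O : letter -> set S) : (2 <= g)%N ->
    (forall i, \det (a i) = 1) -> (forall k, jordan_curve (K k)) ->
    schottky_curves (fun i => real_mobius (a i)) K I O -> forall l,
  exists k u, attracting (lmx a l) k u /\ I (flip l) (ptR u).
Proof.
move=> g2 a1 jK sch l.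
have [k [u [hu Iu]]] := @word_attracting a K I O l [::] g2 a1 jK sch isT (nesym (@flip_neq _ l)).
by exists k, u; rewrite /= mulr1 in hu.
Qed.

Definition circle_forms (I : letter -> set S) (q : letter -> R * R * R) :=
  forall k u, u != 0 -> I k (ptR u) <-> 0 < quad (q k) u.

Lemma quad_other_inside (A : 'I_g -> S -> S) (K I O : letter -> set S) q k l u :
    schottky_curves A K I O -> circle_forms I q -> u != 0 -> k <> l -> I k (ptR u) ->
  quad (q l) u <= 0.
Proof.
move=> [_ _ tI _] Iq u0 kl Ik; rewrite leNgt; apply/negP => /(Iq _ _ u0) Il.
by apply: kl; apply: (tI k l) => //; exists (ptR u); split; exact: subset_closure.
Qed.

Lemma classical_forms (A : 'I_g -> S -> S) G : classical_schottky_on A G ->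
  exists K I O q, [/\ forall k, jordan_curve (K k), schottky_curves A K I O &
    circle_forms I q].
Proof.
move=> [_ _ [K [I [Ou [cK sch]]]]]; have [_ comp _ _] := sch.
have /fin_all_exists[q hq] : forall k, exists c, forall u : R * R, u != 0 ->
    I k (ptR u) <-> 0 < quad c u.
  move=> k; have [P P0 KE] := geometric_circle_mobius (cK k).2.
  have [IO comp_k] := comp k; have [c hc] := side_quad P0.
  have : [set I k; Ou k] (I k) by left.
  rewrite -comp_k KE mobius_circ_components // => -[->|->].
    by exists c => u /hc[].
  by exists (- c.1.1, - c.1.2, - c.2) => u /hc[].
by exists K, I, Ou, q; split => // k; case: (cK k).
Qed.

Lemma classical_pair (A : 'I_g -> S -> S) (a : 'I_g -> 'M[R]_2) G i j : (2 <= g)%N ->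
    (forall i, \det (a i) = 1) -> (forall i, A i = real_mobius (a i)) ->
    classical_schottky_on A G -> i != j ->
  4 < \tr (a i) ^+ 2 /\
  [\/ kappa (a i) (a j) < 0, \tr (a i) * \tr (a j) * \tr (a i * a j) < 0 |
      \tr (a i) * \tr (a j) * \tr (a i * adj2 (a j)) < 0].
Proof.
move=> g2 a1 Aa /classical_forms[K [I [Ou [q [jK sch Iq]]]]] ij.
have AE : A = fun i => real_mobius (a i) by apply: funext.
rewrite {}AE in sch.
have single := letter_attracting g2 a1 jK sch.
(* The attracting point p of [a i] lies inside C_i' and the repelling point p' inside C_i; similarly
   for r, r' and [a j]. *)
have [k [p [hp Ip]]] := single (i, false).
have [k' [p' [hp' Ip']]] := single (i, true).
have [l [r [hr Ir]]] := single (j, false).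
have [l' [r' [hr' Ir']]] := single (j, true).
rewrite /lmx /flip /= in hp hp' hr hr' Ip Ip' Ir Ir'.
have [kk' _] := attracting_unique (a1 i) hp hp'; have [ll' _] := attracting_unique (a1 j) hr hr'.
rewrite -{}kk' in hp'; rewrite -{}ll' in hr'.
have npos k0 k1 u := @quad_other_inside _ _ _ _ _ k0 k1 u sch Iq.
have u0 (b : 'M[R]_2) (k1 : R) u : attracting b k1 u -> u != 0 by case.
have ne (e e' : bool) : (i, e) <> (j, e') by move=> [ij' _]; move: ij; rewrite ij' eqxx.
have ne' (e e' : bool) : (j, e') <> (i, e) by move=> [ij' _]; move: ij; rewrite ij' eqxx.
have pn0 := u0 _ _ _ hp; have pn0' := u0 _ _ _ hp'.
have rn0 := u0 _ _ _ hr; have rn0' := u0 _ _ _ hr'.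
have gt k0 u : u != 0 -> I k0 (ptR u) -> 0 < quad (q k0) u by move=> un0 /(Iq _ _ un0).
have tf : (i, true) <> (i, false) by [].
have tf' : (j, true) <> (j, false) by [].
have pp : br p p' != 0.
  by apply: (quad_br_neq0 (gt _ _ pn0 Ip)) => //; apply: npos Ip'.
have rr : br r r' != 0.
  by apply: (quad_br_neq0 (gt _ _ rn0 Ir)) => //; apply: npos Ir'.
(* For e = true the second factor is the inverse of [a j], and r and r' exchange their roles. *)
have sign_word e v m v' : attracting (lmx a (j, e)) m v -> attracting (adj2 (lmx a (j, e))) m v' ->
    I (j, ~~ e) (ptR v) -> I (j, e) (ptR v') ->
    0 < \tr (a i) * \tr (lmx a (j, e)) * \tr (a i * lmx a (j, e)) *
        (br p p' * br p v' * (br v p' * br v v')).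
  move=> hv hv' Iv Iv'.
  have [| |n [f [hf If]]] := @word_attracting a K I Ou (i, false) [:: (j, e)] g2 a1 jK sch.
  - by rewrite /reduced /= andbT; apply/eqP => -[]; move/eqP: ij; auto.
  - exact: ne'.
  rewrite /= mulr1 in hf; have fn0 := u0 _ _ _ hf.
  have bf0 : app (lmx a (j, e)) f != 0.
    apply: contra_neq fn0 => h; have := congr1 (app (adj2 (lmx a (j, e)))) h.
    rewrite -appM mul_adj2mx ?det_lmx // app1 => ->.
    by rewrite /app /= !mulr0 !addr0.
  (* The point f is inside C_i', hence outside the curve of the letter (j, e), which takes it inside
     the flipped curve. *)
  have Ibf : I (j, ~~ e) (ptR (app (lmx a (j, e)) f)).
    have m0 h : \det (map_mx (real_complex R) (a h)) != 0 by exact: real_det_neq0.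
    rewrite -real_mobius_ptR ?det_lmx ?oner_neq0 //.
    have -> : real_mobius (lmx a (j, e)) =
        lact (fun h => map_mx (real_complex R) (a h)) (j, e) :> (S -> S).
      by rewrite /lact /lmx /=; case: (e); rewrite /real_mobius ?map_adj2.
    apply: (lact_outside m0 sch (l := (j, e))).
    by apply: (inside_closed_outside jK sch (nesym (@ne' true e))); left.
  have rv := u0 _ _ _ hv; have rv' := u0 _ _ _ hv'.
  have je : (j, e) <> (j, ~~ e) by case: (e).
  have fi : (i, true) <> (i, false) by [].
  apply: (@trace_product_sign _ (a i) (lmx a (j, e)) k m n p p' v v' f
            (q (i, true)) (q (j, ~~ e))) => //.
  - exact: det_lmx.
  - exact: gt.
  - exact: gt.
  - exact: npos Ip'.
  - exact: npos Iv'.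
  - exact: gt.
  - exact: gt.
  - exact: npos Ip'.
  - exact: npos Iv'.
split; first by have [] := attracting_trace (a1 i) hp.
have X := sign_word false _ _ _ hr hr' Ir Ir'.
have hr2 : attracting (adj2 (lmx a (j, true))) l r by rewrite /lmx /= adj2K.
have Y := sign_word true _ _ _ hr' hr2 Ir' Ir.
rewrite /lmx /= in X Y.
have trV : \tr (adj2 (a j)) = \tr (a j) by rewrite !tr2E !mxe2 addrC.
rewrite trV in Y.
have [nk|nk] := boolP (kappa (a i) (a j) < 0); first by constructor 1.
have kpos : 0 < br p r * br p r' * (br p' r * br p' r').
  rewrite (kappa_sign (a1 i) (a1 j) hp hp' hr hr' pp rr) -leNgt in nk.
  rewrite lt_neqAle nk andbT eq_sym !mulf_neq0 //.
  - by apply: (quad_br_neq0 (gt _ _ pn0 Ip)) => //; exact: npos Ir.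
  - by apply: (quad_br_neq0 (gt _ _ pn0 Ip)) => //; exact: npos Ir'.
  - by apply: (quad_br_neq0 (gt _ _ pn0' Ip')) => //; exact: npos Ir.
  - by apply: (quad_br_neq0 (gt _ _ pn0' Ip')) => //; exact: npos Ir'.
have [lX|lY] := linked_pairing kpos pp rr.
  by constructor 2; move: X; rewrite nmulr_lgt0.
by constructor 3; move: Y; rewrite nmulr_lgt0.
Qed.

End Classical.

(** * Groups that are classical on all generators *)

Section AllClassical.
Variables (R : realType) (g : nat) (G : set (sphere R -> sphere R)).
Hypothesis g2 : (2 <= g)%N.
Hypothesis gG : mobius_group G.
Hypothesis allG : forall A : 'I_g -> sphere R -> sphere R,
  G = generated (range A) -> classical_schottky_on A G.
Local Notation letter := ('I_g * bool)%type.
Local Notation gens a := (range (fun i => real_mobius (a i))).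
Implicit Types a b : 'I_g -> 'M[R]_2.

Definition swap_gen a (j : 'I_g) (c : 'M[R]_2) : 'I_g -> 'M[R]_2 :=
  fun h => if h == j then c else a h.

Lemma det_swap_gen a j c : (forall i, \det (a i) = 1) -> \det c = 1 ->
  forall i, \det (swap_gen a j c i) = 1.
Proof. by move=> a1 c1 i; rewrite /swap_gen; case: ifP. Qed.

(** The last hypothesis recovers [a j] from the new generators without naming a word: each group
    that contains them contains [a j]. *)
Lemma gens_swap a j c : (forall i, \det (a i) = 1) -> \det c = 1 ->
    G = generated (gens a) -> G (real_mobius c) ->
    (forall H, mobius_group H -> (forall i, i != j -> H (real_mobius (a i))) ->
       H (real_mobius c) -> H (real_mobius (a j))) ->
  G = generated (gens (swap_gen a j c)).
Proof.
move=> a1 c1 Ga Gc back.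
have gensG : gens (swap_gen a j c) `<=` G.
  move=> _ [i _ <-]; rewrite /swap_gen; case: ifP => // _.
  by rewrite Ga; apply: sub_generated; exists i.
apply: (generated_eq gG Ga gensG) => _ [i _ <-].
have gH := generated_group gG gensG.
have Hi h : h != j -> generated (gens (swap_gen a j c)) (real_mobius (a h)).
  by move=> hj; apply: sub_generated; exists h => //; rewrite /swap_gen (negPf hj).
have [->|] := eqVneq i j; last exact: Hi.
apply: (back _ gH Hi); apply: sub_generated; exists j => //.
by rewrite /swap_gen eqxx.
Qed.

Lemma gens_in a i : G = generated (gens a) -> G (real_mobius (a i)).
Proof. by move=> ->; apply: sub_generated; exists i. Qed.

Lemma kappa_neg a (i j : 'I_g) : (forall i, \det (a i) = 1) -> G = generated (gens a) ->
  i != j -> kappa (a i) (a j) < 0.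
Proof.
move=> a1 Ga ij; have ji : j != i by rewrite eq_sym.
have [ai4 []] := classical_pair g2 a1 (fun=> erefl) (allG Ga) ij => // neg; exfalso.
  pose c := a i * (a i * a j).
  have c1 : \det c = 1 by rewrite !det_mulmx !a1 !mulr1.
  have aij1 : \det (a i * a j) = 1 by rewrite det_mulmx !a1 mulr1.
  have Gc : G = generated (gens (swap_gen a j c)).
    apply: gens_swap => //; first by apply: group_mul => //;
      [exact: gens_in|apply: group_mul => //; exact: gens_in].
    move=> H gH Hi Hc.
    have -> : a j = adj2 (a i) * (adj2 (a i) * c).
      by rewrite /c [adj2 _ * (a i * _)]mulrA mul_adj2mx // mul1r mulrA mul_adj2mx // mul1r.
    have Hai : H (real_mobius (adj2 (a i))) by apply: group_adj2 => //; exact: Hi.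
    by apply: group_mul => //; rewrite ?det_mulmx ?det_adj2 ?a1 ?c1 ?mulr1 //;
      apply: group_mul => //; rewrite ?det_adj2.
  have [_] := classical_pair g2 (det_swap_gen j a1 c1) (fun=> erefl) (allG Gc) ij.
  rewrite /swap_gen eqxx (negPf ij); exact: trace_twist.
(* The third inequality is the second one for [a i] and the inverse of [a j]. *)
pose c := a i * (a i * adj2 (a j)).
have aj1 : \det (adj2 (a j)) = 1 by rewrite det_adj2.
have c1 : \det c = 1 by rewrite !det_mulmx det_adj2 !a1 !mulr1.
have aij1 : \det (a i * adj2 (a j)) = 1 by rewrite det_mulmx det_adj2 !a1 mulr1.
have Gc : G = generated (gens (swap_gen a j c)).
  apply: gens_swap => //.
    apply: group_mul => //; first exact: gens_in.
    by apply: group_mul => //; [exact: gens_in|apply: group_adj2 => //; exact: gens_in].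
  move=> H gH Hi Hc.
  have -> : a j = adj2 (adj2 (a i) * (adj2 (a i) * c)).
    rewrite /c [adj2 (a i) * (a i * _)]mulrA mul_adj2mx // mul1r mulrA mul_adj2mx // mul1r.
    by rewrite adj2K.
  have Hai : H (real_mobius (adj2 (a i))) by apply: group_adj2 => //; exact: Hi.
  apply: group_adj2 => //; first by rewrite !det_mulmx !det_adj2 !a1 !mulr1.
  by apply: group_mul => //; rewrite ?det_mulmx ?det_adj2 ?a1 ?c1 ?mulr1 //;
    apply: group_mul => //; rewrite ?det_adj2.
have [_] := classical_pair g2 (det_swap_gen j a1 c1) (fun=> erefl) (allG Gc) ij.
rewrite /swap_gen eqxx (negPf ij); apply: trace_twist => //.
by have -> : \tr (adj2 (a j)) = \tr (a j) by rewrite !tr2E !mxe2 addrC.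
Qed.

(* Write side(v) for the sign of br v r * br v r', which tells the two sides of the
   axis of a i3 apart. The fixed points of a i1 * (a i2)^{+-1} lie next to the
   attracting one of a i1 and to one of those of a i2, which a i3 separates. *)
Lemma genus_le2 a (i1 i2 i3 : 'I_g) : (forall i, \det (a i) = 1) -> G = generated (gens a) ->
  i1 != i2 -> i1 != i3 -> i2 != i3 -> False.
Proof.
move=> a1 Ga i12 i13 i23.
have [K [I [Ou [q [jK sch Iq]]]]] := classical_forms (allG Ga).
have single := letter_attracting g2 a1 jK sch.
have [k [p [hp Ip]]] := single (i1, false).
have [l [r [hr Ir]]] := single (i3, false).
have [l' [r' [hr' Ir']]] := single (i3, true).
rewrite /lmx /flip /= in hp hr hr' Ip Ir Ir'.
have [m [v [hv Iv]]] := single (i2, false).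
have [m' [v' [hv' Iv']]] := single (i2, true).
rewrite /lmx /flip /= in hv hv' Iv Iv'.
have [ll' _] := attracting_unique (a1 i3) hr hr'; rewrite -{}ll' in hr'.
have [mm' _] := attracting_unique (a1 i2) hv hv'; rewrite -{}mm' in hv'.
have npos k0 k1 u := @quad_other_inside _ _ _ _ _ _ _ k0 k1 u sch Iq.
have gt k0 u : u != 0 -> I k0 (ptR u) -> 0 < quad (q k0) u by move=> un0 /(Iq _ _ un0).
have u0 (b : 'M[R]_2) (k1 : R) u : attracting b k1 u -> u != 0 by case.
have pn0 := u0 _ _ _ hp; have rn0 := u0 _ _ _ hr; have rn0' := u0 _ _ _ hr'.
have vn0 := u0 _ _ _ hv; have vn0' := u0 _ _ _ hv'.
pose side u := br u r * br u r'.
have same k0 u w : k0.1 != i3 -> u != 0 -> w != 0 -> I k0 (ptR u) -> I k0 (ptR w) ->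
    0 < side u * side w.
  move=> k03 un0 wn0 Iu Iw.
  have ne e : (i3, e) <> k0 by move=> e'; move: k03; rewrite -e' eqxx.
  have := quad_unlinked (gt _ _ un0 Iu) (gt _ _ wn0 Iw)
    (npos _ _ _ rn0 (ne _) Ir) (npos _ _ _ rn0' (ne _) Ir') rn0 rn0'.
  by rewrite /side mulrACA.
have nbr k0 u w e : k0.1 != i3 -> u != 0 -> w != 0 -> I k0 (ptR u) -> I (i3, e) (ptR w) ->
    br u w != 0.
  move=> k03 un0 wn0 Iu Iw; apply: (quad_br_neq0 (gt _ _ un0 Iu)) => //.
  by apply: npos Iw => // e'; move: k03; rewrite -e' eqxx.
have rr : br r r' != 0.
  by apply: (quad_br_neq0 (gt _ _ rn0 Ir)) => //; apply: npos Ir'.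
(* The axes of [a i2] and [a i3] cross, so the fixed points of [a i2] are on different sides; w is
   the one on the side of p. *)
have side23 : side v * side v' < 0.
  have := kappa_neg a1 Ga i23; rewrite (kappa_sign (a1 i2) (a1 i3) hv hv' hr hr') //.
  apply: (quad_br_neq0 (gt _ _ vn0 Iv)) => //; exact: npos Iv'.
have [e [w [wn0 Iw pw]]] : exists e w, [/\ w != 0, I (i2, e) (ptR w) & 0 < side p * side w].
  have p2 : 0 < side p ^+ 2.
    rewrite lt_neqAle sqr_ge0 andbT eq_sym sqrf_eq0 mulf_neq0 //.
      exact: (nbr (i1, true) _ _ true).
    exact: (nbr (i1, true) _ _ false).
  have [pv|pv] := ltP 0 (side p * side v); first by exists true, v.
  exists false, v'; split => //.
  have : side p * side v * (side p * side v') < 0.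
    have -> : side p * side v * (side p * side v') = side p ^+ 2 * (side v * side v') by ring.
    by rewrite pmulr_rlt0.
  set x := side p * side v in pv *; set y := side p * side v'.
  by move=> xy; rewrite ltNge; apply: contraTN xy => y0; rewrite -leNgt mulr_le0.
(* With this e, the repelling point of F lies in [I (i2, e)] with w, and the attracting one in
   [I (i1, true)] with p: both are on the same side. But F can replace [a i1] as a generator, so its
   axis ought to cross that of [a i3]. *)
pose F := a i1 * lmx a (i2, e).
have i12e (e1 e2 : bool) : (i2, e1) != (i1, e2) by apply/eqP => -[ee _]; move: i12; rewrite ee eqxx.
have i21e (e1 e2 : bool) : (i1, e1) != (i2, e2) by rewrite eq_sym.
have red1 : reduced [:: (i1, false); (i2, e)] by rewrite /reduced /= andbT; exact: i12e.
have red2 : reduced [:: (i2, ~~ e); (i1, true)] by rewrite /reduced /= andbT; exact: i21e.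
have last1 : last (i1, false) [:: (i2, e)] <> flip (i1, false) by exact/eqP/i12e.
have last2 : last (i2, ~~ e) [:: (i1, true)] <> flip (i2, ~~ e) by exact/eqP/i21e.
have [n [f [hf If]]] := word_attracting g2 a1 jK sch red1 last1.
have [n' [f' [hf' If']]] := word_attracting g2 a1 jK sch red2 last2.
rewrite /= mulr1 /flip /= in hf If; rewrite /= mulr1 /flip /= negbK in hf' If'.
have FV : lmx a (i2, ~~ e) * lmx a (i1, true) = adj2 F.
  by rewrite /F adj2M /lmx /=; case: (e) => //=; rewrite adj2K.
rewrite FV in hf'.
have fn0 := u0 _ _ _ hf; have fn0' := u0 _ _ _ hf'.
have F1 : \det F = 1 by rewrite det_mulmx a1 det_lmx // mulr1.
have [nn' _] := attracting_unique F1 hf hf'; rewrite -{}nn' in hf'.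
have GF : G = generated (gens (swap_gen a i1 F)).
  have Gl H : mobius_group H -> (forall i, i != i1 -> H (real_mobius (a i))) ->
      H (real_mobius (lmx a (i2, e))).
    move=> gH Hi; have H2 : H (real_mobius (a i2)) by apply: Hi; rewrite eq_sym.
    by rewrite /lmx /=; case: (e) => //; exact: group_adj2.
  apply: gens_swap => //.
    apply: group_mul => //; [exact: det_lmx|exact: gens_in|].
    by apply: Gl => // i _; exact: gens_in.
  move=> H gH Hi HF; have -> : a i1 = F * adj2 (lmx a (i2, e)).
    by rewrite /F -mulrA mulmx_adj2 ?det_lmx // mulr1.
  apply: group_mul => //; first by rewrite det_adj2 det_lmx.
  by apply: group_adj2; [|exact: det_lmx|exact: Gl].
have := kappa_neg (det_swap_gen i1 a1 F1) GF i13.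
rewrite /swap_gen eqxx eq_sym (negPf i13).
have ff' : br f f' != 0.
  apply: (quad_br_neq0 (gt _ _ fn0 If)) => //; apply: npos If' => //.
rewrite (kappa_sign F1 (a1 i3) hf hf' hr hr' ff' rr) -/(side f) -/(side f').
have s1 := same (i1, true) _ _ i13 pn0 fn0 Ip If.
have s2 := same (i2, e) _ _ i23 wn0 fn0' Iw If'.
apply/negP; rewrite -leNgt ltW //.
have P : 0 < (side p * side f) * (side w * side f') * (side p * side w) by rewrite (mulr_gt0 (mulr_gt0 s1 s2) pw).
have D : 0 <= (side p * side w) ^+ 2 by exact: sqr_ge0.
have D0 : 0 < (side p * side w) ^+ 2.
  by rewrite lt_neqAle D andbT eq_sym sqrf_eq0 gt_eqF.
rewrite -(pmulr_rgt0 _ D0).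
have -> : (side p * side w) ^+ 2 * (side f * side f') =
  (side p * side f) * (side w * side f') * (side p * side w) by ring.
by [].
Qed.

End AllClassical.

(** * Intersecting axes *)

Section Axes.
Variable R : realType.
Implicit Types (M a b : 'M[R]_2) (z : R[i]).

(** The fixed point equation c x^2 + (d - a) x - b = 0 with |z|^2 for x^2 and Re z for x: the circle
    or line through the fixed points and orthogonal to the real line. *)
Definition axis_eq M z := M 1 0 * (complex.Re z ^+ 2 + complex.Im z ^+ 2) +
  (M 1 1 - M 0 0) * complex.Re z - M 0 1.

Lemma fixed_finite M (x : R) : \det M = 1 ->
  real_mobius M (boundary_point (Some x)) = boundary_point (Some x) <->
  M 1 0 * x ^+ 2 + (M 1 1 - M 0 0) * x - M 0 1 = 0.
Proof.
move=> M1; have x0 : (x, 1 : R) != 0 by rewrite -pair_eqE /= oner_eq0 andbF.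
have bE : boundary_point (Some x) = ptR (x, 1).
  by rewrite /ptR /pt /= oner_eq0 divr1.
have M0 : \det M != 0 by rewrite M1 oner_neq0.
have nzC2 (u : R * R) : u != 0 -> (u.1%:C != 0) || (u.2%:C != 0) by exact: nonzeroC.
have a0 : app M (x, 1) != 0.
  apply: contra_neq x0 => h; have := congr1 (app (adj2 M)) h.
  rewrite -appM mul_adj2mx // app1 => ->.
  by rewrite /app /= !mulr0 !addr0.
rewrite bE real_mobius_ptR // /ptR pt_eq ?nonzeroC // /app /= -!realCM; split=> [/complexI|h].
  by rewrite !mulr1 => h; apply/eqP; rewrite -subr_eq0 in h *; lra.
by congr (_%:C); lra.
Qed.

Lemma fixed_infty M : real_mobius M (boundary_point None) = boundary_point None <->
  M 1 0 = 0.
Proof.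
rewrite /real_mobius /= mxE.
have -> : ((M 1 0)%:C == 0) = (M 1 0 == 0) by rewrite -realC0 (inj_eq (@complexI _)).
by case: eqP.
Qed.

Lemma geodesicSS (x y : R) z : geodesic (Some x) (Some y) z <->
  0 < complex.Im z /\ complex.Re z ^+ 2 + complex.Im z ^+ 2 - (x + y) * complex.Re z + x * y = 0.
Proof.
rewrite /geodesic /upper_half_plane /=; split=> -[z0 h]; split => //.
  have := congr1 (fun w => w ^+ 2) h; rewrite -add_Re2_Im2 -realCX => /complexI.
  rewrite !raddfB /= subr0 expr_div_n real_normK ?num_real //.
  by move=> e; lra.
apply/eqP; rewrite -(eqrXn2 (n := 2)) ?normr_ge0 //; last by rewrite -realC0 lecR divr_ge0.
rewrite -add_Re2_Im2 -realCX (inj_eq (@complexI _)) !raddfB /= subr0.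
by rewrite expr_div_n real_normK ?num_real //; apply/eqP; lra.
Qed.

Lemma axisP M z : \det M = 1 -> 4 < \tr M ^+ 2 ->
  axis (real_mobius M) z <-> 0 < complex.Im z /\ axis_eq M z = 0.
Proof.
move=> M1 t4; have d1 := M1; rewrite det2E in d1; rewrite tr2E in t4.
split.
  have half (x : R) : M 1 0 * x ^+ 2 + (M 1 1 - M 0 0) * x - M 0 1 = 0 -> M 1 0 = 0 ->
      0 < complex.Im z -> complex.Re z = x -> 0 < complex.Im z /\ axis_eq M z = 0.
    by move=> + c0 z0 zx; rewrite /axis_eq c0 zx !mul0r.
  case=> -[x|] [[y|] [pq fp fq]].
  - move: fp fq => /(fixed_finite _ M1) fx /(fixed_finite _ M1) fy /geodesicSS[z0 h].
    split=> //; have xy : x - y != 0 by rewrite subr_eq0; apply/eqP => e; apply: pq; rewrite e.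
    have sxy : M 1 0 * (x + y) = M 0 0 - M 1 1.
      apply: (mulfI xy); apply/eqP; rewrite -subr_eq0; apply/eqP.
      by transitivity ((M 1 0 * x ^+ 2 + (M 1 1 - M 0 0) * x - M 0 1) -
        (M 1 0 * y ^+ 2 + (M 1 1 - M 0 0) * y - M 0 1)); [ring|rewrite fx fy subrr].
    have pxy : M 1 0 * (x * y) = - M 0 1.
      have h1 : M 0 1 = M 1 0 * x ^+ 2 + (M 1 1 - M 0 0) * x by lra.
      have -> : M 1 0 * (x * y) = M 1 0 * (x + y) * x - M 1 0 * x ^+ 2 by ring.
      by rewrite sxy h1; ring.
    rewrite /axis_eq; transitivity (M 1 0 * (complex.Re z ^+ 2 + complex.Im z ^+ 2
      - (x + y) * complex.Re z + x * y)); last by rewrite h mulr0.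
    transitivity (M 1 0 * (complex.Re z ^+ 2 + complex.Im z ^+ 2)
      - M 1 0 * (x + y) * complex.Re z + M 1 0 * (x * y)); last by ring.
    by rewrite sxy pxy; ring.
  - by move: fp fq => /(fixed_finite _ M1) fx /fixed_infty c0 [z0 zx]; exact: (half x).
  - by move: fp fq => /fixed_infty c0 /(fixed_finite _ M1) fy [z0 zx]; exact: (half y).
  - by case: pq.
move=> [z0 h]; have [c0|c0] := eqVneq (M 1 0) 0.
  have e0 : M 1 1 - M 0 0 != 0.
    apply/eqP => e; have : (M 0 0 + M 1 1) ^+ 2 = (M 1 1 - M 0 0) ^+ 2 + 4 by rewrite c0 in d1; lra.
    by rewrite e; lra.
  have hx : (M 1 1 - M 0 0) * complex.Re z = M 0 1 by move: h; rewrite /axis_eq c0; lra.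
  exists (Some (complex.Re z)), None; split => //.
  - by apply/(fixed_finite _ M1); rewrite c0 hx; ring.
  - exact/fixed_infty.
pose s := Num.sqrt ((M 0 0 + M 1 1) ^+ 2 - 4).
have s2 : s ^+ 2 = (M 0 0 + M 1 1) ^+ 2 - 4 by rewrite sqr_sqrtr //; lra.
have s0 : 0 < s by rewrite sqrtr_gt0; lra.
pose x := (M 0 0 - M 1 1 + s) / (2 * M 1 0); pose y := (M 0 0 - M 1 1 - s) / (2 * M 1 0).
have bE : M 0 1 = (s ^+ 2 - (M 0 0 - M 1 1) ^+ 2) / (4 * M 1 0).
  apply: (mulIf c0); rewrite s2; have -> : M 0 1 * M 1 0 = M 0 0 * M 1 1 - 1 by lra.
  by field.
have fx : M 1 0 * x ^+ 2 + (M 1 1 - M 0 0) * x - M 0 1 = 0 by rewrite bE /x; field.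
have fy : M 1 0 * y ^+ 2 + (M 1 1 - M 0 0) * y - M 0 1 = 0 by rewrite bE /y; field.
exists (Some x), (Some y); split.
- move=> [xy]; have : (x - y) * M 1 0 = s by rewrite /x /y; field.
  by rewrite xy subrr mul0r; lra.
- exact/fixed_finite.
- exact/fixed_finite.
apply/geodesicSS; split=> //; apply: (mulfI c0); rewrite mulr0 -[RHS]h /axis_eq.
by rewrite bE /x /y; field.
Qed.

Lemma kappa_axis a b : kappa a b = (a 0 1 * b 1 0 - b 0 1 * a 1 0) ^+ 2 -
  (a 0 1 * (b 1 1 - b 0 0) - b 0 1 * (a 1 1 - a 0 0)) *
  (a 1 0 * (b 1 1 - b 0 0) - b 1 0 * (a 1 1 - a 0 0)).
Proof. by rewrite /kappa det2E !mxe2; ring. Qed.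

(** The equations of the axes are linear in X1 = Re z and X2 = |z|^2. Their solution comes from a
    point of U exactly when X2 - X1^2 > 0, and this difference is - kappa / D^2. *)
Lemma intersecting_axes_kappa a b : \det a = 1 -> \det b = 1 ->
    4 < \tr a ^+ 2 -> 4 < \tr b ^+ 2 ->
  intersecting_axes (real_mobius a) (real_mobius b) <-> kappa a b < 0.
Proof.
move=> a1 b1 ta tb; rewrite /intersecting_axes.
set A := axis (real_mobius a); set B := axis (real_mobius b).
have hA z : A z <-> 0 < complex.Im z /\ axis_eq a z = 0 := @axisP a z a1 ta.
have hB z : B z <-> 0 < complex.Im z /\ axis_eq b z = 0 := @axisP b z b1 tb.
pose c := a 1 0; pose e := a 1 1 - a 0 0; pose f := a 0 1.
pose c' := b 1 0; pose e' := b 1 1 - b 0 0; pose f' := b 0 1.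
pose D := c * e' - c' * e.
have kE : kappa a b = (f * c' - f' * c) ^+ 2 - (f * e' - f' * e) * D by exact: kappa_axis.
have cramer z : axis_eq a z = 0 -> axis_eq b z = 0 ->
    D * complex.Re z = c * f' - c' * f /\
    D * (complex.Re z ^+ 2 + complex.Im z ^+ 2) = f * e' - f' * e.
  rewrite /axis_eq -/c -/e -/f -/c' -/e' -/f' => h1 h2.
  have {}h1 : f = c * (complex.Re z ^+ 2 + complex.Im z ^+ 2) + e * complex.Re z by lra.
  have {}h2 : f' = c' * (complex.Re z ^+ 2 + complex.Im z ^+ 2) + e' * complex.Re z by lra.
  by rewrite h1 h2 /D; split; ring.
split.
  move=> [AB [z [/hA[z0 Az] /hB[_ Bz]]]]; have [X1 X2] := cramer z Az Bz.
  (* If D = 0, the two equations, which share the solution z, are proportional and the axes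
     coincide. *)
  have [D0|D0] := eqVneq D 0; last first.
    have -> : kappa a b = - (D ^+ 2 * complex.Im z ^+ 2).
      by rewrite kE -X2 -[f * c' - _]opprK opprB [f' * c]mulrC [f * c']mulrC -X1; ring.
    rewrite oppr_lt0; apply: mulr_gt0; last by rewrite exprn_gt0.
    by rewrite lt_neqAle sqr_ge0 andbT eq_sym sqrf_eq0.
  exfalso; apply: AB.
  have nz (M : 'M[R]_2) : \det M = 1 -> 4 < \tr M ^+ 2 -> axis_eq M z = 0 ->
      0 < M 1 0 ^+ 2 + (M 1 1 - M 0 0) ^+ 2.
    rewrite det2E tr2E => M1 M4 Mz; rewrite lt_neqAle addr_ge0 ?sqr_ge0 // andbT eq_sym.
    rewrite paddr_eq0 ?sqr_ge0 // !sqrf_eq0; apply: contraTN M4 => /andP[/eqP m0 /eqP m1].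
    have m2 : M 0 1 = 0 by move: Mz; rewrite /axis_eq m0 m1; lra.
    have m3 : M 1 1 = M 0 0 by lra.
    by rewrite -leNgt; move: M1; rewrite m0 m2 m3; lra.
  have na := nz a a1 ta Az; have nb := nz b b1 tb Bz; rewrite -/c -/e in na; rewrite -/c' -/e' in nb.
  pose k := (c * c' + e * e') / (c ^+ 2 + e ^+ 2).
  have na0 : c ^+ 2 + e ^+ 2 != 0 by rewrite gt_eqF.
  have ce : c * e' = c' * e by apply/eqP; rewrite -subr_eq0 -/D D0.
  have kc : c' = k * c by apply: (mulIf na0); rewrite /k mulrAC divfK //; ring: ce.
  have ke : e' = k * e by apply: (mulIf na0); rewrite /k mulrAC divfK //; ring: ce.
  have k0 : k != 0.
    by apply: contraTneq nb => k0; rewrite kc ke k0 !mul0r expr0n addr0 ltxx.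
  have kf : f' = k * f.
    move: Az Bz; rewrite /axis_eq -/c -/e -/f -/c' -/e' -/f' kc ke => Az Bz.
    have -> : f = c * (complex.Re z ^+ 2 + complex.Im z ^+ 2) + e * complex.Re z by lra.
    rewrite mulrDr mulrA [k * (e * _)]mulrA; lra.
  have eqE w : axis_eq b w = k * axis_eq a w.
    by rewrite /axis_eq -/c -/e -/f -/c' -/e' -/f' kc ke kf; ring.
  rewrite eqEsubset; split=> w.
    by move=> /hA[w0 aw]; apply/hB; rewrite eqE aw mulr0.
  move=> /hB[w0]; rewrite eqE => /eqP; rewrite mulf_eq0 (negPf k0) => /eqP aw.
  exact/hA.
move=> k0; have D0 : D != 0.
  by apply: contraTneq k0 => d0; rewrite kE d0 mulr0 subr0 -leNgt sqr_ge0.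
split.
  move=> AB.
  have uniq z w : A z -> A w -> complex.Re z = complex.Re w /\
      complex.Re z ^+ 2 + complex.Im z ^+ 2 = complex.Re w ^+ 2 + complex.Im w ^+ 2.
    move=> Az Aw; have Bz : B z by rewrite -AB.
    have Bw : B w by rewrite -AB.
    have [e1 e2] := cramer z ((hA z).1 Az).2 ((hB z).1 Bz).2.
    have [e3 e4] := cramer w ((hA w).1 Aw).2 ((hB w).1 Bw).2.
    by split; apply: (mulfI D0); rewrite ?e1 ?e2 ?e3 ?e4.
  have d4 : e ^+ 2 + 4 * (f * c) > 0.
    by rewrite /e /f /c; move: ta a1; rewrite tr2E det2E; lra.
  have [c0|c0] := eqVneq c 0.
    have e0 : e != 0 by apply: contraTneq d4 => ->; rewrite c0; lra.
    have A1 : A ((f / e) +i* 1).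
      by apply/hA; rewrite /axis_eq -/c -/e -/f c0 /=; split; [lra|field].
    have A2 : A ((f / e) +i* 2).
      by apply/hA; rewrite /axis_eq -/c -/e -/f c0 /=; split; [lra|field].
    have /= [_ h] := uniq _ _ A1 A2; lra.
  pose s := Num.sqrt (e ^+ 2 + 4 * (f * c)).
  have s2 : s ^+ 2 = e ^+ 2 + 4 * (f * c) by rewrite sqr_sqrtr // ltW.
  have s0 : 0 < s by rewrite sqrtr_gt0.
  have fE : f = (s ^+ 2 - e ^+ 2) / (4 * c) by rewrite s2; field.
  have c2 : `|c| ^+ 2 = c ^+ 2 by rewrite real_normK ?num_real.
  have nc : 0 < `|c| by rewrite normr_gt0.
  (* The top of the semicircle, and another point of it found from 3^2 + 4^2 = 5^2. Coinciding axes
     would share both, against the uniqueness of the solution. *)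
  have A1 : A ((- e / (2 * c)) +i* (s / (2 * `|c|))).
    apply/hA; rewrite /axis_eq -/c -/e -/f /=; split; first by rewrite divr_gt0 // mulr_gt0.
    by rewrite [(s / _) ^+ 2]expr_div_n [(2 * `|c|) ^+ 2]exprMn c2 fE; field.
  have A2 : A (((- e + s * (3 / 5)) / (2 * c)) +i* (s * (4 / 5) / (2 * `|c|))).
    apply/hA; rewrite /axis_eq -/c -/e -/f /=; split; first by rewrite divr_gt0 // mulr_gt0 //; lra.
    by rewrite [(s * (4 / 5) / _) ^+ 2]expr_div_n [(2 * `|c|) ^+ 2]exprMn c2 fE; field.
  have /= [h _] := uniq _ _ A1 A2.
  have : (- e / (2 * c)) * (2 * c) = ((- e + s * (3 / 5)) / (2 * c)) * (2 * c) by rewrite h.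
  by rewrite !divfK ?mulf_neq0 //; lra.
pose X1 := (c * f' - c' * f) / D; pose X2 := (f * e' - f' * e) / D.
pose y := Num.sqrt (X2 - X1 ^+ 2).
have yE : X2 - X1 ^+ 2 = - kappa a b / D ^+ 2 by rewrite kE /X1 /X2; field.
have D2 : 0 < D ^+ 2 by rewrite lt_neqAle sqr_ge0 andbT eq_sym sqrf_eq0.
have y0 : 0 < X2 - X1 ^+ 2 by rewrite yE divr_gt0 // oppr_gt0.
have y2 : X1 ^+ 2 + y ^+ 2 = X2 by rewrite sqr_sqrtr ?ltW //; ring.
exists (X1 +i* y); split; [apply/hA|apply/hB]; rewrite /axis_eq /= y2 sqrtr_gt0; split => //.
  by rewrite -/c -/e -/f /X1 /X2 /D; field.
by rewrite -/c' -/e' -/f' /X1 /X2 /D; field.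
Qed.

End Axes.

(** * Explicit circles *)

Section CircleImages.
Variable R : realType.
Local Notation C := R[i].
Local Notation S := (sphere R).
Local Notation cj := conjc.

Lemma norm_eq_conj (z w : C) : `|z| = `|w| <-> z * (cj z) = w * (cj w).
Proof.
rewrite -!sqr_normc; split=> [->//|/eqP].
by rewrite eqrXn2 ?normr_ge0 // => /eqP.
Qed.

(** The image is given by a Hermitian equation A |z|^2 + 2 Re (B z) + D = 0 with |B|^2 - A D = |det
    P|^2 > 0. It is a line if A = 0 and otherwise a circle of radius |det P / A|. *)
Lemma mobius_circ_geometric (P : 'M[C]_2) : \det P != 0 ->
  geometric_circle (mobius P @` @circ R).
Proof.
move=> P0.
have [a [b [c [d [aE bE cE dE]]]]] : exists a b c d,
    [/\ P 1 1 = a, - P 0 1 = b, - P 1 0 = c & P 0 0 = d].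
  by exists (P 1 1), (- P 0 1), (- P 1 0), (P 0 0).
pose A := a * cj a - c * cj c; pose B := a * cj b - c * cj d.
pose D := b * cj b - d * cj d.
have conjJ (z w : C) : (cj (z * w)) = (cj z) * (cj w) by exact: rmorphM.
have conjB (z w : C) : (cj (z - w)) = (cj z) - (cj w) by exact: rmorphB.
have conjD (z w : C) : (cj (z + w)) = (cj z) + (cj w) by exact: rmorphD.
have AJ : (cj A) = A by rewrite ?/A ?/D conjB !conjJ !conjcK; ring.
have DJ : (cj D) = D by rewrite ?/A ?/D conjB !conjJ !conjcK; ring.
pose e := a * d - b * c.
have eE : e = \det P by rewrite det2E /e -aE -bE -cE -dE; ring.
have e0 : e != 0 by rewrite eE.
have BB : B * (cj B) = A * D + e * (cj e).
  by rewrite /B /A /D /e !conjB !conjJ !conjcK; ring.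
have mem (z : C) : (mobius P @` @circ R) (Some z) <->
    A * (z * (cj z)) + B * z + (cj (B * z)) + D = 0.
  have -> : (Some z : S) = pt z 1 by rewrite /pt oner_eq0 divr1.
  rewrite mobius_preimage //= mobius_pt ?det_adj2 ?oner_neq0 ?orbT // circP; last first.
    by apply: det_coord_neq0; rewrite ?det_adj2 ?oner_neq0 ?orbT.
  rewrite !mxe2 aE bE cE dE !mulr1 norm_eq_conj.
  have E : (a * z + b) * (cj (a * z + b)) - (c * z + d) * (cj (c * z + d)) =
    A * (z * (cj z)) + B * z + (cj (B * z)) + D.
    by rewrite /A /B /D !conjJ !conjB !conjD !conjJ !conjcK; ring.
  by split=> h; [rewrite -E h subrr|apply/eqP; rewrite -subr_eq0 E h].
have memN : (mobius P @` @circ R) None <-> A = 0.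
  have -> : (None : S) = pt 1 0 by rewrite /pt eqxx.
  rewrite mobius_preimage //= mobius_pt ?det_adj2 ?oner_neq0 // circP; last first.
    by apply: det_coord_neq0; rewrite ?det_adj2 ?oner_neq0.
  rewrite !mxe2 aE cE !mulr0 !addr0 !mulr1 norm_eq_conj /A.
  by split=> [->|/eqP]; [rewrite subrr|rewrite subr_eq0 => /eqP].
clearbody A B D e.
have [A0|A0] := eqVneq A 0.
  right; have B0 : B != 0.
    apply: contra_neq e0 => B0; move: BB; rewrite B0 A0 !mul0r add0r => /esym/eqP.
    by rewrite mulf_eq0 conjc_eq0 orbb => /eqP.
  have i0 : ('i : C) != 0 by rewrite eq_complex /= oner_eq0 andbF.
  exists (- D / (2 * B)), ('i / B); split; first by rewrite mulf_neq0 ?invr_eq0.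
  have two0 : (2 : C) != 0 by rewrite pnatr_eq0.
  have BzE (z : C) : B * (- D / (2 * B) + z * ('i / B)) = - D / 2 + z * 'i by field; rewrite B0.
  have DR : - D / 2 = (- complex.Re D / 2)%:C.
    rewrite realCM realCN realCV.
    have -> : (complex.Re D)%:C = D.
      by case: (D) DJ => s t [] ts; rewrite /=; have -> : t = 0 by lra.
    by congr (_ / _); rewrite -[2 in RHS]/(2%:R) realCn.
  rewrite eqEsubset; split=> -[z|].
  - move/mem; rewrite A0 mul0r add0r => h; left; exists z => //.
    exists (complex.Im (B * z)) => //; apply: (mulfI B0); rewrite BzE DR.
    have : complex.Re (B * z) = - complex.Re D / 2.
      have := congr1 (@complex.Re R) h; rewrite !raddfD /=.
      by case: (B * z) => s t /=; lra.
    by case: (B * z) => s t /= ->; apply/eqP; rewrite eq_complex /=; apply/andP; split; apply/eqP; ring.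
  - by move=> _; right.
  - case=> [[_ [t _ <-] [<-]]|//]; apply/mem; rewrite A0 mul0r add0r BzE DR.
    have -> : D = (complex.Re D)%:C.
      by case: (D) DJ => s t' [] ts; rewrite /=; have -> : t' = 0 by lra.
    by apply/eqP; rewrite eq_complex /=; apply/andP; split; apply/eqP; field.
  - by move=> _; exact/memN.
left; exists (- (cj B) / A), (nrm e / nrm A); split.
  by rewrite divr_gt0 // -ltcR nrmE normr_gt0.
have key (z : C) : A * (z * (cj z)) + B * z + (cj (B * z)) + D = 0 <->
    `|z - - (cj B) / A| = (nrm e / nrm A)%:C.
  have -> : (nrm e / nrm A)%:C = `|e / A| by rewrite realCM realCV !nrmE normf_div.
  rewrite norm_eq_conj conjB !conjJ !conjc_inv AJ.
  have -> : (cj (- (cj B))) = - B by rewrite rmorphN /= conjcK.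
  have E : (z - - (cj B) / A) * ((cj z) - - B / A) - e / A * ((cj e) / A) =
     (A * (z * (cj z)) + B * z + cj B * cj z + D) / A.
    have -> : e / A * ((cj e) / A) = (B * (cj B) - A * D) / (A * A).
      by rewrite BB; field.
    by field.
  split=> h; first by apply/eqP; rewrite -subr_eq0 E h mul0r.
  by apply: (mulIf (x := A^-1)); rewrite ?invr_eq0 // -E h subrr mul0r.
rewrite eqEsubset; split=> -[z|].
- by move/mem/key => h; exists z.
- by move/memN/eqP; rewrite (negPf A0).
- by case=> w h [<-]; exact/mem/key.
- by case.
Qed.

Definition closed_disc (P : 'M[C]_2) : set S := mobius P @` (@disc R `|` @circ R).

Lemma closed_disc_setC (P : 'M[C]_2) : \det P != 0 ->
  closed_disc P = ~` (mobius P @` @ext R).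
Proof.
move=> P0; rewrite -mobius_image_setC //; congr (_ @` _).
have -> : @ext R = ~` (@disc R `|` @circ R).
  rewrite setCU setC_circ eqEsubset; split=> [p Ep|p [nd []]//]; split; last by right.
  by move=> Dp; have : (@disc R `&` @ext R) p by []; rewrite disc_ext.
by rewrite setCK.
Qed.

Lemma swapK (p : S) : mobius (mx2 0 1 1 0) (mobius (mx2 0 1 1 0) p) = p.
Proof.
rewrite -mobiusM ?det_swap //; have -> : mx2 0 1 1 0 * mx2 0 1 1 0 = 1 :> 'M[C]_2.
  by apply: matrix2P; rewrite !mxe2; ring.
exact: mobius1.
Qed.

Lemma swap_image (A B : set S) : mobius (mx2 0 1 1 0) @` A = B ->
  mobius (mx2 0 1 1 0) @` B = A.
Proof.
move=> <-; rewrite eqEsubset; split=> [_ [_ [p Ap <-] <-]|p Ap]; first by rewrite swapK.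
by exists (mobius (mx2 0 1 1 0) p); rewrite ?swapK //; exists p.
Qed.

Lemma swap_ext : mobius (mx2 0 1 1 0) @` @ext R = @disc R.
Proof. exact: swap_image. Qed.

Lemma swap_circ : mobius (mx2 0 1 1 0) @` @circ R = @circ R.
Proof.
have h : ~` (mobius (mx2 0 1 1 0) @` @circ R) = ~` @circ R.
  by rewrite -mobius_image_setC ?det_swap // setC_circ image_setU swap_ext setUC.
by rewrite -[LHS]setCK h setCK.
Qed.

(** As the inversion exchanges the sides of the unit circle, the third hypothesis makes [m i] carry
    the outside of C_i onto the inside of C_i'. *)
Lemma schottky_of_discs (g : nat) (m : 'I_g -> 'M[C]_2) (P : 'I_g * bool -> 'M[C]_2) :
    (forall i, \det (m i) != 0) -> (forall k, \det (P k) != 0) ->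
    (forall i p, mobius (P (i, true)) p =
       mobius (m i) (mobius (P (i, false)) (mobius (mx2 0 1 1 0) p))) ->
    (forall k l, k != l -> closed_disc (P k) `&` closed_disc (P l) = set0) ->
  exists K I O, (forall k, jordan_curve (K k) /\ geometric_circle (K k)) /\
    schottky_curves (fun i => mobius (m i)) K I O.
Proof.
move=> m0 P0 Pm disj.
exists (fun k => mobius (P k) @` @circ R), (fun k => mobius (P k) @` @disc R),
  (fun k => mobius (P k) @` @ext R); split.
  by move=> k; split; [exact: mobius_circ_jordan|exact: mobius_circ_geometric].
have triv (F : 'I_g * bool -> set S) : (forall k, F k `<=` closed_disc (P k)) ->
    trivIset setT F.
  move=> FP k l _ _ [p [Fk Fl]]; apply/eqP; apply: contraT => kl.
  have : (closed_disc (P k) `&` closed_disc (P l)) p by split; exact: FP.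
  by rewrite disj.
split.
- by apply: triv => k; apply: image_subset => p; right.
- move=> k; split; last exact: mobius_circ_components.
  move=> IO; have : (mobius (P k) @` @disc R) (mobius (P k) (Some 0)).
    by exists (Some 0) => //; exists 0 => //=; rewrite normr0 ltr01.
  rewrite IO => -[q Eq /(mobius_inj (P0 k)) q0]; rewrite {}q0 in Eq.
  have : (@disc R `&` @ext R) (Some 0).
    by split => //; exists 0 => //=; rewrite normr0 ltr01.
  by rewrite disc_ext.
- apply: triv => k.
  have cl : closed (closed_disc (P k)).
    by rewrite closed_disc_setC //; apply: open_closedC; apply: mobius_open => //; exact: open_ext.
  rewrite [closed_disc (P k)](closure_id _).1 //; apply: closure_subset; apply: image_subset => p; by left.
- move=> i; have img (A B : set S) : mobius (mx2 0 1 1 0) @` A = B ->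
      mobius (m i) @` (mobius (P (i, false)) @` B) = mobius (P (i, true)) @` A.
    move=> <-; rewrite eqEsubset; split.
      by move=> _ [_ [_ [p Ap <-] <-] <-]; exists p => //; rewrite Pm.
    move=> _ [p Ap <-]; rewrite Pm; do 2 (eexists; last reflexivity).
    by exists p.
  by split; [exact/img/swap_circ|exact: img].
Qed.

End CircleImages.

(** * Discs with real diameters *)

Section TorusDiscs.
Variable R : realType.
Local Notation C := R[i].
Local Notation S := (sphere R).

Definition sqn (x : C) : R := complex.Re x ^+ 2 + complex.Im x ^+ 2.
Definition dot (x y : C) : R := complex.Re x * complex.Re y + complex.Im x * complex.Im y.

(* In the coordinate z = x / y, this is |y|^2 times (Re z - s)(Re z - t) + (Im z)^2,
   which is negative in the disc with diameter [s, t]. *)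
Definition diam (s t : R) (x y : C) : R := sqn x - (s + t) * dot x y + s * t * sqn y.

Lemma sqn_ge0 x : 0 <= sqn x. Proof. by rewrite addr_ge0 ?sqr_ge0. Qed.

Lemma sqn_eq0 x : sqn x = 0 -> x = 0.
Proof.
case: x => u v /eqP; rewrite /sqn /= paddr_eq0 ?sqr_ge0 // !sqrf_eq0.
by move=> /andP[/eqP -> /eqP ->].
Qed.

Lemma ler_normC (z w : C) : `|z| <= `|w| <-> sqn z <= sqn w.
Proof. by rewrite -[sqn _ <= _]lecR !add_Re2_Im2 ler_pXn2r ?nnegrE. Qed.

(** Cauchy-Schwarz is (Re z)^2 <= |z|^2 here, whence (Re z - s) (Re z - t) <= 0. At infinity, where
    y = 0, the form is |x|^2 > 0. *)
Lemma diam_bounds s t x y : (x != 0) || (y != 0) -> s < t -> diam s t x y <= 0 ->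
  0 < sqn y /\ s * sqn y <= dot x y <= t * sqn y.
Proof.
move=> xy0 st; rewrite /diam => h.
have CS : dot x y ^+ 2 <= sqn x * sqn y.
  rewrite -subr_ge0; have -> : sqn x * sqn y - dot x y ^+ 2 =
    (complex.Re x * complex.Im y - complex.Im x * complex.Re y) ^+ 2.
    by rewrite /sqn /dot; ring.
  exact: sqr_ge0.
have y0 : 0 < sqn y.
  rewrite lt_neqAle sqn_ge0 andbT eq_sym; apply/eqP => y0.
  have d0 : dot x y = 0 by rewrite (sqn_eq0 y0) /dot /= !mulr0 addr0.
  move: h; rewrite y0 d0 !mulr0 subr0 addr0 => x0.
  have /sqn_eq0 x0' : sqn x = 0 by apply/eqP; rewrite eq_le x0 sqn_ge0.
  by move: xy0; rewrite x0' (sqn_eq0 y0) eqxx.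
split=> //; set u := dot x y in CS h *; set n := sqn y in y0 CS h *.
have prod : (u - s * n) * (u - t * n) <= 0.
  have -> : (u - s * n) * (u - t * n) =
     n * (sqn x - (s + t) * u + s * t * n) + (u ^+ 2 - sqn x * n) by ring.
  have : n * (sqn x - (s + t) * u + s * t * n) <= 0 by rewrite mulr_ge0_le0 // ltW.
  by lra.
have stn : s * n < t * n by rewrite ltr_pM2r.
by apply/andP; split; rewrite leNgt; apply/negP => hu; have : 0 < (u - s * n) * (u - t * n);
  [rewrite nmulr_rgt0; lra|lra|rewrite pmulr_rgt0; lra|lra].
Qed.

Lemma discs_disjoint s t s' t' x y : (x != 0) || (y != 0) -> s < t -> s' < t' -> t < s' ->
  diam s t x y <= 0 -> diam s' t' x y <= 0 -> False.
Proof.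
move=> xy0 st st' ts h h'.
have [y0 /andP[_ b]] := diam_bounds xy0 st h.
have [_ /andP[b' _]] := diam_bounds xy0 st' h'.
have : t * sqn y < s' * sqn y by rewrite ltr_pM2r.
by lra.
Qed.

(** The difference of the two forms is affine in Re z and negative at both ends s and t. *)
Lemma discs_nested l r s t x y : (x != 0) || (y != 0) -> l < s -> s < t -> t < r ->
  0 <= diam l r x y -> diam s t x y <= 0 -> False.
Proof.
move=> xy0 ls st tr h h'; have [y0 /andP[b b']] := diam_bounds xy0 st h'.
move: h h'; rewrite /diam; set u := dot x y in b b' *; set n := sqn y in y0 b b' *.
move=> h h'.
have lin : 0 <= (s + t - l - r) * u + (l * r - s * t) * n by lra.
have es : (s + t - l - r) * (s * n) + (l * r - s * t) * n < 0.
  have -> : (s + t - l - r) * (s * n) + (l * r - s * t) * n = n * ((s - l) * (s - r)) by ring.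
  by rewrite pmulr_rlt0 // pmulr_rlt0; lra.
have et : (s + t - l - r) * (t * n) + (l * r - s * t) * n < 0.
  have -> : (s + t - l - r) * (t * n) + (l * r - s * t) * n = n * ((t - l) * (t - r)) by ring.
  by rewrite pmulr_rlt0 // pmulr_rlt0; lra.
have [c0|c0] := leP 0 (s + t - l - r).
  have : (s + t - l - r) * u <= (s + t - l - r) * (t * n) by rewrite ler_wpM2l.
  by lra.
have : (s + t - l - r) * u <= (s + t - l - r) * (s * n) by rewrite ler_wnM2l // ltW.
by lra.
Qed.

Definition diam_mx (s t : R) : 'M[C]_2 := mx2 ((t - s) / 2)%:C ((s + t) / 2)%:C 0 1.

Lemma det_diam_mx s t : s < t -> \det (diam_mx s t) != 0.
Proof.
move=> st; rewrite det2E !mxe2 mulr1 mulr0 subr0 -realC0 (inj_eq (@complexI _)).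
by rewrite gt_eqF // divr_gt0 // subr_gt0.
Qed.

Lemma closed_discP (P : 'M[C]_2) x y : \det P != 0 -> (x != 0) || (y != 0) ->
  closed_disc P (pt x y) <-> `|adj2 P 0 0 * x + adj2 P 0 1 * y| <= `|adj2 P 1 0 * x + adj2 P 1 1 * y|.
Proof.
move=> P0 xy0; rewrite /closed_disc mobius_preimage //= mobius_pt ?det_adj2 //.
have nz := det_coord_neq0 (det_adj2_neq0 P0) xy0.
rewrite le_eqVlt; split=> [[/(discP nz) ->|/(circP nz) ->]|/orP[/eqP h|h]].
- by rewrite orbT.
- by rewrite eqxx.
- by right; exact/(circP nz).
- by left; exact/(discP nz).
Qed.

Lemma diam_mxE s t x y : sqn (x - ((s + t) / 2)%:C * y) - sqn (((t - s) / 2)%:C * y) =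
  diam s t x y.
Proof. by case: x y => x1 x2 [y1 y2]; rewrite /diam /sqn /dot /=; field. Qed.

Lemma closed_disc_diam s t x y : s < t -> (x != 0) || (y != 0) ->
  closed_disc (diam_mx s t) (pt x y) <-> diam s t x y <= 0.
Proof.
move=> st xy0; rewrite closed_discP ?det_diam_mx // !mxe2 mul1r oppr0 mul0r add0r mulNr.
by rewrite ler_normC -diam_mxE subr_le0.
Qed.

(** The inversion comes first, so that the unit disc goes to the image under n of the exterior of
    the disc on [s, t]. *)
Definition co_diam_mx (n : 'M[R]_2) (s t : R) : 'M[C]_2 :=
  map_mx (real_complex R) n * diam_mx s t * mx2 0 1 1 0.

Lemma closed_disc_co_diam (n : 'M[R]_2) s t x y : \det n = 1 -> s < t ->
    (x != 0) || (y != 0) ->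
  closed_disc (co_diam_mx n s t) (pt x y) <->
    0 <= diam s t ((n 1 1)%:C * x - (n 0 1)%:C * y) ((n 0 0)%:C * y - (n 1 0)%:C * x).
Proof.
move=> n1 st xy0; rewrite closed_discP //; last first.
  by rewrite !det_mulmx !mulf_neq0 ?det_diam_mx ?det_swap ?real_det_neq0.
rewrite ler_normC -diam_mxE subr_ge0 /co_diam_mx !adj2M !mxe2.
set X := (n 1 1)%:C * x - _; set Y := (n 0 0)%:C * y - _.
have sqnN (z : C) : sqn (- z) = sqn z by rewrite /sqn !raddfN /= !sqrrN.
rewrite -[X in X <= _]sqnN -[X in _ <= X]sqnN !mxE.
set U := (Z in sqn Z <= _ <-> _); set V := (Z in _ <= sqn Z <-> _).
have -> : U = ((t - s) / 2)%:C * Y by rewrite /U /Y; ring.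
by have -> : V = X - ((s + t) / 2)%:C * Y by rewrite /V /X /Y; ring.
Qed.

(** For these matrices kappa = - ((l - 1 / l) q)^2, and the last hypothesis says that it is less
    than -4. *)
Lemma torus_model (l q m : R) : 1 < l -> 0 < q -> 0 < m -> 2 * l < (l ^+ 2 - 1) * q ->
  let n (i : 'I_2) := if i == 0 then mx2 l 0 0 l^-1 else mx2 ((1 + q ^+ 2) / m) q q m in
  exists P : 'I_2 * bool -> 'M[C]_2, [/\ forall k, \det (P k) != 0,
    forall i p, mobius (P (i, true)) p =
       real_mobius (n i) (mobius (P (i, false)) (mobius (mx2 0 1 1 0) p)) &
    forall k j, k != j -> closed_disc (P k) `&` closed_disc (P j) = set0].
Proof.
move=> l1 q0 m0 lq n.
have l0 : l != 0 by rewrite gt_eqF; lra.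
have m0' : m != 0 by rewrite gt_eqF.
have n1 i : \det (n i) = 1.
  by rewrite /n; case: ifP => _; rewrite det2E !mxe2; field; rewrite ?l0 ?m0'.
(* b(-1/s) = t holds for m s = q - eps and m t = q + 1 / eps; then t < l ^ 2 s reads
   l ^ 2 eps + 1 / eps < (l ^ 2 - 1) q, which is weakest for eps = 1 / l. *)
pose s := (q - l^-1) / m; pose t := (q + l) / m; pose r := q * (1 + l ^+ 2) / 2 / m.
have lq1 : 1 < q * l.
  have : l * (l ^+ 2 - 1) * (q * l - 1) > 0.
    by nra.
  by rewrite pmulr_rgt0; [lra|rewrite mulr_gt0; nra].
have lv : l^-1 < q by rewrite -(ltr_pM2r (_ : 0 < l)) ?mulVf //; lra.
have s0 : 0 < s by rewrite divr_gt0 // subr_gt0.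
have lv0 : 0 < l^-1 by rewrite invr_gt0; lra.
have st : s < t by rewrite ltr_pM2r ?invr_gt0 //; lra.
have tr : t < r by rewrite ltr_pM2r ?invr_gt0 //; nra.
have t0 : 0 < t by apply: lt_trans st.
have r0 : 0 < r by apply: lt_trans tr.
have l2 : 0 < l ^+ 2 by rewrite exprn_gt0 //; lra.
have rs' : r < s * l ^+ 2.
  have -> : s * l ^+ 2 = (q * l ^+ 2 - l) / m by rewrite /s; field; rewrite l0 m0'.
  by rewrite /r ltr_pM2r ?invr_gt0 //; lra.
have rs : r / l ^+ 2 < s by rewrite ltr_pdivrMr.
(* The endpoints of the diameters lie in the order - l^2 / r < - 1 / s < - 1 / t < - 1 / r < r / l^2
   < s < t < r. *)
have neg (x y : R) : 0 < x -> x < y -> - x^-1 < - y^-1.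
  by move=> x0 xy; rewrite ltrN2 ltf_pV2 ?posrE // (lt_trans x0).
have ts := neg _ _ s0 st; have rt := neg _ _ t0 tr.
have rr : r / l ^+ 2 < r by rewrite ltr_pdivrMr // ltr_pMr // expr_gt1 //; lra.
have rpos : 0 < r / l ^+ 2 by rewrite divr_gt0.
have r1 : - r^-1 < 0 by rewrite oppr_lt0 invr_gt0.
have ar : - r^-1 < r / l ^+ 2 by lra.
have lr : - (l ^+ 2 / r) < - s^-1.
  by rewrite ltrN2 ltr_pdivlMr // mulrC ltr_pdivrMr // mulrC.
have lr' : - (l ^+ 2 / r) < - r^-1.
  apply: lt_trans lr _; rewrite ltrN2 ltf_pV2 ?posrE //; exact: lt_trans tr.
have r00 : r != 0 by rewrite gt_eqF.
(* Multiplication by l^2 takes the exterior of the disc on [- 1 / r, r / l^2] to that of the disc on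
   [- l^2 / r, r]. The symmetric matrix takes the exterior of the disc on [- 1 / s, - 1 / t] to the
   disc on [s, t]. *)
pose P (k : 'I_2 * bool) := let i := k.1 in
  let d := if i == 0 then (- r^-1, r / l ^+ 2) else (- s^-1, - t^-1) in
  if k.2 then co_diam_mx (n i) d.1 d.2 else diam_mx d.1 d.2.
have dlt (i : 'I_2) : let d := if i == 0 then (- r^-1, r / l ^+ 2) else (- s^-1, - t^-1) in
    d.1 < d.2 by case: ifP.
have P0 k : \det (P k) != 0.
  rewrite /P; case: k.2; last exact: det_diam_mx.
  by rewrite !det_mulmx !mulf_neq0 ?det_diam_mx ?det_swap ?real_det_neq0.
pose region (k : 'I_2 * bool) x y := match k with
  | (i, e) => if i == 0 then (if e then 0 <= diam (- (l ^+ 2 / r)) r x y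
                              else diam (- r^-1) (r / l ^+ 2) x y <= 0)
              else (if e then diam s t x y <= 0 else diam (- s^-1) (- t^-1) x y <= 0) end.
have scaled (a k1 k2 : R) : 0 < a -> k1 = a * k2 -> (0 <= k1) = (0 <= k2).
  by move=> a0 ->; rewrite pmulr_rge0.
have regionP k x y : (x != 0) || (y != 0) -> closed_disc (P k) (pt x y) -> region k x y.
  move=> xy0; case: k => i [] /=; rewrite /P /=.
    move/(closed_disc_co_diam (n1 i) (dlt i) xy0).
    case: (ord2P i) => -> /=; rewrite /n /= !mxe2.
      rewrite (scaled (l ^- 2) _ (diam (- (l ^+ 2 / r)) r x y)) ?invr_gt0 //.
      by case: x y {xy0} => x1 x2 [y1 y2]; rewrite /diam /sqn /dot /=; field; rewrite l0 r00.
    have st0 : 0 < (s * t)^-1 by rewrite invr_gt0 (mulr_gt0 s0 t0).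
    rewrite (scaled _ _ (- diam s t x y) st0).
      by rewrite oppr_ge0.
    have ql0 : q * l - 1 != 0 by rewrite gt_eqF // subr_gt0.
    have qpl : q + l != 0 by rewrite gt_eqF // addr_gt0 //; lra.
    case: x y {xy0} => x1 x2 [y1 y2]; rewrite /diam /sqn /dot /s /t /=; field.
    by rewrite qpl l0 m0' ql0.
  move/(closed_disc_diam (dlt i) xy0).
  by case: (ord2P i) => -> /=.
exists P; split => //.
  move=> i p; rewrite /P /= /co_diam_mx !mobiusM // ?det_mulmx ?mulf_neq0 //
    ?det_diam_mx ?det_swap ?real_det_neq0 //; exact: dlt.
move=> k j kj; rewrite -subset0 => p [].
have [x [y [xy0 ->]]] := ptP p => /(regionP _ _ _ xy0) + /(regionP _ _ _ xy0).
have inner := discs_nested xy0; have outer := discs_disjoint xy0.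
case: k j kj => [i e] [i' e'] kj.
have t1s : - t^-1 < s by apply: lt_trans s0; rewrite oppr_lt0 invr_gt0.
have t1r : - t^-1 < r by apply: lt_trans r0; rewrite oppr_lt0 invr_gt0.
have lrs : - (l ^+ 2 / r) < s by apply: lt_trans s0; rewrite oppr_lt0 divr_gt0.
have aa := inner _ _ _ _ lr' ar rr; have ab' := inner _ _ _ _ lrs st tr.
have ab := inner _ _ _ _ lr ts t1r; have cb' := outer _ _ _ _ ar st rs.
have cb := outer _ _ _ _ ts ar rt; have bb := outer _ _ _ _ ts st t1s.
case: (ord2P i) kj => ->; case: (ord2P i') => ->; case: e; case: e' => //= _ h1 h2.
all: first [exact: aa h1 h2|exact: aa h2 h1|exact: ab' h1 h2|exact: ab' h2 h1|
  exact: ab h1 h2|exact: ab h2 h1|exact: cb' h1 h2|exact: cb' h2 h1|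
  exact: cb h1 h2|exact: cb h2 h1|exact: bb h1 h2|exact: bb h2 h1].
Qed.

End TorusDiscs.

(** * Reduction to a diagonal and a symmetric matrix *)

Section NormalForm.
Variable R : realType.
Local Notation C := R[i].
Local Notation S := (sphere R).
Implicit Types (a b P : 'M[R]_2).

Lemma real_mobiusN a : \det a = 1 -> real_mobius (- a) = real_mobius a.
Proof.
move=> a1; apply: funext => p; rewrite /real_mobius.
have -> : map_mx (real_complex R) (- a) = (-1) *: map_mx (real_complex R) a.
  by apply/matrixP => i j; rewrite !mxE realCN mulN1r.
by rewrite mobiusZ ?real_det_neq0 // oppr_eq0 oner_eq0.
Qed.

Lemma kappa_conj P a b :
  kappa (adj2 P * a * P) (adj2 P * b * P) = \det P ^+ 4 * kappa a b.
Proof.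
have M2 x y : adj2 P * x * P * (adj2 P * y * P) = \det P *: (adj2 P * (x * y) * P).
  rewrite -!mulrA [P * (adj2 P * _)]mulrA mul_adj2_scal -scalerAl mul1r.
  by rewrite -!scalerAr !mulrA.
rewrite /kappa !M2 -scalerBr -mulrBl -mulrBr.
have -> x : \det (\det P *: (adj2 P * x * P)) = \det P ^+ 4 * \det x.
  rewrite -[X in _ = _ ^+ 4 * X]mul1r.
  have -> (k : R) (y : 'M[R]_2) : \det (k *: y) = k ^+ 2 * \det y.
    by rewrite !det2E !mxE; ring.
  by rewrite !det_mulmx det_adj2; ring.
by rewrite mulrN.
Qed.

Lemma kappaZ (k l : R) a b : kappa (k *: a) (l *: b) = (k * l) ^+ 2 * kappa a b.
Proof. by rewrite /kappa !det2E !mxe2; ring. Qed.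

(** If x = tr a has x^2 <= 4, completing the square shows y^2 + z^2 - x y z >= 0, and then kappa >=
    x^2 - 4 >= -4. *)
Lemma kappa_lt_trace a b : \det a = 1 -> \det b = 1 -> kappa a b < -4 -> 4 < \tr a ^+ 2.
Proof.
move=> a1 b1; rewrite kappaE //; set x := \tr a; set y := \tr b; set z := \tr _ => h.
rewrite ltNge; apply/negP => x4.
have : 0 <= (z - x * y / 2) ^+ 2 + y ^+ 2 * (1 - x ^+ 2 / 4).
  by rewrite addr_ge0 ?sqr_ge0 // mulr_ge0 ?sqr_ge0 //; lra.
have -> : (z - x * y / 2) ^+ 2 + y ^+ 2 * (1 - x ^+ 2 / 4) =
  y ^+ 2 + z ^+ 2 - x * y * z by field.
by have := sqr_ge0 x; lra.
Qed.

(** Once a is diagonal, kappa is a negative multiple of the product of the off-diagonal entries of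
    b. These thus have the same sign, and a diagonal conjugation makes them equal. *)
Lemma normal_form a b : \det a = 1 -> \det b = 1 -> kappa a b < -4 ->
  exists T : 'M[R]_2, exists l q m : R, [/\ \det T != 0, 1 < l, 0 < q, 0 < m &
    [/\ 2 * l < (l ^+ 2 - 1) * q,
     (a * T = T * mx2 l 0 0 l^-1) \/ (- a * T = T * mx2 l 0 0 l^-1) &
     (b * T = T * mx2 ((1 + q ^+ 2) / m) q q m) \/
     (- b * T = T * mx2 ((1 + q ^+ 2) / m) q q m)]].
Proof.
move=> a1 b1 kab; have a4 := kappa_lt_trace a1 b1 kab.
have detN (x : 'M[R]_2) : \det (- x) = \det x by rewrite !det2E !mxe2; ring.
have [a' [aa' t2 a1' kab']] : exists a', [/\ a' = a \/ a' = - a, 2 < \tr a', \det a' = 1 &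
    kappa a' b < -4].
  have [t0|t0] := leP 0 (\tr a).
    by exists a; split => //; [left|nra].
  exists (- a); split; [by right| |by rewrite detN|by rewrite kappaNl].
  by have -> : \tr (- a) = - \tr a; [rewrite !tr2E !mxe2; ring|nra].
pose t := \tr a'; rewrite -/t in t2.
pose s := Num.sqrt (t ^+ 2 - 4).
have s2 : s ^+ 2 = t ^+ 2 - 4 by rewrite sqr_sqrtr //; nra.
have s0 : 0 < s by rewrite sqrtr_gt0; nra.
pose l := (t + s) / 2.
have l1 : 1 < l by rewrite /l; lra.
have l0 : l != 0 by rewrite gt_eqF; lra.
have lV : l^-1 = (t - s) / 2.
  apply: (mulfI l0); rewrite divff //.
  by transitivity ((t ^+ 2 - s ^+ 2) / 4); [rewrite s2; field|rewrite /l; field].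
have chl : l ^+ 2 - \tr a' * l + \det a' = 0.
  rewrite a1' -/t; transitivity ((s ^+ 2 - (t ^+ 2 - 4)) / 4); first by rewrite /l; field.
  by rewrite s2 subrr mul0r.
have chV : l^-1 ^+ 2 - \tr a' * l^-1 + \det a' = 0.
  rewrite a1' -/t lV; transitivity ((s ^+ 2 - (t ^+ 2 - 4)) / 4); first by field.
  by rewrite s2 subrr mul0r.
have llV : l != l^-1 by rewrite lV /l; apply/eqP; lra.
have [x [y [xy0 e1 e2]]] := eigenvector2 chl.
have [z [w [zw0 e3 e4]]] := eigenvector2 chV.
have D0 := eigenvector2_det llV xy0 zw0 e1 e2 e3 e4.
pose P : 'M[R]_2 := mx2 x z y w.
have dP : \det P = x * w - z * y by rewrite det2E !mxe2.
have dP0 : \det P != 0 by rewrite dP.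
have aP := adj2_mul_eigen e1 e2 e3 e4; rewrite -/P -dP in aP.
pose b' := (\det P)^-1 *: (adj2 P * b * P).
have bP : adj2 P * b * P = \det P *: b' by rewrite scalerA divff // scale1r.
have conj (u v : 'M[R]_2) : adj2 P * u * P = \det P *: v -> u * P = P * v.
  move=> e; have := congr1 (fun m => P * m) e.
  rewrite !mulrA mul_adj2_scal -!scalerAl mul1r -scalerAr => /(scalerI dP0).
  by [].
have detZ (k : R) (u : 'M[R]_2) : \det (k *: u) = k ^+ 2 * \det u.
  by rewrite !det2E !mxE; ring.
have b1' : \det b' = 1 by rewrite detZ !det_mulmx det_adj2 b1; field.
clearbody b'.
have kb : kappa (mx2 l 0 0 l^-1) b' = kappa a' b.
  have := kappa_conj P a' b; rewrite aP bP kappaZ => e.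
  apply: (mulfI (expf_neq0 4 dP0)); rewrite -e; ring.
have kE : kappa (mx2 l 0 0 l^-1) b' = - ((l - l^-1) ^+ 2 * (b' 0 1 * b' 1 0)).
  by rewrite /kappa det2E !mxe2; ring.
rewrite {}kE in kb.
have lV1 : 0 < l - l^-1 by rewrite lV /l; lra.
have lV2 : 0 < (l - l^-1) ^+ 2 by rewrite exprn_gt0.
have qq0 : 0 < b' 0 1 * b' 1 0.
  by rewrite -(pmulr_rgt0 _ lV2); lra.
(* The diagonal entries have product 1 + [b' 0 1 * b' 1 0], so up to the sign of the matrix both are
   positive. *)
have pm : 0 < b' 0 0 * b' 1 1 by move: b1'; rewrite det2E; lra.
have [b2 [bb b21 m0 bq]] : exists b2, [/\ b2 = b' \/ b2 = - b', \det b2 = 1, 0 < b2 1 1 &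
    b2 0 1 * b2 1 0 = b' 0 1 * b' 1 0].
  have m00 : b' 1 1 != 0 by apply: contraTneq pm => ->; rewrite mulr0 ltxx.
  have [mp|mn] := ltP 0 (b' 1 1); first by exists b'; split => //; left.
  exists (- b'); split; [by right|by rewrite detN| |by rewrite !mxe2; ring].
  by rewrite !mxe2 oppr_gt0 lt_neqAle m00.
pose q := Num.sqrt (b' 0 1 * b' 1 0).
have q0 : 0 < q by rewrite sqrtr_gt0.
have q2 : q ^+ 2 = b2 0 1 * b2 1 0 by rewrite bq sqr_sqrtr // ltW.
(* d^2 is the quotient of the off-diagonal entries: conjugation by the diagonal matrix (d, 1) turns
   both into q. *)
pose d := b2 0 1 / q.
have q00 : q != 0 by rewrite gt_eqF.
have d0 : d != 0.
  by rewrite mulf_neq0 ?invr_eq0 //; apply: contraTneq qq0 => h; rewrite -bq h mul0r ltxx.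
exists (P * mx2 d 0 0 1), l, q, (b2 1 1); split => //.
  by rewrite det_mulmx mulf_neq0 // det2E !mxe2 mulr1 mulr0 subr0.
have m0' : b2 1 1 != 0 by rewrite gt_eqF.
split.
- have h4 : 4 < ((l - l^-1) * q) ^+ 2.
    by rewrite exprMn q2 bq; lra.
  have h2 : 2 < (l - l^-1) * q.
    have : 0 < (l - l^-1) * q by rewrite mulr_gt0.
    by nra.
  have : l * 2 < l * ((l - l^-1) * q) by rewrite ltr_pM2l //; lra.
  have -> : l * ((l - l^-1) * q) = (l ^+ 2 - 1) * q by field.
  by lra.
- have e : a' * (P * mx2 d 0 0 1) = P * mx2 d 0 0 1 * mx2 l 0 0 l^-1.
    rewrite mulrA (conj _ _ aP) -!mulrA; congr (P * _).
    by apply: matrix2P; rewrite !mxe2; ring.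
  by case: aa' => aa'; [left|right]; rewrite -e aa'.
- have e : b2 * mx2 d 0 0 1 = mx2 d 0 0 1 * mx2 ((1 + q ^+ 2) / b2 1 1) q q (b2 1 1).
    have p' : b2 0 0 = (1 + q ^+ 2) / b2 1 1.
      by apply: (mulIf m0'); rewrite divfK // q2; move: b21; rewrite det2E; lra.
    apply: matrix2P; rewrite !mxe2.
    + by rewrite -p'; ring.
    + by rewrite /d; field.
    + rewrite mulr0 addr0 mul0r add0r mul1r /d mulrCA mulrA -q2 expr2 mulfK //.
    + by ring.
  have e' : (b * P = P * b2) \/ (- b * P = P * b2).
    case: bb => ->; [left|right]; first exact: conj.
    by rewrite mulNr mulrN (conj _ _ bP).
  by case: e' => e'; [left|right]; rewrite mulrA e' -(mulrA P b2) e mulrA.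
Qed.

Lemma torus_curves (a : 'I_2 -> 'M[R]_2) : (forall i, \det (a i) = 1) ->
    kappa (a 0) (a 1) < -4 ->
  exists K I O, (forall k, jordan_curve (K k) /\ geometric_circle (K k)) /\
    schottky_curves (fun i => real_mobius (a i)) K I O.
Proof.
move=> a1 kab.
have [T [l [q [m [T0 l1 q0 m0 [lq aT bT]]]]]] := normal_form (a1 0) (a1 1) kab.
have [P [P0 Pm disj]] := torus_model l1 q0 m0 lq.
pose n (i : 'I_2) : 'M[R]_2 := if i == 0 then mx2 l 0 0 l^-1 else mx2 ((1 + q ^+ 2) / m) q q m.
have l0 : l != 0 by rewrite gt_eqF; lra.
have n1 i : \det (n i) = 1.
  by rewrite /n; case: ifP => _; rewrite det2E !mxe2; field; rewrite ?l0 ?gt_eqF.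
pose TC := map_mx (real_complex R) T.
have TC0 : \det TC != 0 by rewrite det_realC -realC0 (inj_eq (@complexI _)).
have act (c d : 'M[R]_2) p : \det c = 1 -> \det d = 1 -> c * T = T * d \/ - c * T = T * d ->
    real_mobius c (mobius TC p) = mobius TC (real_mobius d p).
  have main (c' : 'M[R]_2) : \det c' = 1 -> \det d = 1 -> c' * T = T * d ->
      real_mobius c' (mobius TC p) = mobius TC (real_mobius d p).
    move=> c1 d1 e; rewrite /real_mobius -!mobiusM ?TC0 ?(real_det_neq0 c1) ?(real_det_neq0 d1) //.
    by rewrite -!map_mx2M e.
  move=> c1 d1 [|e]; first exact: main.
  rewrite -(real_mobiusN c1); apply: main => //.
  by rewrite -[RHS]c1 !det2E !mxe2; ring.
apply: (@schottky_of_discs R 2 (fun i => map_mx (real_complex R) (a i)) (fun k => TC * P k)).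
- by move=> i; exact: real_det_neq0.
- by move=> k; rewrite det_mulmx mulf_neq0.
- move=> i p; rewrite !mobiusM //; rewrite Pm -/(n i); symmetry.
  apply: act; rewrite ?a1 ?n1 //.
  by case: (ord2P i) => ->.
- move=> k j kj; have cdE h : closed_disc (TC * P h) = mobius TC @` closed_disc (P h).
    rewrite /closed_disc image_comp; congr (_ @` _).
    by apply: funext => p /=; rewrite mobiusM.
  rewrite !cdE -subset0 => _ [[p kp <-] [p' jp' e]].
  have pp' := mobius_inj TC0 e; rewrite {}pp' in jp'.
  by have : (closed_disc (P k) `&` closed_disc (P j)) p by []; rewrite disj.
Qed.

End NormalForm.

(** * Schottky generators and the main theorem *)

Section KappaBasis.
Variable R : realType.
Local Notation C := R[i].
Local Notation S := (sphere R).
Local Notation gens a := (range (fun i => real_mobius (a i))).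

Lemma real_mobius_inj (a b : 'M[R]_2) : \det a = 1 -> \det b = 1 ->
  real_mobius a = real_mobius b -> a = b \/ a = - b.
Proof.
move=> a1 b1 /(mobius_inj_mx (real_det_neq0 a1) (real_det_neq0 b1))[k k0 e].
have k2 : k ^+ 2 = 1.
  have := congr1 determinant e; rewrite det_realC a1.
  have -> : \det (k *: map_mx (real_complex R) b) = k ^+ 2 * \det (map_mx (real_complex R) b).
    by rewrite !det2E !mxE; ring.
  by rewrite det_realC b1 !realC1 mulr1.
have entry i j : (a i j)%:C = k * (b i j)%:C.
  by have := congr1 (fun m : 'M[C]_2 => m i j) e; rewrite !mxE.
move/eqP: k2; rewrite sqrf_eq1 => /orP[]/eqP k1; [left|right]; apply/matrixP => i j;
  apply: (@complexI R); rewrite entry k1 ?mul1r //.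
by rewrite mulN1r mxE realCN.
Qed.

Lemma generated_word (I : finType) (b : I -> 'M[R]_2) (f : S -> S) :
    (forall i, \det (b i) = 1) -> generated (gens b) f ->
  exists w, f = real_mobius (wmx b w).
Proof.
move=> b1; apply: (@generated_min _ _ [set f | exists w, f = real_mobius (wmx b w)]).
  split.
  - move=> _ [w ->]; exists (map_mx (real_complex R) (wmx b w)) => //.
    by rewrite real_det_neq0 ?det_wmx.
  - exists [::]; apply: funext => p; rewrite /real_mobius /=.
    have -> : map_mx (real_complex R) (1 : 'M[R]_2) = 1.
      by apply: matrix2P; rewrite !mxE.
    by rewrite mobius1.
  - move=> _ _ [w ->] [w' ->]; exists (w ++ w').
    by rewrite wmx_cat real_mobiusM ?det_wmx.
  - move=> _ [w ->]; exists (real_mobius (wmx b (winv w))); first by exists (winv w).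
    rewrite wmx_winv // /real_mobius map_adj2.
    by split; [apply: mobiusK|apply: mobiusVK]; rewrite real_det_neq0 ?det_wmx.
by move=> _ [i _ <-]; exists [:: (i, false)]; rewrite /= mulr1.
Qed.

Lemma wmx_sign (I : eqType) (x y : I -> 'M[R]_2) w :
  (forall i, x i = y i \/ x i = - y i) -> wmx x w = wmx y w \/ wmx x w = - wmx y w.
Proof.
move=> xy; elim: w => [|l w IHw] /=; first by left.
have [e|e] : lmx x l = lmx y l \/ lmx x l = - lmx y l.
  by rewrite /lmx; case: (xy l.1) => ->; case: l.2; rewrite ?adj2N; auto.
all: by case: IHw => ->; rewrite e ?mulNr ?mulrN ?opprK; auto.
Qed.

(* Ping-pong makes a Schottky group free on its generators b, so each b i is a word
   in the c i, themselves words in b, identically in SL(2) over every ring. *)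
Lemma kappa_basis (b c : 'I_2 -> 'M[R]_2) (K I O : 'I_2 * bool -> set S) :
    (forall i, \det (b i) = 1) -> (forall i, \det (c i) = 1) ->
    (forall k, jordan_curve (K k)) -> schottky_curves (fun i => real_mobius (b i)) K I O ->
    generated (gens b) = generated (gens c) ->
  kappa (c 0) (c 1) = kappa (b 0) (b 1).
Proof.
move=> b1 c1 jK sch bc.
have /fin_all_exists[u hu] : forall i, exists w, real_mobius (c i) = real_mobius (wmx b w).
  by move=> i; apply: generated_word => //; rewrite bc; apply: sub_generated; exists i.
have /fin_all_exists[s hs] : forall i, exists w, real_mobius (b i) = real_mobius (wmx c w).
  by move=> i; apply: generated_word => //; rewrite -bc; apply: sub_generated; exists i.
pose x i := map_mx (real_complex R) (b i).
have x0 i : \det (x i) != 0 by exact: real_det_neq0.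
have x1 i : \det (x i) = 1 by rewrite det_realC b1.
have cu i : wmx b (u i) = c i \/ wmx b (u i) = - c i.
  by apply: real_mobius_inj; rewrite ?det_wmx.
(* The word acts as [b i] composed with its inverse, and by ping-pong the only reduced word that
   acts trivially is the empty one. *)
have trivial i : reduce (wsubst u (s i) ++ [:: (i, true)]) = [::].
  set w := _ ++ _.
  apply/eqP; apply: contraT => w0.
  have [p] := word_nontrivial x0 jK sch isT (reduce_reduced w) w0.
  rewrite foldr_reduce; last exact: lactK.
  case; rewrite -[LHS]/((fun p => foldr (lact x) p w) p) (foldr_lact_wmx x0) real_wmx.
  rewrite wmx_cat wmx_subst //= mulr1 real_mobiusM ?det_lmx //; last first.
    by apply: det_wmx => j; exact: det_wmx.
  have -> : real_mobius (wmx (fun j => wmx b (u j)) (s i)) = real_mobius (b i).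
    have sc1 : \det (wmx c (s i)) = 1 by exact: det_wmx.
    by rewrite hs; case: (wmx_sign (s i) cu) => ->; rewrite ?real_mobiusN.
  by rewrite /lmx /= /real_mobius map_adj2 mobiusVK ?real_det_neq0.
have := kappa_word_basis x1 trivial; rewrite /x -!wmx_map !kappa_map => /complexI <-.
have kN (y z y' z' : 'M[R]_2) : y = y' \/ y = - y' -> z = z' \/ z = - z' ->
    kappa y z = kappa y' z'.
  by move=> [->|->] [->|->]; rewrite ?kappaNl ?kappaNr.
by apply/esym/kN.
Qed.

End KappaBasis.

Section MainTheorem.
Variable R : realType.
Local Notation S := (sphere R).

Lemma hyperbolic_lift (f : S -> S) : hyperbolic f ->
  exists a : 'M[R]_2, [/\ \det a = 1, f = real_mobius a & 4 < \tr a ^+ 2].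
Proof.
move=> [M [M1 fM tM]]; exists M; split => //.
by rewrite -real_normK ?num_real //; nra.
Qed.

Lemma hyperbolic_real_mobius (a : 'M[R]_2) : \det a = 1 -> 4 < \tr a ^+ 2 ->
  hyperbolic (real_mobius a).
Proof.
move=> a1 a4; exists a; split => //.
by have := normr_ge0 (\tr a); move: a4; rewrite -(real_normK (num_real (\tr a))); nra.
Qed.

Lemma range_I2 (T : Type) (A : 'I_2 -> T) : range A = [set A 0; A 1].
Proof.
rewrite eqEsubset; split=> [_ [i _ <-]|_ [->|->]]; last 2 first.
- by exists 0.
- by exists 1.
by case: (ord2P i) => ->; [left|right].
Qed.

Lemma classical_on_all_generators (G : set (S -> S)) :
    fuchsian_schottky 2 G ->
    (exists f h : S -> S, [/\ hyperbolic f, hyperbolic h, intersecting_axes f h &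
       G = generated [set f; h]]) ->
  forall A : 'I_2 -> S -> S, G = generated (range A) -> classical_schottky_on A G.
Proof.
move=> [[gG GP _] [B [_ GB [K [I [Ou [jK sch]]]]]]] [f [h [hf hh fh Gfh]]] A GA.
have lift (A' : 'I_2 -> S -> S) : G = generated (range A') ->
    exists a : 'I_2 -> 'M[R]_2, (forall i, \det (a i) = 1) /\ A' = fun i => real_mobius (a i).
  move=> GA'; have [a ha] : exists a : 'I_2 -> 'M[R]_2, forall i,
      \det (a i) = 1 /\ A' i = real_mobius (a i).
    apply: PSL2R_lift => i; apply: GP; rewrite GA'.
    by apply: sub_generated; exists i.
  by exists a; split=> [i|]; [case: (ha i)|apply: funext => i; case: (ha i)].
have [b [b1 Bb]] := lift B GB; have [a [a1 Aa]] := lift A GA.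
have [x [x1 fx x4]] := hyperbolic_lift hf; have [y [y1 hy y4]] := hyperbolic_lift hh.
rewrite {}Bb in sch GB; subst A.
pose c (i : 'I_2) := if i == 0 then x else y.
have c1 i : \det (c i) = 1 by rewrite /c; case: ifP.
have Gc : G = generated (range (fun i => real_mobius (c i))).
  by rewrite range_I2 /c /= -fx -hy.
have kb : kappa (b 0) (b 1) < 0.
  rewrite -(kappa_basis b1 c1 jK sch); last by rewrite -GB -Gc.
  by apply/intersecting_axes_kappa; rewrite ?c1 //= -?fx -?hy.
(* The commutator is a cyclically reduced word, hence hyperbolic: (kappa + 2)^2 > 4, where kappa <
   0. *)
have kb4 : kappa (b 0) (b 1) < -4.
  have red : reduced [:: (0 : 'I_2, false); (1 : 'I_2, false); (0 : 'I_2, true); (1 : 'I_2, true)].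
    by [].
  have last_ne : last (0 : 'I_2, false) [:: (1 : 'I_2, false); (0 : 'I_2, true); (1 : 'I_2, true)]
     <> flip (0 : 'I_2, false) by [].
  have [k [v [hv _]]] := word_attracting (isT : (1 < 2)%N) b1 jK sch red last_ne.
  have [_] := attracting_trace (det_wmx b1 _) hv.
  rewrite /= mulr1 /lmx /= !mulrA kappa_comm //; nra.
have ka4 : kappa (a 0) (a 1) < -4.
  by rewrite (kappa_basis b1 a1 jK sch) // -GB -GA.
have [K' [I' [Ou' [cK' sch']]]] := torus_curves a1 ka4.
split=> //.
- move=> i; exists (map_mx (real_complex R) (a i)) => //.
  exact: real_det_neq0.
- by exists K', I', Ou'.
Qed.

Lemma intersecting_axes_of_classical (g : nat) (G : set (S -> S)) : (2 <= g)%N ->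
    fuchsian_schottky g G ->
    (forall A : 'I_g -> S -> S, G = generated (range A) -> classical_schottky_on A G) ->
  g = 2%N /\ exists f h : S -> S, [/\ hyperbolic f, hyperbolic h, intersecting_axes f h &
    G = generated [set f; h]].
Proof.
move=> g2 [[gG GP _] [B [_ GB _]]] allG.
have [a ha] : exists a : 'I_g -> 'M[R]_2, forall i, \det (a i) = 1 /\ B i = real_mobius (a i).
  by apply: PSL2R_lift => i; apply: GP; rewrite GB; apply: sub_generated; exists i.
have a1 i : \det (a i) = 1 by case: (ha i).
have BE : B = fun i => real_mobius (a i) by apply: funext => i; case: (ha i).
rewrite {}BE in GB.
have gE : g = 2%N.
  apply/eqP; rewrite eqn_leq g2 andbT leqNgt; apply/negP => g3.
  pose i0 : 'I_g := Ordinal (ltn_trans (isT : (0 < 2)%N) g3).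
  pose i1 : 'I_g := Ordinal (ltn_trans (isT : (1 < 2)%N) g3).
  pose i2 : 'I_g := Ordinal g3.
  exact: (@genus_le2 R g G g2 gG allG a i0 i1 i2).
split=> //; subst g.
have k01 := @kappa_neg R 2 G g2 gG allG a 0 1 a1 GB isT.
have [a04 _] := classical_pair g2 a1 (fun=> erefl) (allG _ GB) (isT : (0 : 'I_2) != 1).
have [a14 _] := classical_pair g2 a1 (fun=> erefl) (allG _ GB) (isT : (1 : 'I_2) != 0).
exists (real_mobius (a 0)), (real_mobius (a 1)); split.
- exact: hyperbolic_real_mobius.
- exact: hyperbolic_real_mobius.
- exact/intersecting_axes_kappa.
- by rewrite GB range_I2.
Qed.

End MainTheorem.

Unset Implicit Arguments.

Theorem mainTheorem2 (R : realType) (g : nat) (hg : (2 <= g)%N)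
    (G : set (sphere R -> sphere R)) (hG : fuchsian_schottky g G) :
  (forall A : 'I_g -> sphere R -> sphere R,
     G = generated (range A) -> classical_schottky_on A G) <->
  (g = 2%N /\
   exists f h : sphere R -> sphere R,
     [/\ hyperbolic f, hyperbolic h, intersecting_axes f h &
         G = generated [set f; h]]).
Proof.
split; first exact: intersecting_axes_of_classical.
by move=> [g2]; subst g; exact: classical_on_all_generators.
Qed.
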